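(* Let $\Omega\subset\mathbb{C}$ be a domain and let $w\in\Omega$. If $R>\delta_\Omega(w)$ is a real number such that $$\mathrm{Cap}(E(w,R))<2\delta_\Omega(w),$$ then $$K_\Omega(w)\le\frac{18}{\pi}\cdot\frac{1}{\delta_\Omega(w)^2}\cdot\left(\frac{1}{\log\frac{2\delta_\Omega(w)}{\mathrm{Cap}(E(w,R))}}+\frac{1}{\log\frac{2R}{\delta_\Omega(w)}}\right).$$
   Context: $K_\Omega(w)=K_\Omega(w,w)$ is the Bergman kernel of $\Omega$ on the diagonal, i.e. the reproducing kernel of the space $A^2(\Omega)$ of holomorphic functions on $\Omega$ that are square-integrable with respect to Lebesgue measure. $\delta_\Omega(w)$ is the Euclidean distance from $w$ to $\partial\Omega$. $E(w,R):=\overline{D(w,R)}\setminus\Omega$, where $D(w,R)$ is the open disc of center $w$ and radius $R$. $\mathrm{Cap}$ denotes logarithmic capacity. If $\mathrm{Cap}(E(w,R))=0$, the first term in the parentheses is interpreted as $0$. *)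

(* Defs.v *)
From HB Require Import structures.
From mathcomp Require Import all_boot all_order all_algebra.
From mathcomp Require Import complex.
From mathcomp Require Import all_classical all_reals all_analysis.
From mathcomp Require Import measurable_realfun.

Set Implicit Arguments.
Unset Strict Implicit.
Unset Printing Implicit Defensive.

Import Order.TTheory GRing.Theory Num.Theory.
Import numFieldNormedType.Exports.

Local Open Scope classical_set_scope.
Local Open Scope complex_scope.
Local Open Scope ring_scope.

(* The complex plane is [R[i]^o]: the norm, the topology and the complex
   derivative are those of the field [R[i]] over itself (radii of balls are
   therefore elements of [R[i]]). Its Borel sets and Lebesgue measure are those
   of [R * R], transported by [plane]. *)

Section Plane.
Context {R : realType}.
Implicit Types (A E Omega : set R[i]^o) (w z : R[i]^o).

Definition plane (p : measurableTypeR R * measurableTypeR R) : R[i]^o :=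
  p.1 +i* p.2.

(* modulus, with values in [R] rather than [R[i]] *)
Definition modulus z : R := Normc.normc z.

Definition area :
    {measure set (measurableTypeR R * measurableTypeR R)%type -> \bar R} :=
  (@lebesgue_measure R \x @lebesgue_measure R)%E.

Definition domain Omega := [/\ open Omega, connected Omega & Omega !=set0].

Definition boundary A : set R[i]^o := closure A `\` A°.

(* +oo when the boundary is empty, i.e. for the whole plane *)
Definition boundary_dist Omega w : \bar R :=
  ereal_inf [set (modulus (w - z))%:E | z in boundary Omega].

Definition holomorphic_on Omega (f : R[i]^o -> R[i]^o) :=
  forall z, Omega z -> derivable f z 1.

(* A^2(Omega); its elements are represented by total functions, whose values
   outside Omega play no role *)
Definition bergman_space Omega : set (R[i]^o -> R[i]^o) :=
  [set f | holomorphic_on Omega f /\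
    (\int[area]_(p in plane @^-1` Omega) (modulus (f (plane p)) ^+ 2)%:E
      < +oo)%E].

Definition plane_integral Omega (h : R[i]^o -> R[i]^o) : R[i]^o :=
  Rintegral area (plane @^-1` Omega) (fun p => complex.Re (h (plane p))) +i*
  Rintegral area (plane @^-1` Omega) (fun p => complex.Im (h (plane p))).

Definition is_bergman_kernel Omega (K : R[i]^o -> R[i]^o -> R[i]^o) :=
  forall w, Omega w ->
    bergman_space Omega (K ^~ w) /\
    forall f, bergman_space Omega f ->
      f w = plane_integral Omega (fun z => f z * (K z w)^*).

(* I(mu) = \iint log |z - w| dmu(z) dmu(w), with log 0 = -oo *)
Definition log_energy
    (mu : probability (measurableTypeR R * measurableTypeR R)%type R) : \bar R :=
  (\int[mu]_p \int[mu]_q lne (modulus (plane p - plane q))%:E)%E.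

(* Borel probability measures whose support is a compact subset of E *)
Definition compactly_supported_in E :
    set (probability (measurableTypeR R * measurableTypeR R)%type R) :=
  [set mu | exists F : set R[i]^o,
    [/\ compact F, F `<=` E & mu (plane @^-1` F) = 1%E]].

(* exp (sup_mu I(mu)), which is 0 when every I(mu) is -oo *)
Definition log_capacity E : \bar R :=
  expeR (ereal_sup [set log_energy mu | mu in compactly_supported_in E]).

Definition disc_complement Omega w (r : R) : set R[i]^o :=
  closure (ball w r%:C) `\` Omega.

End Plane.

(* Main.v *)
(* Let f = K(., w), so that f(w) is the squared L^2 norm of f. For a cutoff chi
   supported in Omega and equal to 1 near w, Stokes' theorem applied to
   f chi / (z - w) gives pi f(w) = - int f dbar(chi) / (z - w), hence
   pi^2 K(w, w) <= int |dbar(chi)|^2 / |z - w|^2.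
   We take for chi the product of a smoothed logarithmic cutoff in |z - w|^2,
   supported in D(w, R), and of one in |q|^2, where q is a monic polynomial which
   is small on E(w, R) and large near w. Their Dirichlet energies are computed
   by Stokes' theorem and give the two terms of the bound.
   To find q, let c > Cap E(w, R). If every monic polynomial of degree n with
   roots in E had maximum at least c^n on E, a greedy choice would give Leja points
   in E whose limit distribution has logarithmic energy at least log c, contrary
   to the choice of c. The roots of q are at distance at least delta
   from w, so |q| >= (delta / 2)^n on D(w, delta / 2). *)
Require Import Defs.
From HB Require Import structures.
From mathcomp Require Import all_boot all_order all_algebra.
From mathcomp Require Import complex.
From mathcomp Require Import all_classical all_reals all_analysis.
From mathcomp Require Import measurable_realfun.
From mathcomp Require Import ring lra.

Import Order.TTheory GRing.Theory Num.Theory.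
Import numFieldNormedType.Exports.

Local Open Scope classical_set_scope.
Local Open Scope complex_scope.
Local Open Scope ring_scope.

(** * Wirtinger derivatives *)

(** Every integral identity comes from one form of Stokes' theorem, for functions differentiable at
    each point whose dbar-derivative is continuous. Goursat's bisection proves it, so holomorphic
    functions enter with their bare definition: nothing is assumed of f', and no Cauchy theory is
    needed. The energies are flux integrals too. If H is a primitive of t ramp'(t)^2, the function
    H(|q|^2) q'/q has dbar-derivative |dbar ramp(|q|^2)|^2, and on a large square q'/q is about deg
    q / |z|. The resulting energy is of order deg q / log(b/a), where log(b/a) is itself
    proportional to deg q: the degree cancels, and no control of it is required. The polynomial
    compares Cap with delta/2, while the statement compares it with 2 delta. Losing this factor 4
    inside the logarithm is affordable only if log(2 delta / Cap) is large, whence the separate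
    treatment of large right-hand sides. The constant 18 is fixed by 20 (12/5) = 48 = 18 (8/3) and
    pi >= 8/3: the factor 20 is 5 / (delta/2)^2 without delta^2, and 12/5 pays for the lost factor
    4. *)

Section Wirtinger.
Context {R : realType}.
Implicit Types (z h a b : R[i]) (f g : R[i] -> R[i]) (e d : R).

Lemma modulusE z : modulus z = Num.sqrt (complex.Re z ^+ 2 + complex.Im z ^+ 2).
Proof. by case: z. Qed.

Lemma modulus_normE z : `|z| = (modulus z)%:C.
Proof. by case: z. Qed.

Lemma gt0_complexE {z} : 0 < z -> z = (complex.Re z)%:C.
Proof. by case: z => x y; rewrite ltcE /= => /andP[/eqP ->]. Qed.

Lemma real_complexB (x y : R) : (x - y)%:C = x%:C - y%:C.
Proof. exact: rmorphB. Qed.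

Lemma real_complexM (x y : R) : (x * y)%:C = x%:C * y%:C.
Proof. exact: rmorphM. Qed.

Lemma modulus_ge0 z : 0 <= modulus z.
Proof. by rewrite modulusE sqrtr_ge0. Qed.

Lemma modulus0 : modulus (0 : R[i]) = 0.
Proof. exact: Normc.normc0. Qed.

Lemma modulus_eq0 z : (modulus z == 0) = (z == 0).
Proof.
by apply/eqP/eqP => [/Normc.eq0_normc //|->]; rewrite modulus0.
Qed.

Lemma modulusM z h : modulus (z * h) = modulus z * modulus h.
Proof. exact: Normc.normcM. Qed.

Lemma modulusD z h : modulus (z + h) <= modulus z + modulus h.
Proof. by rewrite -lecR rmorphD /= -!modulus_normE ler_normD. Qed.

Lemma modulusN z : modulus (- z) = modulus z.
Proof. by apply: complexI; rewrite -!modulus_normE normrN. Qed.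

Lemma modulusBC z h : modulus (z - h) = modulus (h - z).
Proof. by rewrite -modulusN opprB. Qed.

Lemma modulusB z h : modulus (z - h) <= modulus z + modulus h.
Proof. by rewrite -(modulusN h) modulusD. Qed.

Lemma modulus_conj z : modulus z^* = modulus z.
Proof. by case: z => x y; rewrite !modulusE /= sqrrN. Qed.

Lemma modulus_real (x : R) : modulus x%:C = `|x|.
Proof. by rewrite modulusE /= expr0n addr0 sqrtr_sqr. Qed.

Lemma modulus_sqr z : modulus z ^+ 2 = complex.Re z ^+ 2 + complex.Im z ^+ 2.
Proof. by rewrite modulusE sqr_sqrtr // addr_ge0 ?sqr_ge0. Qed.

Lemma mul_conj z : z * z^* = (modulus z ^+ 2)%:C.
Proof.
by rewrite modulus_sqr; case: z => x y /=; apply/eqP; rewrite eq_complex /=;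
  apply/andP; split; apply/eqP; ring.
Qed.

Lemma Re_le_modulus z : `|complex.Re z| <= modulus z.
Proof.
by rewrite -sqrtr_sqr modulusE ler_wsqrtr // lerDl sqr_ge0.
Qed.

Lemma Im_le_modulus z : `|complex.Im z| <= modulus z.
Proof.
by rewrite -sqrtr_sqr modulusE ler_wsqrtr // lerDr sqr_ge0.
Qed.

Lemma modulus_le_ReIm z : modulus z <= `|complex.Re z| + `|complex.Im z|.
Proof.
have -> : z = (complex.Re z)%:C + 'i * (complex.Im z)%:C by rewrite -complexE.
apply: (le_trans (modulusD _ _)); rewrite modulusM !modulus_real.
suff -> : modulus 'i%C = 1 :> R by rewrite mul1r -complexE.
by rewrite modulusE /= expr0n add0r expr1n sqrtr1.
Qed.

(* [a] is the derivative of [g] at [z] with respect to z, and [b] the one with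
   respect to the conjugate of z. *)
Definition wirtinger g z a b := forall e, 0 < e -> exists2 d, 0 < d &
  forall h, modulus h < d ->
    modulus (g (z + h) - g z - a * h - b * h^*) <= e * modulus h.

Lemma wirtinger_cst (c : R[i]) z : wirtinger (fun=> c) z 0 0.
Proof.
move=> e e0; exists 1 => // h _.
by rewrite subrr !mul0r !subr0 modulus0 mulr_ge0 ?modulus_ge0 ?ltW.
Qed.

Lemma wirtinger_id z : wirtinger id z 1 0.
Proof.
move=> e e0; exists 1 => // h _.
have -> : z + h - z - 1 * h - 0 * h^* = 0 by ring.
by rewrite modulus0 mulr_ge0 ?modulus_ge0 ?ltW.
Qed.

Lemma wirtinger_conj {g z a b} :
  wirtinger g z a b -> wirtinger (fun z => (g z)^*) z b^* a^*.
Proof.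
move=> gz e /gz[d d0 Hd]; exists d => // h /Hd.
rewrite -(modulus_conj (_ - _ - _ - _)) !rmorphB !rmorphM/= conjCK.
by rewrite -[_ - a^* * _ - _]addrA [- _ - _ in X in modulus X]addrC addrA.
Qed.

Lemma wirtingerD {f g z a b a' b'} : wirtinger f z a b -> wirtinger g z a' b' ->
  wirtinger (fun z => f z + g z) z (a + a') (b + b').
Proof.
move=> fz gz e e0; have e2 : 0 < e / 2 by rewrite divr_gt0.
have [d d0 Hd] := fz _ e2; have [d' d0' Hd'] := gz _ e2.
exists (Num.min d d'); first by rewrite lt_min d0.
move=> h; rewrite lt_min => /andP[/Hd H1 /Hd' H2].
have -> : f (z + h) + g (z + h) - (f z + g z) - (a + a') * h - (b + b') * h^* =
  (f (z + h) - f z - a * h - b * h^*) + (g (z + h) - g z - a' * h - b' * h^*).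
  by ring.
by apply: (le_trans (modulusD _ _)); lra.
Qed.

Lemma wirtinger_lip {g z a b} : wirtinger g z a b -> exists2 d, 0 < d &
  forall h, modulus h < d ->
    modulus (g (z + h) - g z) <= (modulus a + modulus b + 1) * modulus h.
Proof.
move=> /(_ 1 ltr01) [d d0 Hd]; exists d => // h /Hd H.
have -> : g (z + h) - g z = (g (z + h) - g z - a * h - b * h^*) + (a * h + b * h^*).
  by ring.
apply: (le_trans (modulusD _ _)).
have := modulusD (a * h) (b * h^*); rewrite !modulusM modulus_conj; lra.
Qed.

Lemma wirtingerM {f g z a b a' b'} : wirtinger f z a b -> wirtinger g z a' b' ->
  wirtinger (fun z => f z * g z) z (a * g z + f z * a') (b * g z + f z * b').
Proof.
move=> fz gz e e0.
have [d0 d00 L0] := wirtinger_lip fz.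
have [d1 d10 L1] := wirtinger_lip gz.
set A := modulus a + modulus b + 1; set B := modulus a' + modulus b' + 1.
have A1 : 1 <= A by rewrite /A; have := modulus_ge0 a; have := modulus_ge0 b; lra.
have B1 : 1 <= B by rewrite /B; have := modulus_ge0 a'; have := modulus_ge0 b'; lra.
have gz0 := modulus_ge0 (g z); have fz0 := modulus_ge0 (f z).
set M := modulus (g z) + modulus (f z) + 1.
have M0 : 0 < M by rewrite /M; lra.
have e2 : 0 < e / (2 * M) by rewrite divr_gt0 // mulr_gt0.
have [d2 d20 L2] := fz _ e2; have [d3 d30 L3] := gz _ e2.
have d40 : 0 < e / (2 * (A * B)) by rewrite divr_gt0 // !mulr_gt0 //; lra.
exists (Num.min (Num.min d0 d1) (Num.min (Num.min d2 d3) (e / (2 * (A * B))))).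
  by rewrite !lt_min d00 d10 d20 d30.
move=> h; rewrite !lt_min => /andP[/andP[/L0 h0 /L1 h1] /andP[/andP[/L2 h2 /L3 h3] h4]].
have -> : f (z + h) * g (z + h) - f z * g z - (a * g z + f z * a') * h -
    (b * g z + f z * b') * h^* =
  (f (z + h) - f z) * (g (z + h) - g z) +
  (f (z + h) - f z - a * h - b * h^*) * g z +
  f z * (g (z + h) - g z - a' * h - b' * h^*) by ring.
apply: (le_trans (modulusD _ _)).
apply: (@le_trans _ _ (e / 2 * modulus h + e / (2 * M) * modulus h * modulus (g z) +
   modulus (f z) * (e / (2 * M) * modulus h))).
  apply: lerD; last by rewrite modulusM ler_wpM2l.
  apply: (le_trans (modulusD _ _)); rewrite !modulusM lerD //; last by rewrite ler_wpM2r.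
  apply: (@le_trans _ _ (A * modulus h * (B * modulus h))).
    by rewrite ler_pM ?modulus_ge0.
  have -> : A * modulus h * (B * modulus h) = (A * B * modulus h) * modulus h by ring.
  rewrite ler_wpM2r ?modulus_ge0 // mulrC -ler_pdivlMr; last by rewrite mulr_gt0 //; lra.
  by rewrite -mulrA -invfM ltW.
have -> : e / 2 * modulus h + e / (2 * M) * modulus h * modulus (g z) +
   modulus (f z) * (e / (2 * M) * modulus h) =
   (e / 2 + (e / (2 * M)) * (modulus (g z) + modulus (f z))) * modulus h by ring.
rewrite ler_wpM2r ?modulus_ge0 //.
suff : e / (2 * M) * (modulus (g z) + modulus (f z)) <= e / 2 by lra.
rewrite invfM mulrA -mulrA ler_piMr ?divr_ge0 ?ltW //.
by rewrite mulrC ltr_pdivrMr // /M; lra.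
Qed.

Lemma wirtinger_eq {f g z a b a' b'} : wirtinger f z a b ->
  (forall z, f z = g z) -> a = a' -> b = b' -> wirtinger g z a' b'.
Proof. by move=> fz fg <- <-; rewrite (_ : g = f) //; apply/funext. Qed.

Lemma wirtinger_near f g z a b d : 0 < d ->
  (forall y, modulus (y - z) < d -> f y = g y) ->
  wirtinger f z a b -> wirtinger g z a b.
Proof.
move=> d0 fg fz e /fz[d' d'0 H]; exists (Num.min d d'); first by rewrite lt_min d0.
move=> h; rewrite lt_min => /andP[hd /H]; rewrite !fg ?subrr ?modulus0 //.
by rewrite addrC addKr.
Qed.

(** The derivative of a real function, in the same epsilon-delta form as [wirtinger]: the chain rule
    and the gluing of cutoff profiles become direct estimates. *)
Definition rdiff (F : R -> R) (t k : R) := forall e, 0 < e -> exists2 d, 0 < d &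
  forall s, `|s| < d -> `|F (t + s) - F t - k * s| <= e * `|s|.

Lemma is_derive_rdiff (F : R -> R) (t k : R) : is_derive t 1 F k -> rdiff F t k.
Proof.
move=> [dF Fk] e e0.
have /cvgrPdist_le/(_ _ e0) : (fun u : R => u^-1 *: (F (u *: (1 : R) + t) - F t)) @ 0^' --> k.
  by rewrite -Fk.
rewrite /= near_withinE => -[d /= d0 H]; exists d => // s sd.
have [->|s0] := eqVneq s 0; first by rewrite addr0 subrr mulr0 subr0 normr0 mulr0.
have /= := H s; rewrite sub0r normrN => /(_ sd s0).
rewrite -[s *: 1]/(s * 1) mulr1 -[_ *: (F _ - _)]/(_ * (F _ - _)) => H1.
have -> : F (t + s) - F t - k * s = - ((k - s^-1 * (F (s + t) - F t)) * s).
  by rewrite [s + t]addrC; field.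
by rewrite normrN normrM ler_wpM2r.
Qed.

Lemma wirtinger_comp {F : R -> R} {T : R[i] -> R} {z a b k} :
  wirtinger (fun z => (T z)%:C) z a b -> rdiff F (T z) k ->
  wirtinger (fun z => (F (T z))%:C) z (k%:C * a) (k%:C * b).
Proof.
move=> Tz Fk e e0.
have [d0 d00 L0] := wirtinger_lip Tz.
set A := modulus a + modulus b + 1 in L0.
have A1 : 1 <= A by rewrite /A; have := modulus_ge0 a; have := modulus_ge0 b; lra.
have e1 : 0 < e / (2 * A) by rewrite divr_gt0 // mulr_gt0 //; lra.
have [d1 d10 L1] := Fk _ e1.
have k0 : 0 < `|k| + 1 by have := normr_ge0 k; lra.
have e2 : 0 < e / (2 * (`|k| + 1)) by rewrite divr_gt0 // mulr_gt0.
have [d2 d20 L2] := Tz _ e2.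
have dA : 0 < d1 / A by rewrite divr_gt0 //; lra.
exists (Num.min d0 (Num.min (d1 / A) d2)); first by rewrite !lt_min d00 dA.
move=> h; rewrite !lt_min => /andP[/L0 h0 /andP[h1 /L2 h2]].
rewrite -real_complexB modulus_real in h0.
have /L1 h3 : `|T (z + h) - T z| < d1.
  by apply: (le_lt_trans h0); rewrite mulrC -ltr_pdivlMr //; lra.
have -> : (F (T (z + h)))%:C - (F (T z))%:C - k%:C * a * h - k%:C * b * h^* =
 (F (T z + (T (z + h) - T z)) - F (T z) - k * (T (z + h) - T z))%:C +
 k%:C * ((T (z + h))%:C - (T z)%:C - a * h - b * h^*).
  rewrite [T z + _]addrC subrK.
  by rewrite !(real_complexB, real_complexM); ring.
apply: (le_trans (modulusD _ _)); rewrite modulusM !modulus_real.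
have -> : e * modulus h = e / 2 * modulus h + e / 2 * modulus h by field.
apply: lerD.
  apply: (le_trans h3); apply: (@le_trans _ _ (e / (2 * A) * (A * modulus h))).
    by rewrite ler_wpM2l // ltW.
  by rewrite mulrA ler_wpM2r ?modulus_ge0 // le_eqVlt; apply/orP; left; apply/eqP; field; lra.
apply: (le_trans (ler_wpM2l (normr_ge0 _) h2)).
rewrite mulrA ler_wpM2r ?modulus_ge0 //.
have -> : `|k| * (e / (2 * (`|k| + 1))) = e / 2 * (`|k| / (`|k| + 1)).
  by field; lra.
by rewrite ler_piMr ?divr_ge0 ?ltW // ltr_pdivrMr //; lra.
Qed.

(** Complex differentiability means that the first-order expansion has no term in the conjugate of
    h. The coefficient [a] may depend on z in any way, since Stokes' theorem asks for continuity of
    the other coefficient only. *)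
Lemma holomorphic_wirtinger (g : R[i]^o -> R[i]^o) (z : R[i]^o) :
  derivable g z 1 -> exists a, wirtinger g z a 0.
Proof.
move=> /cvg_ex[/= k gk]; exists k => e e0.
have e0' : 0 < e%:C by rewrite ltcR.
move/cvgrPdist_le : gk => /(_ _ e0').
rewrite /= near_withinE => -[d /= d0 H].
have dE := gt0_complexE d0.
exists (complex.Re d); first by rewrite -ltcR -dE.
move=> h hd; have [->|h0] := eqVneq h 0.
  rewrite addr0 subrr rmorph0 !mulr0 !subr0 modulus0 mulr0 //.
have /= := H h; rewrite sub0r normrN modulus_normE {1}dE ltcR => /(_ hd h0).
rewrite -[h *: 1]/(h * 1) mulr1 -[_ *: (g _ - _)]/(_ * (g _ - _)) modulus_normE lecR => H1.
have -> : g (z + h) - g z - k * h - 0 * h^* = - ((k - h^-1 * (g (h + z) - g z)) * h).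
  by rewrite [h + z]addrC; field.
by rewrite modulusN modulusM ler_wpM2r ?modulus_ge0.
Qed.

End Wirtinger.

(** * Integration over squares and Stokes' theorem *)

Section PlaneMeasure.
Context {R : realType}.
Local Notation RR := (measurableTypeR R * measurableTypeR R)%type.
Local Notation leb := (@lebesgue_measure R).

Lemma continuous_plane : continuous (plane : R * R -> R[i]^o).
Proof.
move=> p; apply/cvgrPdist_lt => e e0.
have eE := gt0_complexE e0.
have d0 : 0 < complex.Re e by rewrite -ltcR -eE.
have d2 : 0 < complex.Re e / 2 by rewrite divr_gt0.
exists (ball p.1 (complex.Re e / 2), ball p.2 (complex.Re e / 2)).
  by split; apply: nbhsx_ballx.
move=> [x y] [/= bx byy]; rewrite modulus_normE eE ltcR.
apply: (le_lt_trans (modulus_le_ReIm _)) => /=.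
by move: bx byy; rewrite /ball /= => ? ?; lra.
Qed.

(** [area] lives on the product sigma-algebra, so open sets must be built from products: an open set
    is the union of the rational open squares that it contains. *)
Lemma open_plane_measurable (A : set (R * R)) : open A -> measurable (A : set RR).
Proof.
move=> oA.
pose box (q : rat * rat * rat) : set (R * R) :=
  `](ratr q.1.1 - ratr q.2 : R), ratr q.1.1 + ratr q.2[%classic `*`
  `](ratr q.1.2 - ratr q.2 : R), ratr q.1.2 + ratr q.2[%classic.
pose F q := if `[< box q `<=` A >] then box q else set0.
have -> : A = \bigcup_q F q.
  apply/seteqP; split=> [[x y] Axy|p [q _]]; last first.
    by rewrite /F; case: asboolP => // H /H.
  have : nbhs (x, y) A by apply: open_nbhs_nbhs.
  case=> -[U V] [/= /nbhs_ballP[d /= d0 HU] /nbhs_ballP[d' /= d'0 HV]] UV.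
  pose m := Num.min d d'; have m0 : 0 < m by rewrite lt_min d0.
  (* With a centre within m/8 of the point in each coordinate, a half-side above m/8 captures the
     point, and one below m/4 keeps the square within 3m/8 < m of it. *)
  have [r] : exists r : rat, ratr r \in `]m / 8, m / 4[.
    by apply: rat_in_itvoo; lra.
  rewrite in_itv /= => /andP[r1 r2].
  have [a] : exists r : rat, ratr r \in `]x - m / 8, x + m / 8[.
    by apply: rat_in_itvoo; lra.
  rewrite in_itv /= => /andP[a1 a2].
  have [b] : exists r : rat, ratr r \in `]y - m / 8, y + m / 8[.
    by apply: rat_in_itvoo; lra.
  rewrite in_itv /= => /andP[b1 b2].
  exists (a, b, r) => //; rewrite /F; case: asboolP => [_|]; last first.
    case=> -[u v] [/=]; rewrite !in_itv /= => /andP[u1 u2] /andP[v1 v2].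
    apply: UV; split; [apply: HU|apply: HV]; rewrite /ball /= ltr_norml.
      by have : m <= d; [rewrite ge_min lexx|lra].
    by have : m <= d'; [rewrite ge_min lexx orbT|lra].
  by split; rewrite /= in_itv /=; apply/andP; split; lra.
apply: countable_bigcupT_measurable; first exact: countableP.
move=> q; rewrite /F; case: asboolP => // _; exact: measurableX.
Qed.

Lemma continuous_plane_measurable (f : R * R -> R) : continuous f ->
  measurable_fun [set: RR] (f : RR -> measurableTypeR R).
Proof.
move=> cf; apply: (measurability _ (RGenOpens.measurableE R)).
move=> _ [_ [a [b ->] <-]]; rewrite setTI; apply: open_plane_measurable.
by move/continuousP : cf; apply; exact: interval_open.
Qed.

(** Half-open, so that bisection cuts a square into four disjoint squares of the same kind. *)
Definition square (x y l : R) : set RR := `[x, x + l[ `*` `[y, y + l[.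

Lemma measurable_square x y l : measurable (square x y l).
Proof. exact: measurableX. Qed.

Lemma area_square x y l : 0 <= l -> area (square x y l) = (l ^+ 2)%:E.
Proof.
move=> l0.
have -> : area (square x y l) = (leb `[x, (x + l)%R[ * leb `[y, (y + l)%R[)%E.
  exact: product_measure1E.
rewrite !lebesgue_measure_itv /= !lte_fin.
rewrite !ltrDl -!EFinB ![_ + l - _]addrAC !subrr !add0r.
by case: ltrP => l1; [rewrite -EFinM -expr2|rewrite (@le_anti _ _ l 0) ?l0 ?l1 // mul0e expr0n].
Qed.

Lemma integrable_square (f : R * R -> R) x y l : continuous f ->
  area.-integrable (square x y l) (EFin \o f).
Proof.
move=> cf; have [l0|l0] := leP 0 l; last first.
  rewrite (_ : square x y l = set0); first exact: integrable_set0.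
  by rewrite -subset0 => -[a b] [/=]; rewrite !in_itv /=; lra.
apply: measurable_bounded_integrable; first exact: measurable_square.
- by rewrite area_square // ltry.
- by apply: measurable_funS (continuous_plane_measurable f cf).
have : compact (f @` (`[x, x + l] `*` `[y, y + l])).
  apply: continuous_compact; first by apply: continuous_subspaceT.
  by apply: compact_setX; apply: segment_compact.
move=> /compact_bounded[M [Mr HM]]; exists M; split => // N MN p [/= p1 p2].
apply: (HM N MN); exists p => //; split; move: p1 p2; rewrite /= !in_itv /=; lra.
Qed.

Lemma integrable_co (f : R -> R) a b : continuous f ->
  leb.-integrable `[a, b[ (EFin \o f).
Proof.
move=> cf; have ic : leb.-integrable `[a, b] (EFin \o f).
  by apply: continuous_compact_integrable; [exact: segment_compact|exact: continuous_subspaceT].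
by apply: integrableS ic => //; apply: subset_itvl; rewrite bnd_simp.
Qed.

Lemma Rintegral_co_split (f : R -> R) a b c : continuous f -> a <= b -> b <= c ->
  (\int[leb]_(x in `[a, c[) f x) =
  (\int[leb]_(x in `[a, b[) f x) + (\int[leb]_(x in `[b, c[) f x).
Proof.
move=> cf ab bc; rewrite -Rintegral_setU //.
- by congr Rintegral; rewrite -itv_bndbnd_setU // bnd_simp.
- by rewrite -itv_bndbnd_setU ?bnd_simp //; apply: integrable_co.
- apply/disj_setPS => u [/=]; rewrite !in_itv /=; lra.
Qed.

Lemma Rintegral_square_split (f : R * R -> R) x y l : continuous f -> 0 <= l ->
  (\int[area]_(p in square x y (l + l)) f p) =
  (\int[area]_(p in square x y l) f p) + (\int[area]_(p in square (x + l) y l) f p) +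
  ((\int[area]_(p in square x (y + l) l) f p) +
   (\int[area]_(p in square (x + l) (y + l) l) f p)).
Proof.
move=> cf l0.
have I u v := integrable_square f u v l cf.
have I2 u v := integrable_square f u v (l + l) cf.
have ms := measurable_square.
rewrite -!Rintegral_setU //.
- congr Rintegral; apply/seteqP; split => [[a b]|[a b]]; rewrite /square /setX /setU /= !in_itv /=.
  + move=> [a1 b1]; case: (ltP a (x + l)) => a2; case: (ltP b (y + l)) => b2;
    by [left; left; lra|left; right; lra|right; left; lra|right; right; lra].
  + by move=> [[]|[]]; lra.
- exact: measurableU.
- exact: measurableU.
- apply: (integrableS _ _ _ (I2 x y)) => //; first by apply: measurableU; apply: measurableU.
  by move=> [a b]; rewrite /square /setX /setU /= !in_itv /= => -[[]|[]]; lra.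
- by apply/disj_setPS => -[a b]; rewrite /square /setX /setU /setI /= !in_itv /=; lra.
- apply: (integrableS _ _ _ (I2 x y)) => //; first by apply: measurableU.
  by move=> [a b]; rewrite /square /setX /setU /= !in_itv /=; lra.
- by apply/disj_setPS => -[a b]; rewrite /square /setX /setU /setI /= !in_itv /=; lra.
- apply: (integrableS _ _ _ (I2 x y)) => //; first by apply: measurableU.
  by move=> [a b]; rewrite /square /setX /setU /= !in_itv /=; lra.
- by apply/disj_setPS => -[a b]; rewrite /square /setX /setU /setI /= !in_itv /=; lra.
Qed.

Lemma Rintegral_co_near (f : R -> R) a l k e : continuous f -> 0 <= l ->
  (forall t, a <= t <= a + l -> `|f t - k| <= e) ->
  `| (\int[leb]_(x in `[a, a + l[) f x) - k * l | <= e * l.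
Proof.
move=> cf l0 H.
have ll : leb `[a, a + l[ = l%:E.
  rewrite lebesgue_measure_itv /= lte_fin ltrDl -EFinB [_ + l - _]addrAC subrr add0r.
  by case: ltrP => // l1; congr EFin; lra.
have cst m : (\int[leb]_(x in `[a, a + l[) m) = m * l.
  by rewrite Rintegral_cst //; congr (m * _); exact: (congr1 fine ll).
have ik m : leb.-integrable `[a, a + l[ (EFin \o (fun=> m)).
  by apply: integrable_co => ?; exact: cvg_cst.
rewrite ler_norml; apply/andP; split.
  suff : (k - e) * l <= \int[leb]_(x in `[a, a + l[) f x by lra.
  rewrite -(cst (k - e)); apply: le_Rintegral => //; first exact: integrable_co.
  move=> t /=; rewrite in_itv /= => /andP[t1 t2].
  by have : a <= t <= a + l; [lra|move/H; rewrite ler_norml; lra].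
suff : \int[leb]_(x in `[a, a + l[) f x <= (k + e) * l by lra.
rewrite -(cst (k + e)); apply: le_Rintegral => //; first exact: integrable_co.
move=> t /=; rewrite in_itv /= => /andP[t1 t2].
by have : a <= t <= a + l; [lra|move/H; rewrite ler_norml; lra].
Qed.

Lemma Rintegral_square_near (f : R * R -> R) x y l k e : continuous f -> 0 <= l ->
  (forall u v, x <= u <= x + l -> y <= v <= y + l -> `|f (u, v) - k| <= e) ->
  `| (\int[area]_(p in square x y l) f p) - k * l ^+ 2 | <= e * l ^+ 2.
Proof.
move=> cf l0 H.
have ms := measurable_square x y l.
have cst m : (\int[area]_(p in square x y l) m) = m * l ^+ 2.
  by rewrite Rintegral_cst //; congr (m * _); exact: (congr1 fine (area_square _ _ _ l0)).
have ik m : area.-integrable (square x y l) (EFin \o (fun=> m)).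
  by apply: integrable_square => ?; exact: cvg_cst.
have H' u v : square x y l (u, v) -> k - e <= f (u, v) <= k + e.
  rewrite /square /setX /= !in_itv /= => -[/andP[u1 u2] /andP[v1 v2]].
  have /H H1 : x <= u <= x + l by lra.
  by have /H1 : y <= v <= y + l; [lra|rewrite ler_norml; lra].
rewrite ler_norml; apply/andP; split.
  suff : (k - e) * l ^+ 2 <= \int[area]_(p in square x y l) f p by lra.
  rewrite -(cst (k - e)); apply: le_Rintegral => //; first exact: integrable_square.
  by move=> [u v] /H' /andP[].
suff : \int[area]_(p in square x y l) f p <= (k + e) * l ^+ 2 by lra.
rewrite -(cst (k + e)); apply: le_Rintegral => //; first exact: integrable_square.
by move=> [u v] /H' /andP[].
Qed.

End PlaneMeasure.

(** * The divergence theorem on squares, by bisection *)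

Section Divergence.
Context {R : realType}.
Local Notation leb := (@lebesgue_measure R).
Implicit Types (A B c : R * R -> R) (x y l : R).

(** Total differentiability of the field (A, B) at one point. The four partial derivatives are
    existentially quantified, so only their combination [c] can be asked to be continuous. *)
Definition has_divergence A B (p : R * R) (c : R) :=
  exists a1 a2 b1 b2, a1 + b2 = c /\ forall e, 0 < e -> exists2 d, 0 < d &
  forall s t, `|s| < d -> `|t| < d ->
    `|A (p.1 + s, p.2 + t) - A p - a1 * s - a2 * t| <= e * (`|s| + `|t|) /\
    `|B (p.1 + s, p.2 + t) - B p - b1 * s - b2 * t| <= e * (`|s| + `|t|).

(** The counterclockwise boundary integral of A dy - B dx, that is, the outward flux of (A, B). *)
Definition flux A B x y l :=
  ((\int[leb]_(t in `[y, y + l[) A (x + l, t)) - (\int[leb]_(t in `[y, y + l[) A (x, t))) +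
  ((\int[leb]_(s in `[x, x + l[) B (s, y + l)) - (\int[leb]_(s in `[x, x + l[) B (s, y))).

Lemma continuous_slice1 A x : continuous A -> continuous (fun t => A (x, t)).
Proof.
move=> cA t.
have xt : (fun u : R => (x, u)) @ t --> (x, t).
  move=> P [[U V] [/= HU HV] UV]; apply: (filterS _ HV) => u Vu.
  by apply: UV; split => //; exact: nbhs_singleton HU.
exact: (cvg_comp (fun u : R => (x, u)) A xt (cA (x, t))).
Qed.

Lemma continuous_slice2 A y : continuous A -> continuous (fun s => A (s, y)).
Proof.
move=> cA t.
have ty : (fun u : R => (u, y)) @ t --> (t, y).
  move=> P [[U V] [/= HU HV] UV]; apply: (filterS _ HU) => u Vu.
  by apply: UV; split => //; exact: nbhs_singleton HV.
exact: (cvg_comp (fun u : R => (u, y)) A ty (cA (t, y))).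
Qed.

Lemma nested_point (x l : nat -> R) : (forall n, 0 <= l n) ->
  (forall n, x n <= x n.+1) -> (forall n, x n.+1 + l n.+1 <= x n + l n) ->
  exists x0, forall n, x n <= x0 <= x n + l n.
Proof.
move=> l0 xn ln.
have mx m n : (m <= n)%N -> x m <= x n.
  by move=> /subnK <-; elim: (n - m)%N => // k IH; rewrite addSn (le_trans IH).
have ml m n : (m <= n)%N -> x n + l n <= x m + l m.
  by move=> /subnK <-; elim: (n - m)%N => // k IH; rewrite addSn (le_trans _ IH).
have xl m n : x m <= x n + l n.
  have [mn|nm] := leP m n; first by apply: (le_trans (mx _ _ mn)); rewrite lerDl.
  by apply: (le_trans _ (ml _ _ (ltnW nm))); rewrite lerDl.
have ub m : ubound (range x) (x m + l m) by move=> _ [k _ <-].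
exists (sup (range x)) => n; apply/andP; split.
  by apply: ub_le_sup; [exists (x 0 + l 0) | exists n].
by apply: ge_sup; [exists (x 0), 0 | exact: ub].
Qed.

Section Goursat.
Variables (A B c : R * R -> R).
Hypotheses (cA : continuous A) (cB : continuous B) (cc : continuous c).
Hypothesis div : forall p, has_divergence A B p (c p).

(** The defect in the divergence theorem. It is additive under subdivision and o(l^2) on squares
    shrinking to a point, which forces it to vanish. *)
Let Phi x y l := flux A B x y l - \int[area]_(p in square x y l) c p.

Let Phi_split x y l : 0 <= l ->
  Phi x y (l + l) = Phi x y l + Phi (x + l) y l + Phi x (y + l) l + Phi (x + l) (y + l) l.
Proof.
move=> l0; rewrite /Phi Rintegral_square_split // /flux.
have sA u v := Rintegral_co_split _ v (v + l) (v + (l + l)) (continuous_slice1 A u cA).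
have sB u v := Rintegral_co_split _ u (u + l) (u + (l + l)) (continuous_slice2 B v cB).
rewrite !{}sA ?{}sB ?lerD2l ?lerDl ?lerDr // !addrA.
by ring.
Qed.

Let Phi_local e (p : R * R) : 0 < e -> exists2 d, 0 < d & forall x y l, 0 <= l < d ->
  x <= p.1 <= x + l -> y <= p.2 <= y + l -> `|Phi x y l| <= e * l ^+ 2.
(* The share e/9: each of the two pairs of opposite sides errs by at most 4 shares of l^2, and the
   area integral by one. *)
Proof.
move=> e0; have e9 : 0 < e / 9 by rewrite divr_gt0.
have [a1 [a2 [b1 [b2 [abc /(_ _ e9)[d d0 H]]]]]] := div p.
have /cvgrPdist_le/(_ _ e9) := cc p.
move=> [[U V] [/= /nbhs_ballP[d1 /= d10 HU] /nbhs_ballP[d2 /= d20 HV]] UV].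
exists (Num.min d (Num.min d1 d2)); first by rewrite !lt_min d0 d10.
move=> x y l /andP[l0]; rewrite !lt_min => /andP[ld /andP[ld1 ld2]] /andP[x1 x2] /andP[y1 y2].
have HA s t : x <= s <= x + l -> y <= t <= y + l ->
    `|A (s, t) - A p - a1 * (s - p.1) - a2 * (t - p.2)| <= e / 9 * (2 * l) /\
    `|B (s, t) - B p - b1 * (s - p.1) - b2 * (t - p.2)| <= e / 9 * (2 * l).
  move=> /andP[s1 s2] /andP[t1 t2].
  have sl : `|s - p.1| <= l by rewrite ler_norml; lra.
  have tl : `|t - p.2| <= l by rewrite ler_norml; lra.
  have := H (s - p.1) (t - p.2) (le_lt_trans sl ld) (le_lt_trans tl ld).
  rewrite !subrKC => -[h1 h2]; split; [apply: (le_trans h1)|apply: (le_trans h2)];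
    by rewrite ler_pM2l //; lra.
have hx0 : x <= x <= x + l by lra.
have hx1 : x <= x + l <= x + l by lra.
have hy0 : y <= y <= y + l by lra.
have hy1 : y <= y + l <= y + l by lra.
have FA : `|(\int[leb]_(t in `[y, y + l[) A (x + l, t)) - (\int[leb]_(t in `[y, y + l[) A (x, t))
     - a1 * l * l| <= e / 9 * (4 * l) * l.
  rewrite -RintegralB //; try by apply: integrable_co; exact: continuous_slice1.
  apply: Rintegral_co_near => //.
    by move=> t; apply: continuousB; exact: continuous_slice1.
  move=> t ty; have [h1 _] := HA (x + l) t hx1 ty; have [h2 _] := HA x t hx0 ty.
  have h3 : 0 <= e / 9 * l by rewrite mulr_ge0 // ltW.
  move: h1 h2; rewrite !ler_norml; lra.
have FB : `|(\int[leb]_(s in `[x, x + l[) B (s, y + l)) - (\int[leb]_(s in `[x, x + l[) B (s, y))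
     - b2 * l * l| <= e / 9 * (4 * l) * l.
  rewrite -RintegralB //; try by apply: integrable_co; exact: continuous_slice2.
  apply: Rintegral_co_near => //.
    by move=> t; apply: continuousB; exact: continuous_slice2.
  move=> s sx; have [_ h1] := HA s (y + l) sx hy1; have [_ h2] := HA s y sx hy0.
  have h3 : 0 <= e / 9 * l by rewrite mulr_ge0 // ltW.
  move: h1 h2; rewrite !ler_norml; lra.
have FC : `|(\int[area]_(p in square x y l) c p) - c p * l ^+ 2| <= e / 9 * l ^+ 2.
  apply: Rintegral_square_near => // u v u1 v1.
  have Uu : U u by apply: HU; rewrite /ball /= ltr_norml; lra.
  have Vv : V v by apply: HV; rewrite /ball /= ltr_norml; lra.
  by rewrite distrC; have /= := UV (u, v) (conj Uu Vv).
rewrite -abc in FC; rewrite /Phi /flux.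
have h4 : a1 * l * l = a1 * l ^+ 2 by ring.
have h5 : b2 * l * l = b2 * l ^+ 2 by ring.
have h6 : e / 9 * (4 * l) * l = e / 9 * 4 * l ^+ 2 by ring.
move: FA FB FC; rewrite {}h4 {}h5 {}h6 !ler_norml; lra.
Qed.

(* Goursat's bisection: no integrability of the partial derivatives is assumed *)
Lemma divergence_square x y l : 0 < l ->
  flux A B x y l = \int[area]_(p in square x y l) c p.
Proof.
move=> l0; apply/eqP; rewrite -subr_eq0 -/(Phi x y l); apply/negPn/negP => Phi0.
pose eta := `|Phi x y l| / l ^+ 2.
have eta0 : 0 < eta by rewrite divr_gt0 ?normr_gt0 // exprn_gt0.
pose bad (q : R * R * R) := `|Phi q.1.1 q.1.2 q.2| >= eta * q.2 ^+ 2 /\ 0 < q.2.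
pose good (q q' : R * R * R) := [/\ bad q', q'.2 = q.2 / 2,
  q.1.1 <= q'.1.1 <= q.1.1 + q.2 / 2 & q.1.2 <= q'.1.2 <= q.1.2 + q.2 / 2].
(* If all four quarters had a defect below [eta] times their squared side, additivity would put the
   defect of the whole square below [eta] times its squared side. *)
have step q : bad q -> exists q', good q q'.
  case: q => -[u v] m [/= Hq m0]; apply: contrapT => /forallNP no.
  have small a b : u <= a <= u + m / 2 -> v <= b <= v + m / 2 ->
      `|Phi a b (m / 2)| < eta * (m / 2) ^+ 2.
    move=> ha hb; rewrite ltNge; apply/negP => h.
    by apply: (no ((a, b), m / 2)); split => //; split => //=; lra.
  have Em : m / 2 + m / 2 = m by field.
  move: Hq; have := Phi_split u v (m / 2); rewrite Em => ->; last by lra.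
  have h1 : `|Phi u v (m / 2)| < eta * (m / 2) ^+ 2 by apply: small; lra.
  have h2 : `|Phi (u + m / 2) v (m / 2)| < eta * (m / 2) ^+ 2 by apply: small; lra.
  have h3 : `|Phi u (v + m / 2) (m / 2)| < eta * (m / 2) ^+ 2 by apply: small; lra.
  have h4 : `|Phi (u + m / 2) (v + m / 2) (m / 2)| < eta * (m / 2) ^+ 2 by apply: small; lra.
  apply/negP; rewrite -ltNge.
  apply: (le_lt_trans (ler_normD _ _)).
  apply: (le_lt_trans (lerD (ler_normD _ _) (lexx _))).
  apply: (le_lt_trans (lerD (lerD (ler_normD _ _) (lexx _)) (lexx _))).
  have -> : eta * m ^+ 2 = 4 * (eta * (m / 2) ^+ 2) by field.
  lra.
pose nxt q := xget q (good q).
pose Q n := iter n nxt (x, y, l).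
have Qbad n : bad (Q n).
  elim: n => [|n IH]; first by split=> //=; rewrite /eta divfK // expf_neq0 // gt_eqF.
  rewrite /Q iterS -/(Q n) /nxt; case: xgetP => [q' -> []//|].
  by have [q' h] := step _ IH; move=> /(_ q').
have Qgood n : good (Q n) (Q n.+1).
  rewrite [Q n.+1]iterS -/(Q n) /nxt; case: xgetP => [q' -> //|].
  by have [q' h] := step _ (Qbad n); move=> /(_ q').
have [x0 Hx0] : exists x0, forall n, (Q n).1.1 <= x0 <= (Q n).1.1 + (Q n).2.
  apply: nested_point => n; first by have [_ /ltW] := Qbad n.
  - by have [_ _ /andP[]] := Qgood n.
  - by have [_ -> /andP[_ h] _] := Qgood n; have [_ h'] := Qbad n; lra.
have [y0 Hy0] : exists y0, forall n, (Q n).1.2 <= y0 <= (Q n).1.2 + (Q n).2.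
  apply: nested_point => n; first by have [_ /ltW] := Qbad n.
  - by have [_ _ _ /andP[]] := Qgood n.
  - by have [_ -> _ /andP[_ h]] := Qgood n; have [_ h'] := Qbad n; lra.
(* Around the common point of the nested squares the defect is at most half of what badness
   requires. *)
have eta2 : 0 < eta / 2 by rewrite divr_gt0.
have [d d0 H] := Phi_local _ (x0, y0) eta2.
have Ql n : (Q n).2 = l / 2 ^+ n.
  elim: n => [|n IH]; first by rewrite expr0 divr1.
  by have [_ -> _ _] := Qgood n; rewrite IH exprS; field; rewrite expf_neq0.
have [n Hn] : exists n, (Q n).2 < d.
  have /archi_boundP := divr_ge0 (ltW l0) (ltW d0).
  set n := Num.bound _ => nb; exists n; rewrite Ql ltr_pdivrMr ?exprn_gt0 //.
  rewrite mulrC -ltr_pdivrMr //; apply: (lt_trans nb).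
  by rewrite -natrX ltr_nat ltn_expl.
have [h1 h2] := Qbad n.
have := H (Q n).1.1 (Q n).1.2 (Q n).2 _ (Hx0 n) (Hy0 n).
rewrite Hn ltW // => /(_ isT) h3.
have := le_trans h1 h3; rewrite ler_pM2r ?exprn_gt0 //; lra.
Qed.

End Goursat.
End Divergence.

(** * Stokes' theorem for the dbar-derivative *)

Section ComplexStokes.
Context {R : realType}.
Local Notation leb := (@lebesgue_measure R).
Implicit Types (z w : R[i]).

Lemma continuous_atP (g : R[i]^o -> R[i]^o) (z : R[i]^o) :
  {for z, continuous g} <-> forall e : R, 0 < e -> exists2 d : R, 0 < d &
    forall y : R[i]^o, modulus (y - z) < d -> modulus (g y - g z) < e.
Proof.
split=> [/cvgrPdist_lt gz e e0|gz].
  have e0' : 0 < e%:C by rewrite ltcR.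
  have [d /= d0 H] := gz _ e0'.
  have dE := gt0_complexE d0.
  exists (complex.Re d); first by rewrite -ltcR -dE.
  move=> y yz; have := H y; rewrite /ball_ /= !modulus_normE ltcR dE ltcR.
  by rewrite modulusBC => /(_ yz); rewrite modulusBC.
apply/(@cvgrPdist_lt _ _ _ (nbhs z)) => e e0.
have eE := gt0_complexE e0.
have e0' : 0 < complex.Re e by rewrite -ltcR -eE.
have [d d0 H] := gz _ e0'.
exists d%:C; first by rewrite /= ltcR.
move=> y; rewrite /ball_ /= !modulus_normE ltcR eE ltcR => yz.
by rewrite modulusBC; apply: H; rewrite modulusBC.
Qed.

Lemma continuous_Re : continuous (@complex.Re R : R[i]^o -> R).
Proof.
move=> z; apply/(@cvgrPdist_lt _ _ _ (nbhs (z : R[i]^o))) => e e0; exists e%:C; first by rewrite /= ltcR.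
move=> y; rewrite /ball_ /= modulus_normE ltcR => yz.
apply: (le_lt_trans _ yz); rewrite (le_trans _ (Re_le_modulus _)) //.
by case: (z) (y) => [a b] [a' b'].
Qed.

Lemma continuous_Im : continuous (@complex.Im R : R[i]^o -> R).
Proof.
move=> z; apply/(@cvgrPdist_lt _ _ _ (nbhs (z : R[i]^o))) => e e0; exists e%:C; first by rewrite /= ltcR.
move=> y; rewrite /ball_ /= modulus_normE ltcR => yz.
apply: (le_lt_trans _ yz); rewrite (le_trans _ (Im_le_modulus _)) //.
by case: (z) (y) => [a b] [a' b'].
Qed.

Lemma continuous_conj : continuous (Num.conj : R[i]^o -> R[i]^o).
Proof.
move=> z; apply/continuous_atP => e e0; exists e => // y.
by rewrite -rmorphB modulus_conj.
Qed.

Lemma continuous_real_complex : continuous (fun t : R => t%:C : R[i]^o).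
Proof.
move=> t; apply/(@cvgrPdist_lt _ _ _ (nbhs (t : R))) => e e0.
have eE := gt0_complexE e0.
exists (complex.Re e); first by rewrite /= -ltcR -eE.
by move=> s; rewrite /ball_ /= => ts; rewrite -real_complexB modulus_normE modulus_real eE ltcR.
Qed.

Lemma continuous_scale {T : topologicalType} (k : R) {f : T -> R} :
  continuous f -> continuous (fun p => k * f p).
Proof. by move=> cf p; apply: cvgMl_tmp; exact: cf. Qed.

Lemma wirtinger_continuous {g : R[i]^o -> R[i]^o} {z : R[i]^o} {a b} :
  wirtinger g z a b -> {for z, continuous g}.
Proof.
move=> /wirtinger_lip[d d0 H]; apply/continuous_atP => e e0.
set M := modulus a + modulus b + 1 in H.
have M0 : 0 < M by rewrite /M; have := modulus_ge0 a; have := modulus_ge0 b; lra.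
exists (Num.min d (e / M)); first by rewrite lt_min d0 divr_gt0.
move=> y; rewrite lt_min => /andP[/H]; rewrite subrKC => h1 h2.
by apply: (le_lt_trans h1); rewrite mulrC -ltr_pdivlMr.
Qed.

Section Stokes.
Variables (g h : R[i]^o -> R[i]^o).
Hypothesis dg : forall z, exists a, wirtinger g z a (h z).
Hypothesis ch : continuous h.

Lemma continuous_dbar : continuous g.
Proof. by move=> z; have [a /wirtinger_continuous] := dg z. Qed.

Lemma continuous_Re_plane (f : R[i]^o -> R[i]^o) : continuous f ->
  continuous (fun p : R * R => complex.Re (f (plane p))).
Proof.
move=> cf p; apply: (cvg_comp (fun p => f (plane p)) (@complex.Re R)); last exact: continuous_Re.
by apply: (cvg_comp plane f); [exact: continuous_plane|exact: cf].
Qed.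

Lemma continuous_Im_plane (f : R[i]^o -> R[i]^o) : continuous f ->
  continuous (fun p : R * R => complex.Im (f (plane p))).
Proof.
move=> cf p; apply: (cvg_comp (fun p => f (plane p)) (@complex.Im R)); last exact: continuous_Im.
by apply: (cvg_comp plane f); [exact: continuous_plane|exact: cf].
Qed.

Let A p := complex.Re (g (plane p)).
Let B p := - complex.Im (g (plane p)).

(** For g = u + iv, twice the real part of the dbar-derivative is u_x - v_y, the divergence of (u,
    -v). The real part of the complex formula is enough, because every quantity to be computed is
    real. *)
Lemma stokes (x y l : R) : 0 < l ->
  flux A B x y l = \int[area]_(p in square x y l) (2 * complex.Re (h (plane p))).
Proof.
move=> l0; apply: divergence_square => //.
- exact: (continuous_Re_plane _ continuous_dbar).
- by move=> p; exact: (cvgN (continuous_Im_plane _ continuous_dbar p)).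
- exact: (continuous_scale 2 (continuous_Re_plane _ ch)).
move=> [x0 y0]; have [[ar ai] Hg] := dg (plane (x0, y0)).
case E : (h (plane (x0, y0))) Hg => [br bi] Hg.
exists (ar + br), (bi - ai), (- (ai + bi)), (- (ar - br)); split; first by rewrite /=; ring.
move=> e e0; have [d d0 H] := Hg _ e0; exists (d / 2); first by rewrite divr_gt0.
move=> s t sd td /=.
have st : modulus (s +i* t) <= `|s| + `|t| := modulus_le_ReIm _.
have std : modulus (s +i* t) < d by lra.
have := H _ std; rewrite (_ : plane (x0, y0) + (s +i* t) = plane (x0 + s, y0 + t)) //.
rewrite /A /B; move: (g (plane (x0, y0))) (g (plane (x0 + s, y0 + t))) => [u v] [u' v'] h1.
have est : e * modulus (s +i* t) <= e * (`|s| + `|t|).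
  by rewrite ler_pM2l.
have h2 := le_trans h1 est.
split; [apply: (le_trans _ (le_trans (Re_le_modulus _) h2))|apply: (le_trans _ (le_trans (Im_le_modulus _) h2))].
  by rewrite /= le_eqVlt; apply/orP; left; apply/eqP; congr `|_|; ring.
by rewrite /= -normrN le_eqVlt; apply/orP; left; apply/eqP; congr `|_|; ring.
Qed.

Lemma flux_bound (x y l M : R) : 0 <= l ->
  (forall s t, x <= s <= x + l -> y <= t <= y + l ->
     s \in [:: x; x + l] \/ t \in [:: y; y + l] -> modulus (g (s +i* t)) <= M) ->
  `|flux A B x y l| <= 4 * M * l.
Proof.
move=> l0 H.
have cA : continuous A by exact: (continuous_Re_plane _ continuous_dbar).
have cB : continuous B.
  by move=> p; exact: (cvgN (continuous_Im_plane _ continuous_dbar p)).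
have HA s t : x <= s <= x + l -> y <= t <= y + l -> s \in [:: x; x + l] ->
  `|A (s, t) - 0| <= M.
  move=> h1 h2 h3; rewrite subr0; apply: (le_trans (Re_le_modulus _)).
  by apply: H => //; left.
have HB s t : x <= s <= x + l -> y <= t <= y + l -> t \in [:: y; y + l] ->
  `|B (s, t) - 0| <= M.
  move=> h1 h2 h3; rewrite subr0 normrN; apply: (le_trans (Im_le_modulus _)).
  by apply: H => //; right.
have hx0 : x <= x <= x + l by lra.
have hx1 : x <= x + l <= x + l by lra.
have hy0 : y <= y <= y + l by lra.
have hy1 : y <= y + l <= y + l by lra.
have := Rintegral_co_near _ y l 0 M (continuous_slice1 A x cA) l0
  (fun t ht => HA _ _ hx0 ht (mem_head _ _)).
have := Rintegral_co_near _ y l 0 M (continuous_slice1 A (x + l) cA) l0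
  (fun t ht => HA _ _ hx1 ht (mem_last x [:: x + l])).
have := Rintegral_co_near _ x l 0 M (continuous_slice2 B y cB) l0
  (fun t ht => HB _ _ ht hy0 (mem_head _ _)).
have := Rintegral_co_near _ x l 0 M (continuous_slice2 B (y + l) cB) l0
  (fun t ht => HB _ _ ht hy1 (mem_last y [:: y + l])).
rewrite /flux !mul0r !subr0 !ler_norml; lra.
Qed.

End Stokes.

(** The angle pi/2 under which one side of a square is seen from its centre. The formula for [f] is
    required on that side only, since the fields used are modified near the centre. *)
Lemma Rintegral_atan (c l : R) (f : R -> R) : 0 < l -> continuous f ->
  (forall t, c - l <= t <= c + l -> f t = l / (l ^+ 2 + (t - c) ^+ 2)) ->
  \int[leb]_(t in `[c - l, c - l + (l + l)[) f t = pi / 2.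
Proof.
move=> l0 cf fE; rewrite (_ : c - l + (l + l) = c + l); last by ring.
rewrite Rintegral_itv_bndo_bndc; last exact: integrable_co.
pose F t : R := atan ((t - c) / l).
have dF (t : R) : is_derive t (1 : R) F (l / (l ^+ 2 + (t - c) ^+ 2)).
  have -> : l / (l ^+ 2 + (t - c) ^+ 2) = l^-1 * (1 + ((t - c) / l) ^+ 2)^-1.
    have h1 : 0 <= (t - c) ^+ 2 by rewrite sqr_ge0.
    have h2 : 0 < l ^+ 2 by rewrite exprn_gt0.
    by field; apply/andP; split; rewrite gt_eqF //; lra.
  have dl : is_derive t (1 : R) (fun u : R => l^-1 * (u - c)) l^-1.
    by apply: is_derive_eq; rewrite subr0 -[_ *: _]/(_ * _) mulr1.
  rewrite (_ : F = atan \o (fun u : R => l^-1 * (u - c))); last first.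
    by apply/funext => u; rewrite /F /= mulrC.
  rewrite mulrC; apply: is_derive1_comp; rewrite [l^-1 * _]mulrC.
  exact: is_derive1_atan.
rewrite /Rintegral (@continuous_FTC2 _ f F) /=; first 1 last.
- lra.
- exact: continuous_subspaceT.
- split=> [t _| |].
  + by have [] := dF t.
  + by apply: cvg_at_right_filter; apply: differentiable_continuous; apply/derivable1_diffP; have [] := dF (c - l).
  + by apply: cvg_at_left_filter; apply: differentiable_continuous; apply/derivable1_diffP; have [] := dF (c + l).
- move=> t; rewrite in_itv /= => /andP[t1 t2]; rewrite fE; last lra.
  by rewrite derive1E; have [_ ->] := dF t.
rewrite /F [c + l]addrC addrK divff ?gt_eqF // [c - l]addrC addrK mulNr divff ?gt_eqF //.
by rewrite atanN atan1; field.
Qed.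

End ComplexStokes.

(** * Logarithmic cutoffs and their energy *)

Section Profiles.
Context {R : realType}.
Implicit Types (F P : R -> R) (a b t s e : R).

Lemma rdiff_near F G t k d : 0 < d -> (forall s, `|s - t| < d -> F s = G s) ->
  rdiff F t k -> rdiff G t k.
Proof.
move=> d0 FG Fk e /Fk[d' d'0 H]; exists (Num.min d d'); first by rewrite lt_min d0.
move=> s; rewrite lt_min => /andP[sd /H]; rewrite !FG ?subrr ?normr0 //.
by rewrite addrC addKr.
Qed.

Lemma rdiff_cst (c t : R) : rdiff (fun=> c) t 0.
Proof.
by move=> e e0; exists 1 => // s _; rewrite subrr mul0r subr0 normr0 mulr_ge0 // ltW.
Qed.

Lemma rdiffD F G t k k' : rdiff F t k -> rdiff G t k' ->
  rdiff (fun t => F t + G t) t (k + k').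
Proof.
move=> Fk Gk e e0; have e2 : 0 < e / 2 by rewrite divr_gt0.
have [d d0 H] := Fk _ e2; have [d' d'0 H'] := Gk _ e2.
exists (Num.min d d'); first by rewrite lt_min d0.
move=> s; rewrite lt_min => /andP[/H h1 /H' h2].
have -> : F (t + s) + G (t + s) - (F t + G t) - (k + k') * s =
  (F (t + s) - F t - k * s) + (G (t + s) - G t - k' * s) by ring.
by apply: (le_trans (ler_normD _ _)); lra.
Qed.

(** Continuing [F] by the constant [F a] to the left of [a] creates no corner, because the
    derivative vanishes there. *)
Lemma rdiff_max F (F' : R -> R) a : (forall t, a <= t -> rdiff F t (F' t)) ->
  F' a = 0 -> forall t, rdiff (fun t => F (Num.max a t)) t (F' (Num.max a t)).
Proof.
move=> dF F'a t; case: (ltgtP a t) => [at_|ta|ta].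
- apply: (rdiff_near F _ _ _ (t - a)); first by rewrite subr_gt0.
    by move=> s; rewrite ltr_norml => ?; rewrite max_r //; lra.
  by apply: dF; rewrite ltW.
- rewrite F'a; apply: (rdiff_near (fun=> F a) _ _ _ (a - t)); first by rewrite subr_gt0.
    by move=> s; rewrite ltr_norml => ?; rewrite max_l //; lra.
  exact: rdiff_cst.
subst t; rewrite F'a => e e0; have [d d0 H] := dF a (lexx _) e e0; exists d => // s sd.
rewrite maxxx mul0r subr0; case: (leP 0 s) => s0.
  by rewrite max_r ?lerDl //; have := H s sd; rewrite F'a mul0r subr0.
have h : a + s <= a by rewrite gerDl ltW.
by rewrite (max_l h) subrr normr0; apply: mulr_ge0 => //; exact: ltW.
Qed.

Lemma rdiff_min F (F' : R -> R) b : (forall t, t <= b -> rdiff F t (F' t)) ->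
  F' b = 0 -> forall t, rdiff (fun t => F (Num.min b t)) t (F' (Num.min b t)).
Proof.
move=> dF F'b t; case: (ltgtP b t) => [bt|tb|tb].
- rewrite F'b; apply: (rdiff_near (fun=> F b) _ _ _ (t - b)); first by rewrite subr_gt0.
    by move=> s; rewrite ltr_norml => ?; rewrite min_l //; lra.
  exact: rdiff_cst.
- apply: (rdiff_near F _ _ _ (b - t)); first by rewrite subr_gt0.
    by move=> s; rewrite ltr_norml => ?; rewrite min_r //; lra.
  by apply: dF; rewrite ltW.
subst t; rewrite F'b => e e0; have [d d0 H] := dF b (lexx _) e e0; exists d => // s sd.
rewrite minxx mul0r subr0; case: (leP 0 s) => s0.
  by rewrite min_l ?lerDl // subrr normr0; apply: mulr_ge0 => //; exact: ltW.
have h : b + s <= b by rewrite gerDl ltW.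
by rewrite (min_r h); have := H s sd; rewrite F'b mul0r subr0.
Qed.

(* A C^1 function of t = |q|^2 which equals 1/t for t >= a, so that
   [recip a (|q|^2) * conj q] regularizes 1/q. *)
Definition recip a t : R := (Num.max a t)^-1 + (Num.max a t - t) / a ^+ 2.

(** This is recip + t recip', the factor of the conjugate of q' in the dbar-derivative of
    recip(|q|^2) times the conjugate of q. It vanishes for t >= a, where that function is 1/q. *)
Definition recip_bump a t : R := recip a t - t / Num.max a t ^+ 2.

Lemma max_gt0 a t : 0 < a -> 0 < Num.max a t.
Proof. by move=> a0; rewrite lt_max a0. Qed.

Lemma rdiff_recip a t : 0 < a -> rdiff (recip a) t (- (Num.max a t ^+ 2)^-1).
Proof.
move=> a0.
(* The added linear term makes the derivative vanish at [a], so [rdiff_max] applies to [F]; the term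
   is subtracted again afterwards, for all t. *)
pose F u : R := u^-1 + u / a ^+ 2; pose F' u : R := - u ^- 2 + (a ^+ 2)^-1.
have dF u : a <= u -> rdiff F u (F' u).
  move=> au; apply: is_derive_rdiff.
  have u0 : u != 0 by rewrite gt_eqF // (lt_le_trans a0).
  rewrite /F /F'.
  have -> : (fun u0 : R => u0^-1 + u0 / a ^+ 2) = (fun x => (id x)^-1) + (a ^+ 2)^-1 *: id.
    by apply/funext => v; rewrite /= mulrC.
  have h1 : is_derive u (1 : R) (fun x : R => (id x)^-1) (- u ^- 2 *: (1 : R)).
    exact: is_deriveV.
  have h2 : is_derive u (1 : R) ((a ^+ 2)^-1 *: (id : R -> R)) ((a ^+ 2)^-1 *: (1 : R)).
    exact: is_deriveZ.
  by have := is_deriveD h1 h2; rewrite -![_ *: (1 : R)]/(_ * _) !mulr1.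
have F'a : F' a = 0 by rewrite /F' addrC subrr.
have := rdiff_max F F' a dF F'a t.
have : rdiff (fun t => - (t / a ^+ 2)) t (- (a ^+ 2)^-1).
  move=> e e0; exists 1 => // s _.
  rewrite (_ : _ - _ - _ = 0) ?normr0 ?mulr_ge0 // ?ltW //; ring.
move=> h1 h2; have := rdiffD _ _ _ _ _ h2 h1.
rewrite /F' addrK; apply: rdiff_near ltr01 _ => s _.
by rewrite /recip /F; ring.
Qed.

Lemma recip_ge a t : 0 < a -> a <= t -> recip a t = t^-1.
Proof. by move=> a0 /max_r h; rewrite /recip h subrr mul0r addr0. Qed.

Lemma recip_bump_ge a t : 0 < a -> a <= t -> recip_bump a t = 0.
Proof.
move=> a0 at_; rewrite /recip_bump recip_ge // max_r //.
by field; rewrite gt_eqF // (lt_le_trans a0).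
Qed.

Lemma recip_bump_ge0 a t : 0 < a -> 0 <= t -> 0 <= recip_bump a t.
Proof.
move=> a0 t0; have [at_|ta] := leP a t; first by rewrite recip_bump_ge.
rewrite /recip_bump /recip (max_l (ltW ta)).
rewrite (_ : a^-1 + (a - t) / a ^+ 2 - t / a ^+ 2 = 2 * (a - t) / a ^+ 2); last by field; rewrite gt_eqF.
by apply: divr_ge0; [apply: mulr_ge0 => //; rewrite subr_ge0 ltW|rewrite exprn_ge0 // ltW].
Qed.

Lemma continuous_maxl a : continuous (Num.max a : R -> R).
Proof.
by move=> t; apply: (@continuous_max R _ (cst a) id); [exact: cvg_cst|exact: cvg_id].
Qed.

Lemma continuous_minl a : continuous (Num.min a : R -> R).
Proof.
by move=> t; apply: (@continuous_min R _ (cst a) id); [exact: cvg_cst|exact: cvg_id].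
Qed.

Lemma continuous_recip_bump a : 0 < a -> continuous (recip_bump a).
Proof.
move=> a0 t; have m0 := max_gt0 a t a0; have mn : Num.max a t != 0 by rewrite gt_eqF.
have cm := continuous_maxl a t.
rewrite /recip_bump /recip; apply: cvgB; first apply: cvgD.
- exact: cvgV.
- by apply: cvgMr_tmp; apply: cvgB => //; exact: cvg_id.
- apply: cvgM; first exact: cvg_id.
  by apply: cvgV; [rewrite expf_neq0|exact: (cvgM cm cm)].
Qed.

Definition clamp a b t : R := Num.max a (Num.min b t).

(** The position of t between a and b on a logarithmic scale: the radial profile of the harmonic
    function that is extremal for the energy of an annulus. *)
Definition logpos a b t : R := (ln (clamp a b t) - ln a) / ln (b / a).

Section Clamp.
Variables (a b : R).
Hypotheses (a0 : 0 < a) (ab : a < b).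

Let b0 : 0 < b. Proof. exact: lt_trans ab. Qed.

Lemma ln_ratio_gt0 : 0 < ln (b / a).
Proof. by rewrite ln_gt0 // ltr_pdivlMr // mul1r. Qed.

Lemma clamp_gt0 t : 0 < clamp a b t.
Proof. exact: max_gt0. Qed.

Lemma clamp_bounds t : a <= clamp a b t <= b.
Proof. by rewrite /clamp le_max lexx ge_max (ltW ab) ge_min lexx. Qed.

Lemma clamp_le t : t <= a -> clamp a b t = a.
Proof. by move=> ta; rewrite /clamp max_l // ge_min ta orbT. Qed.

Lemma clamp_ge t : b <= t -> clamp a b t = b.
Proof. by move=> bt; rewrite /clamp min_l // max_r // ltW. Qed.

Lemma clamp_id t : a <= t <= b -> clamp a b t = t.
Proof. by move=> /andP[a_t tb]; rewrite /clamp min_r // max_r. Qed.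

Lemma logpos_bounds t : 0 <= logpos a b t <= 1.
Proof.
have /andP[h1 h2] := clamp_bounds t; have c0 := clamp_gt0 t.
have L0 := ln_ratio_gt0; rewrite /logpos; apply/andP; split.
  by apply: divr_ge0; [rewrite subr_ge0 ler_ln ?posrE|exact: ltW].
by rewrite ler_pdivrMr // mul1r ln_div ?posrE // lerD2r ler_ln ?posrE.
Qed.

Lemma logpos_le t : t <= a -> logpos a b t = 0.
Proof. by move=> ta; rewrite /logpos clamp_le // subrr mul0r. Qed.

Lemma logpos_ge t : b <= t -> logpos a b t = 1.
Proof.
move=> bt; rewrite /logpos clamp_ge // ln_div ?posrE // divff //.
by have := ln_ratio_gt0; rewrite ln_div ?posrE // => /gt_eqF ->.
Qed.

Lemma continuous_clamp : continuous (clamp a b).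
Proof.
move=> t; apply: (cvg_comp (Num.min b) (Num.max a)); first exact: continuous_minl.
exact: continuous_maxl.
Qed.

Lemma continuous_logpos : continuous (logpos a b).
Proof.
move=> t; apply: cvgMr_tmp; apply: cvgB; last exact: cvg_cst.
apply: (cvg_comp (clamp a b) (@ln R)); first exact: continuous_clamp.
exact: continuous_ln (clamp_gt0 t).
Qed.

(** [logpos] has corners at a and b, where it takes the values 0 and 1; a profile [P] that is flat
    at 0 and 1 smooths them. *)
Lemma rdiff_logpos P P' : (forall x, is_derive x (1 : R) P (P' x)) ->
  P' 0 = 0 -> P' 1 = 0 -> forall t, rdiff (fun t => P (logpos a b t)) t
    (P' (logpos a b t) / (clamp a b t * ln (b / a))).
Proof.
move=> dP P0 P1 t; have L0 := ln_ratio_gt0.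
pose x u : R := (ln u - ln a) / ln (b / a).
pose F u := P (x u); pose F' u := P' (x u) / (u * ln (b / a)).
have xa : x a = 0 by rewrite /x subrr mul0r.
have xb : x b = 1 by rewrite -(logpos_ge b (lexx _)) /logpos clamp_ge.
have dF u : a <= u -> rdiff F u (F' u).
  move=> au; have u0 : 0 < u by apply: lt_le_trans au.
  have dx : is_derive u (1 : R) x ((ln (b / a))^-1 * u^-1).
    rewrite (_ : x = (ln (b / a))^-1 *: (@ln R - cst (ln a))); last first.
      by apply/funext => v; rewrite /x mulrC.
    have h1 := is_derive1_ln u0.
    have h2 : is_derive u (1 : R) (@ln R - cst (ln a)) (u^-1 - 0) by exact: is_deriveB.
    by have := is_deriveZ (ln (b / a))^-1 h2; rewrite subr0.
  have := is_derive_rdiff _ _ _ (is_derive1_comp (dP (x u)) dx).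
  by rewrite /F' -/(x u) invfM [u^-1 * _]mulrC.
have := rdiff_min (fun t => F (Num.max a t)) (fun t => F' (Num.max a t)) b _ _ t.
have -> : (fun t => F (Num.max a (Num.min b t))) = (fun t => P (logpos a b t)) by [].
apply.
  by move=> u _; apply: (rdiff_max F F' a dF); rewrite /F' xa P0 mul0r.
by rewrite /F' max_r ?ltW // xb P1 mul0r.
Qed.

End Clamp.

End Profiles.

(** * Cutoffs in the modulus of a polynomial *)

Section Cutoff.
Context {R : realType}.
Local Notation leb := (@lebesgue_measure R).
Implicit Types (p : {poly R[i]}) (z w : R[i]) (a b : R).

Lemma wirtinger_horner p z : wirtinger (fun z => p.[z]) z p^`().[z] 0.
Proof.
elim/poly_ind: p => [|p c IH].
  by apply: (wirtinger_eq (wirtinger_cst 0 z)) => [y||]; rewrite ?deriv0 ?horner0.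
apply: (wirtinger_eq (wirtingerD (wirtingerM IH (wirtinger_id z)) (wirtinger_cst c z))) => [y||];
  rewrite ?derivMXaddC ?hornerMXaddC ?hornerD ?hornerMX; ring.
Qed.

Lemma continuous_hornerC p : continuous (fun z : R[i]^o => p.[z] : R[i]^o).
Proof. by move=> z; exact: wirtinger_continuous (wirtinger_horner p z). Qed.

Definition sqmod p z : R := modulus p.[z] ^+ 2.

Lemma sqmodE p z : (sqmod p z)%:C = p.[z] * p.[z]^*.
Proof. by rewrite mul_conj. Qed.

Lemma wirtinger_conj_horner p z :
  wirtinger (fun z => p.[z]^*) z 0 (p^`().[z])^*.
Proof.
by apply: (wirtinger_eq (wirtinger_conj (wirtinger_horner p z))) => //; exact: rmorph0.
Qed.

Lemma wirtinger_sqmod p z : wirtinger (fun z => (sqmod p z)%:C) z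
  (p^`().[z] * p.[z]^*) (p.[z] * (p^`().[z])^*).
Proof.
apply: (wirtinger_eq (wirtingerM (wirtinger_horner p z) (wirtinger_conj_horner p z))) => [y||];
  rewrite ?sqmodE //; ring.
Qed.

Lemma continuous_sqmod p : continuous (sqmod p : R[i]^o -> R).
Proof.
move=> z; rewrite (_ : sqmod p = fun z => complex.Re ((sqmod p z)%:C)) //.
apply: (cvg_comp (fun z : R[i]^o => (sqmod p z)%:C : R[i]^o) (@complex.Re R)); last exact: continuous_Re.
exact: wirtinger_continuous (wirtinger_sqmod p z).
Qed.

Lemma wirtinger_fun_sqmod {F : R -> R} {p z k} : rdiff F (sqmod p z) k ->
  wirtinger (fun z => (F (sqmod p z))%:C) z
    (k%:C * (p^`().[z] * p.[z]^*)) (k%:C * (p.[z] * (p^`().[z])^*)).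
Proof. exact: (wirtinger_comp (wirtinger_sqmod p z)). Qed.

Lemma continuous_fun_sqmod (F : R -> R) p : continuous F ->
  continuous (fun z : R[i]^o => (F (sqmod p z))%:C : R[i]^o).
Proof.
move=> cF z; apply: (cvg_comp (fun z : R[i]^o => F (sqmod p z)) (fun t => t%:C : R[i]^o));
  last exact: continuous_real_complex.
by apply: (cvg_comp (sqmod p : R[i]^o -> R) F); [exact: continuous_sqmod|exact: cF].
Qed.

(** For p = X - w this is a regularized Cauchy kernel; for general p, multiplied by p', a
    regularized logarithmic derivative. Both uses share the lemmas below. *)
Definition reg_inv a p z : R[i] := (recip a (sqmod p z))%:C * p.[z]^*.

Definition reg_inv_dbar a p z : R[i] := (recip_bump a (sqmod p z))%:C * (p^`().[z])^*.

Lemma wirtinger_reg_inv a p z : 0 < a ->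
  exists k, wirtinger (reg_inv a p) z k (reg_inv_dbar a p z).
Proof.
move=> a0; eexists.
apply: (wirtinger_eq (wirtingerM (wirtinger_fun_sqmod (rdiff_recip a (sqmod p z) a0))
  (wirtinger_conj_horner p z))) => //; rewrite /reg_inv_dbar /recip_bump real_complexB real_complexM sqmodE.
set M := Num.max _ _; have -> : (- (M ^+ 2)^-1)%:C = - (M ^- 2)%:C :> R[i] by exact: rmorphN.
by ring.
Qed.

Lemma continuous_mul (f g : R[i]^o -> R[i]^o) : continuous f -> continuous g ->
  continuous (fun z : R[i]^o => f z * g z : R[i]^o).
Proof. by move=> cf cg z; exact: (@continuousM _ _ f g z (cf z) (cg z)). Qed.

Lemma continuous_conj_horner p : continuous (fun z : R[i]^o => p.[z]^* : R[i]^o).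
Proof. by move=> z; exact: wirtinger_continuous (wirtinger_conj_horner p z). Qed.

Lemma continuous_reg_inv_dbar a p : 0 < a ->
  continuous (reg_inv_dbar a p : R[i]^o -> R[i]^o).
Proof.
move=> a0; apply: continuous_mul; first exact: continuous_fun_sqmod (continuous_recip_bump a a0).
exact: continuous_conj_horner.
Qed.

Lemma reg_inv_ge a p z : 0 < a -> a <= sqmod p z -> reg_inv a p z = p.[z]^-1.
Proof.
move=> a0 aT; rewrite /reg_inv recip_ge //.
have : (sqmod p z)%:C != 0 :> R[i] by rewrite gt_eqF // ltcR (lt_le_trans a0).
have -> : ((sqmod p z)^-1)%:C = (p.[z] * p.[z]^*)^-1.
  by rewrite -sqmodE; exact: (fmorphV (real_complex R)).
rewrite sqmodE mulf_eq0 negb_or => /andP[h1 h2].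
by rewrite invfM -mulrA mulVf ?mulr1.
Qed.

Section Ramp.
Variables (a b : R) (p : {poly R[i]}).
Hypotheses (a0 : 0 < a) (ab : a < b).

(** The cubic from 0 to 1 with derivative 6x(1 - x), flat at both ends. Its energy on [0, 1] is 6/5,
    against 1 for the linear profile, which would leave corners. *)
Definition smoothstep (x : R) : R := 3 * x ^+ 2 - 2 * x ^+ 3.
(* antiderivative of the square of the derivative of [smoothstep] *)
Definition smoothstep_energy (x : R) : R := 12 * x ^+ 3 - 18 * x ^+ 4 + 36 / 5 * x ^+ 5.

Definition ramp (t : R) : R := smoothstep (logpos a b t).
Definition ramp' (t : R) : R :=
  6 * logpos a b t * (1 - logpos a b t) / (clamp a b t * ln (b / a)).

Lemma is_derive_smoothstep (x : R) : is_derive x (1 : R) smoothstep (6 * x * (1 - x)).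
Proof.
have := is_derive_poly (3%:P * 'X^2 - 2%:P * 'X^3) x.
rewrite (_ : horner _ = smoothstep); last first.
  by apply/funext => t; rewrite /smoothstep !hornerE.
by congr is_derive; rewrite !poly.derivE !hornerE /=; ring.
Qed.

Lemma is_derive_smoothstep_energy (x : R) :
  is_derive x (1 : R) smoothstep_energy ((6 * x * (1 - x)) ^+ 2).
Proof.
have := is_derive_poly (12%:P * 'X^3 - 18%:P * 'X^4 + (36 / 5)%:P * 'X^5) x.
rewrite (_ : horner _ = smoothstep_energy); last first.
  by apply/funext => t; rewrite /smoothstep_energy !hornerE.
by congr is_derive; rewrite !poly.derivE !hornerE /=; field.
Qed.

Lemma smoothstep_bounds (x : R) : 0 <= x <= 1 -> 0 <= smoothstep x <= 1.
Proof.
move=> /andP[x0 x1]; rewrite /smoothstep.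
have -> : 3 * x ^+ 2 - 2 * x ^+ 3 = x ^+ 2 * (3 - 2 * x) by ring.
have h : 1 - x ^+ 2 * (3 - 2 * x) = (1 - x) ^+ 2 * (1 + 2 * x) by ring.
apply/andP; split; first by rewrite mulr_ge0 ?sqr_ge0 //; lra.
by rewrite -subr_ge0 h mulr_ge0 ?sqr_ge0 //; lra.
Qed.

Lemma smoothstep_energy_bounds (x : R) : 0 <= x <= 1 -> 0 <= smoothstep_energy x <= 6 / 5.
Proof.
have pos (y : R) : 0 <= y -> 0 <= smoothstep_energy y.
  move=> y0; rewrite /smoothstep_energy.
  have -> : 12 * y ^+ 3 - 18 * y ^+ 4 + 36 / 5 * y ^+ 5 =
    y ^+ 3 * (36 / 5 * (y - 5 / 4) ^+ 2 + 3 / 4) by field.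
  by rewrite mulr_ge0 ?exprn_ge0 //; have := sqr_ge0 (y - 5 / 4); lra.
move=> /andP[x0 x1]; rewrite pos //=.
(* The symmetry of x(1 - x) gives 6/5 - S(x) = S(1 - x) for S = [smoothstep_energy], so the upper
   bound is positivity at 1 - x. *)
have x1' : 0 <= 1 - x by lra.
rewrite -subr_ge0; have := pos _ x1'; congr (_ <= _).
by rewrite /smoothstep_energy; field.
Qed.

Lemma ramp_bounds t : 0 <= ramp t <= 1.
Proof. by apply: smoothstep_bounds; exact: logpos_bounds. Qed.

Lemma ramp_le t : t <= a -> ramp t = 0.
Proof. by move=> ta; rewrite /ramp logpos_le // /smoothstep !expr0n /= !mulr0 subr0. Qed.

Lemma ramp_ge t : b <= t -> ramp t = 1.
Proof. by move=> tb; rewrite /ramp logpos_ge // /smoothstep !expr1n; ring. Qed.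

Lemma rdiff_ramp t : rdiff ramp t (ramp' t).
Proof.
apply: (rdiff_logpos a b a0 ab smoothstep (fun x => 6 * x * (1 - x))).
- exact: is_derive_smoothstep.
- by rewrite mulr0 mul0r.
- by rewrite subrr mulr0.
Qed.

Lemma continuous_ramp' : continuous ramp'.
Proof.
have L0 := ln_ratio_gt0 a b a0 ab.
move=> t; have c0 := clamp_gt0 a b a0 t; have cl := continuous_logpos a b a0 t.
apply: cvgM.
  apply: cvgM; first by apply: cvgMl_tmp; exact: cl.
  by apply: cvgB; [exact: cvg_cst|exact: cl].
apply: cvgV; first by rewrite mulf_neq0 // gt_eqF.
by apply: cvgMr_tmp; exact: continuous_clamp.
Qed.

Lemma ramp'_out t : t <= a \/ b <= t -> ramp' t = 0.
Proof.
rewrite /ramp' => -[/logpos_le ->//|/(logpos_ge a b a0 ab) ->]; first by rewrite mulr0 !mul0r.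
by rewrite subrr mulr0 mul0r.
Qed.

Definition ramp_dbar z : R[i] := (ramp' (sqmod p z))%:C * (p.[z] * (p^`().[z])^*).

Lemma wirtinger_ramp z : exists k, wirtinger (fun z => (ramp (sqmod p z))%:C) z k (ramp_dbar z).
Proof. by eexists; apply: wirtinger_fun_sqmod; exact: rdiff_ramp. Qed.

Lemma continuous_ramp_dbar : continuous (ramp_dbar : R[i]^o -> R[i]^o).
Proof.
apply: continuous_mul; first exact: continuous_fun_sqmod continuous_ramp'.
by apply: continuous_mul; [exact: continuous_hornerC|exact: continuous_conj_horner].
Qed.

(** A primitive of t ramp'(t)^2: of the two factors 1 / (t log(b/a)) in ramp'(t)^2, one is the
    derivative of [logpos] and the other leaves 1 / log(b/a). *)
Let H t := smoothstep_energy (logpos a b t) / ln (b / a).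

Let rdiff_H t : rdiff H t (clamp a b t * ramp' t ^+ 2).
Proof.
have L0 := ln_ratio_gt0 a b a0 ab; have c0 := clamp_gt0 a b a0 t.
have := rdiff_logpos a b a0 ab (fun x => (ln (b / a))^-1 * smoothstep_energy x)
  (fun x => (ln (b / a))^-1 * (6 * x * (1 - x)) ^+ 2) _ _ _ t.
have HE : (fun t => (ln (b / a))^-1 * smoothstep_energy (logpos a b t)) = H.
  by apply/funext => u; exact: mulrC.
rewrite HE.
have -> : (ln (b / a))^-1 * (6 * logpos a b t * (1 - logpos a b t)) ^+ 2 / (clamp a b t * ln (b / a))
   = clamp a b t * ramp' t ^+ 2.
  by rewrite /ramp'; field; rewrite !gt_eqF.
apply => [x||]; last 2 first.
- by rewrite mulr0 mul0r expr0n mulr0.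
- by rewrite subrr mulr0 expr0n mulr0.
have := is_deriveZ (ln (b / a))^-1 (is_derive_smoothstep_energy x).
by [].
Qed.

(** A globally differentiable form of H(|p|^2) p'/p: where [reg_inv] differs from 1/p, [H] and its
    derivative vanish. *)
Let G z := (H (sqmod p z))%:C * reg_inv a p z * p^`().[z].

Let wirtinger_G z : exists k, wirtinger G z k (modulus (ramp_dbar z) ^+ 2)%:C.
Proof.
have [k hk] := wirtinger_reg_inv a p z a0.
eexists.
apply: (wirtinger_eq (wirtingerM (wirtingerM
  (wirtinger_fun_sqmod (rdiff_H (sqmod p z))) hk) (wirtinger_horner p^`() z))) => //.
rewrite mulr0 addr0 -mul_conj /ramp_dbar.
have [Ta|aT] := leP (sqmod p z) a.
  rewrite ramp'_out; last by left.
  by rewrite /H logpos_le // /smoothstep_energy !expr0n /= !mulr0 addr0 subr0 mul0r !mul0r addr0 mul0r.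
rewrite /reg_inv_dbar recip_bump_ge // ?ltW // mul0r mulr0 addr0.
rewrite reg_inv_ge // ?ltW //.
have [bT|Tb] := leP b (sqmod p z).
  have r0 : ramp' (sqmod p z) = 0 by apply: ramp'_out; right.
  have C0 : (0 : R)%:C = 0 :> R[i] by [].
  by rewrite r0 expr0n /= mulr0 C0 !mul0r.
rewrite clamp_id; last by rewrite !ltW.
rewrite expr2 (real_complexM (sqmod p z)) (real_complexM (ramp' _)) sqmodE.
have q0 : p.[z] != 0.
  by apply: contraTneq aT => q0; rewrite /sqmod q0 modulus0 expr0n ltNge ltW.
have rC : (ramp' (sqmod p z))%:C^* = (ramp' (sqmod p z))%:C by exact: conjc_real.
have cM (u v : R[i]) : (u * v)^* = u^* * v^* by exact: rmorphM.
by rewrite (cM (_%:C)) rC (cM p.[z]) conjCK; field.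
Qed.

(* Stokes' theorem for [G], whose dbar-derivative is |ramp_dbar|^2 *)
Lemma ramp_energy (x y l M : R) : 0 < l -> 0 <= M ->
  (forall s t, x <= s <= x + l -> y <= t <= y + l ->
     s \in [:: x; x + l] \/ t \in [:: y; y + l] ->
     modulus p^`().[s +i* t] <= M * modulus p.[s +i* t]) ->
  \int[area]_(q in square x y l) (modulus (ramp_dbar (plane q)) ^+ 2) <=
    12 / 5 * M * l / ln (b / a).
Proof.
move=> l0 M0 HM; have L0 := ln_ratio_gt0 a b a0 ab.
have ch : continuous (fun z : R[i]^o => (modulus (ramp_dbar z) ^+ 2)%:C : R[i]^o).
  rewrite (_ : (fun z => _) = (fun z : R[i]^o => ramp_dbar z * (ramp_dbar z)^* : R[i]^o)); last first.
    by apply/funext => z; rewrite mul_conj.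
  apply: continuous_mul; first exact: continuous_ramp_dbar.
  move=> z; apply: (cvg_comp (ramp_dbar : R[i]^o -> R[i]^o) Num.conj); first exact: continuous_ramp_dbar.
  exact: continuous_conj.
have := stokes _ _ wirtinger_G ch x y l l0.
rewrite RintegralZl //=; last first.
  - exact: (integrable_square _ _ _ _ (continuous_Re_plane _ ch)).
  - exact: measurable_square.
move=> E.
(* On the sides |p'/p| <= M and [H] is at most 6/5 / log(b/a). The four sides, and the factor 2 in
   [stokes], give the constant 4 (6/5) / 2 = 12/5. *)
have := flux_bound _ _ wirtinger_G x y l (6 / 5 / ln (b / a) * M) (ltW l0).
rewrite E => /(_ _)/(le_trans (ler_norm _)) => B.
suff : 2 * (\int[area]_(q in square x y l) (modulus (ramp_dbar (plane q)) ^+ 2)) <=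
   4 * (6 / 5 / ln (b / a) * M) * l.
  have -> : 12 / 5 * M * l / ln (b / a) = (4 * (6 / 5 / ln (b / a) * M) * l) / 2 by field; rewrite gt_eqF.
  lra.
apply: B => s t hs ht hst.
have := HM s t hs ht hst; set z := s +i* t => hz.
have /andP[h1 h2] := smoothstep_energy_bounds _ (logpos_bounds a b a0 ab (sqmod p z)).
rewrite /G modulusM (modulusM (H _)%:C) modulus_real ger0_norm; last by rewrite /H divr_ge0 // ltW.
have [Ta|aT] := leP (sqmod p z) a.
  rewrite /H logpos_le // /smoothstep_energy !expr0n /= !mulr0 addr0 subr0 !mul0r.
  by rewrite mulr_ge0 // divr_ge0 // ltW.
rewrite (reg_inv_ge _ _ _ a0 (ltW aT)) -mulrA.
apply: ler_pM; rewrite ?divr_ge0 ?mulr_ge0 ?modulus_ge0 ?(ltW L0) //.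
  by rewrite ler_pM2r // invr_gt0.
have q0 : p.[z] != 0.
  by apply: contraTneq aT => q0; rewrite /sqmod q0 modulus0 expr0n ltNge ltW.
rewrite [modulus _^-1]Normc.normcV mulrC ler_pdivrMr //.
by rewrite lt_def modulus_eq0 q0 modulus_ge0.
Qed.

End Ramp.

End Cutoff.

(** * The bound by cutoff functions *)

Section Representation.
Context {R : realType}.
Local Notation leb := (@lebesgue_measure R).
Implicit Types (p : {poly R[i]}) (z w : R[i]) (s : seq R[i]).

Definition centered_square w (L : R) := square (complex.Re w - L) (complex.Im w - L) (L + L).

Lemma modulus_boundary w (L s t : R) :
  complex.Re w - L <= s <= complex.Re w - L + (L + L) ->
  complex.Im w - L <= t <= complex.Im w - L + (L + L) ->
  s \in [:: complex.Re w - L; complex.Re w - L + (L + L)] \/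
  t \in [:: complex.Im w - L; complex.Im w - L + (L + L)] ->
  L <= `|complex.Re (s +i* t - w)| \/ L <= `|complex.Im (s +i* t - w)|.
Proof.
case: w => [u v] /=; rewrite !inE => _ _ [] /orP[]/eqP->; [left|left|right|right].
- by rewrite addrAC subrr add0r normrN ler_norm.
- by rewrite (_ : u - L + (L + L) - u = L) ?ler_norm //; ring.
- by rewrite addrAC subrr add0r normrN ler_norm.
- by rewrite (_ : v - L + (L + L) - v = L) ?ler_norm //; ring.
Qed.

Lemma modulus_boundary_ge w (L s t : R) :
  complex.Re w - L <= s <= complex.Re w - L + (L + L) ->
  complex.Im w - L <= t <= complex.Im w - L + (L + L) ->
  s \in [:: complex.Re w - L; complex.Re w - L + (L + L)] \/
  t \in [:: complex.Im w - L; complex.Im w - L + (L + L)] ->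
  L <= modulus (s +i* t - w).
Proof.
move=> hs ht hst; case: (modulus_boundary w L s t hs ht hst) => h;
  apply: (le_trans h); [exact: Re_le_modulus|exact: Im_le_modulus].
Qed.

Lemma sqmod_XsubC w z : sqmod ('X - w%:P) z = modulus (z - w) ^+ 2.
Proof. by rewrite /sqmod !hornerE. Qed.

Lemma reg_inv_dbar_XsubC a w z :
  reg_inv_dbar a ('X - w%:P) z = (recip_bump a (modulus (z - w) ^+ 2))%:C.
Proof. by rewrite /reg_inv_dbar derivXsubC hornerC rmorph1 mulr1 sqmod_XsubC. Qed.

(** The bump is the dbar-derivative of the regularized 1 / (z - w), which on the sides of the square
    is the true one. The flux is four times pi/2, and [stokes] counts the integral twice. As e tends
    to 0 the bump thus acts as pi times a Dirac mass at w. *)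
Lemma Rintegral_recip_bump w (e L : R) : 0 < e -> e <= L ->
  \int[area]_(q in centered_square w L)
    recip_bump (e ^+ 2) (modulus (plane q - w) ^+ 2) = pi.
Proof.
move=> e0 eL; have L0 : 0 < L by apply: lt_le_trans eL.
have a0 : 0 < e ^+ 2 by rewrite exprn_gt0.
pose p := 'X - w%:P.
pose g : R[i]^o -> R[i]^o := reg_inv (e ^+ 2) p.
pose h : R[i]^o -> R[i]^o := reg_inv_dbar (e ^+ 2) p.
have dg z : exists k, wirtinger g z k (h z) by exact: wirtinger_reg_inv.
have ch : continuous h by exact: continuous_reg_inv_dbar.
have L20 : 0 < L + L by rewrite addr_gt0.
have := stokes g h dg ch (complex.Re w - L) (complex.Im w - L) (L + L) L20.
rewrite RintegralZl //=; last first.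
  - exact: (integrable_square _ _ _ _ (continuous_Re_plane _ ch)).
  - exact: measurable_square.
under eq_Rintegral do rewrite /h reg_inv_dbar_XsubC /=.
rewrite -/(centered_square w L) => E.
have gE (s t : R) : e <= modulus (s +i* t - w) -> g (s +i* t) = (s +i* t - w)^-1.
  move=> es; rewrite /g reg_inv_ge // ?hornerE // sqmod_XsubC.
  by rewrite ler_pXn2r ?nnegrE ?modulus_ge0 // ltW.
have gRe (s t : R) : e <= modulus (s +i* t - w) -> complex.Re (g (s +i* t)) =
    (s - complex.Re w) / ((s - complex.Re w) ^+ 2 + (t - complex.Im w) ^+ 2).
  by move=> /gE ->; case: (w).
have gIm (s t : R) : e <= modulus (s +i* t - w) -> - complex.Im (g (s +i* t)) =
    (t - complex.Im w) / ((s - complex.Re w) ^+ 2 + (t - complex.Im w) ^+ 2).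
  by move=> /gE ->; case: (w) => u v /=; rewrite opprK.
have cA : continuous (fun p : R * R => complex.Re (g (plane p))).
  exact: (continuous_Re_plane _ (continuous_dbar _ _ dg)).
have cB : continuous (fun p : R * R => - complex.Im (g (plane p))).
  by move=> q; exact: (cvgN (continuous_Im_plane _ (continuous_dbar _ _ dg) q)).
have far1 (s t : R) : s = complex.Re w - L \/ s = complex.Re w - L + (L + L) -> e <= modulus (s +i* t - w).
  move=> h1; apply: (le_trans eL); apply: (le_trans _ (Re_le_modulus _)).
  by case: (w) h1 => u v /= [] ->; rewrite -ler_sqr ?nnegrE ?(ltW L0) // real_normK ?num_real //;
    rewrite le_eqVlt; apply/orP; left; apply/eqP; ring.
have far2 (s t : R) : t = complex.Im w - L \/ t = complex.Im w - L + (L + L) -> e <= modulus (s +i* t - w).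
  move=> h1; apply: (le_trans eL); apply: (le_trans _ (Im_le_modulus _)).
  by case: (w) h1 => u v /= [] ->; rewrite -ler_sqr ?nnegrE ?(ltW L0) // real_normK ?num_real //;
    rewrite le_eqVlt; apply/orP; left; apply/eqP; ring.
have opp (f : R -> R) x : continuous f ->
    \int[leb]_(t in `[x, x + (L + L)[) (- f t) = pi / 2 ->
    \int[leb]_(t in `[x, x + (L + L)[) f t = - (pi / 2).
  move=> cf <-; rewrite -[RHS]mulN1r -RintegralZl //.
    by apply: eq_Rintegral => t _; rewrite mulN1r opprK.
  by apply: integrable_co => t; exact: (cvgN (cf t)).
have I1 : \int[leb]_(t in `[complex.Im w - L, complex.Im w - L + (L + L)[)
   complex.Re (g (plane (complex.Re w - L + (L + L), t))) = pi / 2.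
  apply: Rintegral_atan => //; first exact: (continuous_slice1 _ _ cA).
  move=> t _; rewrite [LHS]gRe; last by apply: far1; right.
  by rewrite (_ : complex.Re w - L + (L + L) - complex.Re w = L) //; ring.
have I2 : \int[leb]_(t in `[complex.Im w - L, complex.Im w - L + (L + L)[)
   complex.Re (g (plane (complex.Re w - L, t))) = - (pi / 2).
  apply: opp; first exact: (continuous_slice1 _ _ cA).
  apply: Rintegral_atan => //.
    by move=> t; exact: (cvgN (continuous_slice1 _ _ cA t)).
  move=> t _; rewrite -[RHS]opprK; congr (- _); rewrite [LHS]gRe; last by apply: far1; left.
  by rewrite addrAC subrr add0r sqrrN mulNr.
have I3 : \int[leb]_(s in `[complex.Re w - L, complex.Re w - L + (L + L)[)
   (- complex.Im (g (plane (s, complex.Im w - L + (L + L))))) = pi / 2.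
  apply: Rintegral_atan => //; first exact: (continuous_slice2 _ _ cB).
  move=> t _; rewrite [LHS]gIm; last by apply: far2; right.
  by rewrite (_ : complex.Im w - L + (L + L) - complex.Im w = L) 1?addrC //; ring.
have I4 : \int[leb]_(s in `[complex.Re w - L, complex.Re w - L + (L + L)[)
   (- complex.Im (g (plane (s, complex.Im w - L)))) = - (pi / 2).
  apply: opp; first exact: (continuous_slice2 _ _ cB).
  apply: Rintegral_atan => //.
    by move=> t; exact: (cvgN (continuous_slice2 _ _ cB t)).
  move=> t _; rewrite -[RHS]opprK; congr (- _); rewrite [LHS]gIm; last by apply: far2; left.
  by rewrite addrAC subrr add0r sqrrN mulNr addrC.
move: E; rewrite /flux I1 I2 I3 I4; lra.
Qed.

Lemma modulus_prod s z : modulus (\prod_(c <- s) ('X - c%:P)).[z] = \prod_(c <- s) modulus (z - c).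
Proof.
elim: s => [|c s IH]; first by rewrite !big_nil hornerC (modulus_real 1) normr1.
by rewrite !big_cons hornerM modulusM IH !hornerE.
Qed.

(** This is p'/p = sum of 1 / (z - c), proved by the product rule so that nothing is divided by
    p. *)
Lemma modulus_deriv_prod s z (d : R) : 0 < d -> (forall c, c \in s -> d <= modulus (z - c)) ->
  modulus (\prod_(c <- s) ('X - c%:P))^`().[z] <=
  (size s)%:R / d * modulus (\prod_(c <- s) ('X - c%:P)).[z].
Proof.
move=> d0; elim: s => [|c s IH] H.
  by rewrite !big_nil -[1]/(1%:P) derivC horner0 modulus0 !mul0r.
have /IH {}IH : forall c, c \in s -> d <= modulus (z - c).
  by move=> c' c's; apply: H; rewrite inE c's orbT.
have dc : d <= modulus (z - c) by apply: H; rewrite mem_head.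
rewrite !big_cons derivM derivXsubC mul1r hornerD !hornerM !hornerXsubC.
apply: (le_trans (modulusD _ _)); rewrite !(modulusM (z - c)).
move: IH dc; set q := \prod_(c <- s) _; set P := modulus q.[z]; set u := modulus (z - c).
move=> IH dc; have P0 : 0 <= P by exact: modulus_ge0.
have u0 : 0 <= u by exact: modulus_ge0.
rewrite [size _]/= -(addn1 (size s)) natrD mulrDl mulrDl addrC lerD //.
  by rewrite mulrCA ler_wpM2l.
rewrite mulrA -[leLHS]mul1r ler_wpM2r // mulrAC -[_ / d]mul1r mul1r mul1r.
by rewrite ler_pdivlMr // mul1r.
Qed.

(** On the sides |p'/p| is at most n / (L - D) for n roots, and (12/5) 2L / (L - D) <= 5 holds
    exactly when L >= 25 D. A larger square would only push 5 towards 24/5. *)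
Lemma ramp_energy_prod s w (a b L D : R) : 0 < a -> a < b -> 0 <= D -> 0 < L -> 25 * D <= L ->
  (forall c, c \in s -> modulus (c - w) <= D) ->
  \int[area]_(q in centered_square w L)
    (modulus (ramp_dbar a b (\prod_(c <- s) ('X - c%:P)) (plane q)) ^+ 2) <=
    5 * (size s)%:R / ln (b / a).
Proof.
move=> a0 ab D0 L0 DL sD.
have LD : 0 < L - D by lra.
have L20 : 0 < L + L by lra.
apply: (le_trans (ramp_energy a b _ a0 ab _ _ _ ((size s)%:R / (L - D)) L20 _ _)).
- by rewrite divr_ge0 // ltW.
- move=> u v hu hv huv; apply: modulus_deriv_prod => // c cs.
  have := modulus_boundary_ge w L u v hu hv huv.
  have := modulusD (u +i* v - c) (c - w); rewrite subrKA.
  have := sD c cs; lra.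
have := ln_ratio_gt0 a b a0 ab => Lam.
rewrite ler_pM2r ?invr_gt0 //.
rewrite [5 * _]mulrC (_ : 12 / 5 * _ * _ = (size s)%:R * (12 / 5 * (L + L) / (L - D))); last first.
  by field; rewrite gt_eqF.
rewrite ler_wpM2l // ler_pdivrMr //; lra.
Qed.

End Representation.

Lemma weighted_amgm {R : realType} (t x y : R) : 0 < t ->
  x * y <= t / 2 * x ^+ 2 + (2 * t)^-1 * y ^+ 2.
Proof.
move=> t0; have : 0 <= (t * x - y) ^+ 2 / (2 * t).
  by apply: divr_ge0; [exact: sqr_ge0|rewrite mulr_ge0 // ltW].
rewrite (_ : (t * x - y) ^+ 2 / (2 * t) = t / 2 * x ^+ 2 + (2 * t)^-1 * y ^+ 2 - x * y); first lra.
by field; rewrite gt_eqF.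
Qed.

(** * Bounding the kernel by the energy of a cutoff *)

Section CutoffBound.
Context {R : realType}.
Variables (Omega : set R[i]^o) (f : R[i]^o -> R[i]^o) (w : R[i]^o) (k : R).
Hypotheses (oOmega : open Omega) (Omegaw : Omega w).
Hypothesis holf : holomorphic_on Omega f.
Hypothesis fk : f w = k%:C.
Hypothesis intf :
  (\int[area]_(p in plane @^-1` Omega) (modulus (f (plane p)) ^+ 2)%:E <= k%:E)%E.

Lemma measurable_plane_preimage (U : set R[i]^o) : open U ->
  measurable (plane @^-1` U : set (measurableTypeR R * measurableTypeR R)).
Proof.
move=> oU; apply: open_plane_measurable.
by move/continuousP : (@continuous_plane R); exact.
Qed.

Lemma holomorphic_continuous z : Omega z -> {for z, continuous f}.
Proof. by move=> /holf/holomorphic_wirtinger[a /wirtinger_continuous]. Qed.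

Let u p : R := ((fun p => modulus (f (plane p)) ^+ 2) \_ (plane @^-1` Omega)) p.

Let measurable_sqf : measurable_fun (plane @^-1` Omega)
  (fun p : measurableTypeR R * measurableTypeR R => modulus (f (plane p)) ^+ 2 : measurableTypeR R).
Proof.
apply: (measurability _ (RGenOpens.measurableE R)).
move=> _ [_ [a [b ->] <-]]; set I := `]a, b[%classic.
have -> : plane @^-1` Omega `&`
    (fun p : measurableTypeR R * measurableTypeR R => modulus (f (plane p)) ^+ 2) @^-1` I =
  plane @^-1` (Omega `&` (fun z => modulus (f z) ^+ 2) @^-1` I) by [].
apply: measurable_plane_preimage; rewrite openE => z [Oz Iz].
have c1 : {for z, continuous (fun z : R[i]^o => modulus (f z) ^+ 2)}.
  rewrite (_ : (fun z => _) = (fun z : R[i]^o => complex.Re (f z * (f z)^*))); last first.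
    by apply/funext => y; rewrite mul_conj.
  apply: (cvg_comp (fun z : R[i]^o => f z * (f z)^* : R[i]^o) (@complex.Re R)); last exact: continuous_Re.
  apply: (@continuousM _ _ f (fun z => (f z)^* : R[i]^o)); first exact: holomorphic_continuous.
  apply: (cvg_comp f (@Num.conj _ : R[i]^o -> R[i]^o)); first exact: holomorphic_continuous.
  exact: continuous_conj.
rewrite /interior; apply: filterI; first by apply: open_nbhs_nbhs.
by apply: c1; apply: open_nbhs_nbhs; split => //; exact: interval_open.
Qed.

Let integrable_u : area.-integrable setT (EFin \o u).
Proof.
have -> : EFin \o u = (EFin \o (fun p => modulus (f (plane p)) ^+ 2)) \_ (plane @^-1` Omega).
  by rewrite restrict_EFin.
rewrite -integrable_mkcond; last exact: measurable_plane_preimage.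
apply/integrableP; split; first by apply/measurable_EFinP; exact: measurable_sqf.
apply: (le_lt_trans _ (ltry k)); apply: le_trans intf.
by under eq_integral do rewrite /= ger0_norm ?sqr_ge0 //.
Qed.

Let u_ge0 p : 0 <= u p.
Proof. by rewrite /u patchE; case: ifP => // _; exact: sqr_ge0. Qed.

Let Rintegral_u A : measurable A -> \int[area]_(p in A) u p <= k.
Proof.
move=> mA; rewrite -lee_fin /Rintegral fineK; last first.
  by apply: integrable_fin_num => //; exact: (integrableS _ _ (@subsetT _ A) integrable_u).
apply: le_trans intf; rewrite [leRHS]integral_mkcond.
rewrite (_ : _ \_ _ = EFin \o u); last by rewrite -restrict_EFin.
apply: ge0_subset_integral => //; last by move=> p _; rewrite lee_fin.
by case/integrableP : integrable_u.
Qed.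

Section TestFunction.
Variables (chi : R[i] -> R) (kappa : R[i]^o -> R[i]^o) (d L : R).
Hypothesis dchi : forall z, exists a, wirtinger (fun z => (chi z)%:C) z a (kappa z).
Hypothesis ckappa : continuous kappa.
Hypotheses (d0 : 0 < d) (dL : d <= L).
Hypothesis chi1 : forall z, modulus (z - w) < d -> chi z = 1 /\ kappa z = 0.
Hypothesis chi0 : forall z, ~ Omega z -> exists2 e : R, 0 < e &
  forall y, modulus (y - z) < e -> chi y = 0 /\ kappa y = 0.
Hypothesis chiL : forall z, L <= `|complex.Re (z - w)| \/ L <= `|complex.Im (z - w)| ->
  chi z = 0.

Let Q := centered_square w L.
Let psi e : R[i]^o -> R[i]^o := reg_inv (e ^+ 2) ('X - w%:P).
Let rho e : R[i]^o -> R[i]^o := reg_inv_dbar (e ^+ 2) ('X - w%:P).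
Let L20 : 0 < L + L. Proof. by have := lt_le_trans d0 dL => ?; rewrite addr_gt0. Qed.

Let psiE e z : 0 < e -> e <= modulus (z - w) -> psi e z = (z - w)^-1.
Proof.
move=> e0 ez; rewrite /psi reg_inv_ge ?exprn_gt0 // ?hornerXsubC // sqmod_XsubC.
by rewrite ler_pXn2r ?nnegrE ?modulus_ge0 // ltW.
Qed.

(** [kappa] vanishes on D(w, d), outside of which every regularization of scale at most d is the
    exact kernel. The error term therefore does not depend on e, and the limit e -> 0 concerns the
    bump alone. *)
Let kappa_psi e z : 0 < e -> e <= d -> kappa z * psi e z = kappa z * psi d z.
Proof.
move=> e0 ed; case: (ltP (modulus (z - w)) d) => [/chi1[_ ->]|dz]; first by rewrite !mul0r.
by rewrite !psiE // (le_trans ed).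
Qed.

Let cpsi e : 0 < e -> continuous (psi e).
Proof.
move=> e0 z; have e20 : 0 < e ^+ 2 by rewrite exprn_gt0.
by have [a /wirtinger_continuous] := wirtinger_reg_inv _ ('X - w%:P) z e20.
Qed.

Let crho e : 0 < e -> continuous (rho e).
Proof. by move=> e0; apply: continuous_reg_inv_dbar; rewrite exprn_gt0. Qed.

Let cchi : continuous (fun z : R[i]^o => (chi z)%:C : R[i]^o).
Proof. by move=> z; have [a /wirtinger_continuous] := dchi z. Qed.

(** The values of [f] off [Omega] are arbitrary, so continuity there relies on [c] vanishing on a
    whole neighbourhood. *)
Let cut_continuous (c : R[i]^o -> R[i]^o) : continuous c ->
  (forall z, ~ Omega z -> exists2 e : R, 0 < e & forall y, modulus (y - z) < e -> c y = 0) ->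
  continuous (fun z : R[i]^o => f z * c z : R[i]^o).
Proof.
move=> cc c0 z; have [Oz|Oz] := pselect (Omega z).
  exact: (@continuousM _ _ f c z (holomorphic_continuous z Oz) (cc z)).
have [e e0 H] := c0 _ Oz.
apply/continuous_atP => e' e'0; exists e => // y yz.
by rewrite !H ?subrr ?modulus0 // !mulr0 subrr modulus0.
Qed.

Let f_kappa_continuous : continuous (fun z : R[i]^o => f z * kappa z : R[i]^o).
Proof.
apply: (cut_continuous kappa ckappa) => z /chi0[e e0 H].
by exists e => // y /H[].
Qed.

Let f_chi_continuous : continuous (fun z : R[i]^o => f z * (chi z)%:C : R[i]^o).
Proof.
apply: (cut_continuous _ cchi) => z /chi0[e e0 H].
by exists e => // y /H[-> _].
Qed.

Let h1 e (z : R[i]^o) : R[i]^o := f z * kappa z * psi e z.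
Let h2 e (z : R[i]^o) : R[i]^o := f z * (chi z)%:C * rho e z.

Let ch1 e : 0 < e -> continuous (h1 e).
Proof. move=> e0; exact: (continuous_mul _ _ f_kappa_continuous (cpsi e e0)). Qed.

Let ch2 e : 0 < e -> continuous (h2 e).
Proof. move=> e0; exact: (continuous_mul _ _ f_chi_continuous (crho e e0)). Qed.

Let dg e z : 0 < e -> exists a, wirtinger (fun z => f z * (chi z)%:C * psi e z) z a (h1 e z + h2 e z).
Proof.
move=> e0; have [Oz|Oz] := pselect (Omega z).
  have [a1 w1] := holomorphic_wirtinger _ _ (holf z Oz).
  have [a2 w2] := dchi z.
  have e20 : 0 < e ^+ 2 by rewrite exprn_gt0.
  have [a3 w3] := wirtinger_reg_inv _ ('X - w%:P) z e20.
  eexists; apply: (wirtinger_eq (wirtingerM (wirtingerM w1 w2) w3)) => //.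
  by rewrite /h1 /h2 mul0r add0r.
have [d' d'0 H] := chi0 _ Oz.
have -> : h1 e z + h2 e z = 0.
  have z0 : modulus (z - z) < d' by rewrite subrr modulus0.
  have [c0 k0] := H z z0.
  by rewrite /h1 /h2 k0 c0 !mulr0 !mul0r addr0.
exists 0; apply: (wirtinger_near (fun=> 0) _ _ _ _ d' d'0 _ (wirtinger_cst 0 z)).
by move=> y /H[-> _]; rewrite mulr0 mul0r.
Qed.

(** [chi] vanishes on the sides of the square, hence so does the flux of f chi psi; [f] is
    holomorphic, so only [kappa] and the bump contribute to the dbar-derivative. *)
Let weak_dbar e : 0 < e ->
  \int[area]_(p in Q) complex.Re (h1 e (plane p)) +
  \int[area]_(p in Q) complex.Re (h2 e (plane p)) = 0.
Proof.
move=> e0.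
have ch : continuous (fun z : R[i]^o => h1 e z + h2 e z : R[i]^o).
  by move=> z; exact: (@continuousD _ _ _ (h1 e) (h2 e) z (ch1 e e0 z) (ch2 e e0 z)).
have dge z := dg e z e0.
have mQ : measurable Q by exact: measurable_square.
have i1 : area.-integrable Q (EFin \o (fun p => complex.Re (h1 e (plane p)))).
  exact: (integrable_square _ _ _ _ (continuous_Re_plane _ (ch1 e e0))).
have i2 : area.-integrable Q (EFin \o (fun p => complex.Re (h2 e (plane p)))).
  exact: (integrable_square _ _ _ _ (continuous_Re_plane _ (ch2 e e0))).
have := flux_bound _ _ dge (complex.Re w - L) (complex.Im w - L) (L + L) 0 (ltW L20) _.
rewrite (stokes _ _ dge ch _ _ _ L20) mulr0 mul0r normr_le0.
rewrite RintegralZl //=; last exact: (integrable_square _ _ _ _ (continuous_Re_plane _ ch)).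
rewrite -/Q mulf_eq0 pnatr_eq0 /= => H.
have E : \int[area]_(p in Q) (complex.Re (h1 e (plane p)) + complex.Re (h2 e (plane p))) =
    \int[area]_(p in Q) complex.Re (h1 e (plane p) + h2 e (plane p)).
  by apply: eq_Rintegral => p _; case: (h1 e (plane p)) (h2 e (plane p)) => [? ?] [? ?].
rewrite -RintegralD // E; apply/eqP.
apply: H => s t hs ht hst; rewrite chiL; last exact: (modulus_boundary w L s t hs ht hst).
by rewrite mulr0 mul0r modulus0.
Qed.

Let D := \int[area]_(p in Q) (modulus (kappa (plane p) * psi d (plane p)) ^+ 2).

(** A pointwise substitute for Cauchy-Schwarz. With weight pi the term in |f|^2 integrates to at
    most pi k / 2, half of the main term pi k, and can be absorbed. *)
Let h1_bound e z : 0 < e -> e <= d ->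
  - complex.Re (h1 e z) <= pi / 2 * (if `[< Omega z >] then modulus (f z) ^+ 2 else 0) +
    (2 * pi)^-1 * modulus (kappa z * psi d z) ^+ 2.
Proof.
move=> e0 ed; have pi0 := pi_gt0 R.
have pos : 0 <= (2 * pi)^-1 * modulus (kappa z * psi d z) ^+ 2.
  by rewrite mulr_ge0 ?sqr_ge0 // invr_ge0 mulr_ge0 // ltW.
case: asboolP => Oz; last first.
  have [e' e'0 /(_ z)] := chi0 _ Oz; rewrite subrr modulus0 => /(_ e'0)[_ k0].
  by rewrite /h1 k0 mulr0 mul0r oppr0 mulr0 add0r -k0.
rewrite /h1 -mulrA kappa_psi //.
set v := kappa z * psi d z in pos *.
apply: (@le_trans _ _ (modulus (f z) * modulus v)).
  by rewrite -modulusM; apply: le_trans (Re_le_modulus _); rewrite -normrN ler_norm.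
exact: weighted_amgm.
Qed.

(** Letting e tend to 0 in [weak_dbar] yields pi k <= pi k / 2 + D / (2 pi). *)
Lemma cutoff_bound : pi ^+ 2 * k <= D.
Proof.
have pi0 := pi_gt0 R.
have mQ : measurable Q by exact: measurable_square.
have iu : area.-integrable Q (EFin \o u) by exact: (integrableS _ _ (@subsetT _ Q) integrable_u).
have cD : continuous (fun p : R * R => modulus (kappa (plane p) * psi d (plane p)) ^+ 2).
  have c1 : continuous (fun z : R[i]^o => kappa z * psi d z : R[i]^o).
    exact: (continuous_mul _ _ ckappa (cpsi d d0)).
  have c2 : continuous (fun z : R[i]^o => (kappa z * psi d z)^* : R[i]^o).
    by move=> z; exact: (cvg_comp _ _ (c1 z) (continuous_conj _)).
  have E : (fun p : R * R => complex.Re ((kappa (plane p) * psi d (plane p)) *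
      (kappa (plane p) * psi d (plane p))^*)) =
      (fun p : R * R => modulus (kappa (plane p) * psi d (plane p)) ^+ 2).
    by apply/funext => p; rewrite mul_conj.
  by rewrite -E; exact: (continuous_Re_plane _ (continuous_mul _ _ c1 c2)).
have iD : area.-integrable Q (EFin \o (fun p => modulus (kappa (plane p) * psi d (plane p)) ^+ 2)).
  exact: integrable_square.
have upper e : 0 < e -> e <= d -> \int[area]_(p in Q) complex.Re (h2 e (plane p)) <=
    pi / 2 * k + (2 * pi)^-1 * D.
  move=> e0 ed; have := weak_dbar e e0.
  have i1 : area.-integrable Q (EFin \o (fun p => complex.Re (h1 e (plane p)))).
    exact: (integrable_square _ _ _ _ (continuous_Re_plane _ (ch1 e e0))).
  suff : - (\int[area]_(p in Q) complex.Re (h1 e (plane p))) <= pi / 2 * k + (2 * pi)^-1 * D by lra.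
  rewrite -mulN1r -RintegralZl //.
  have ia : area.-integrable Q (EFin \o (fun p => pi / 2 * u p)).
    by rewrite (_ : _ \o _ = (fun p => (pi / 2)%:E * (EFin \o u) p)%E) //; exact: integrableZl.
  have ib : area.-integrable Q (EFin \o (fun p => (2 * pi)^-1 *
      modulus (kappa (plane p) * psi d (plane p)) ^+ 2)).
    exact: integrable_square (continuous_scale _ cD).
  apply: (@le_trans _ _ (\int[area]_(p in Q) (pi / 2 * u p + (2 * pi)^-1 *
      modulus (kappa (plane p) * psi d (plane p)) ^+ 2))).
    apply: le_Rintegral => //.
    - rewrite (_ : _ \o _ = (fun p => (-1)%:E * (EFin \o (fun p => complex.Re (h1 e (plane p)))) p)%E) //.
      exact: integrableZl.
    - exact: (integrableD mQ ia ib).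
    move=> p _; rewrite mulN1r; apply: (le_trans (h1_bound e (plane p) e0 ed)).
    rewrite lerD2r ler_pM2l; last by rewrite divr_gt0.
    rewrite /u patchE; case: asboolP => Op; first by rewrite mem_set.
    by rewrite memNset.
  rewrite RintegralD // !RintegralZl //.
  by rewrite lerD2r ler_pM2l ?divr_gt0 //; exact: Rintegral_u.
(* On a disc D(w, e1) where chi = 1 and |f - k| < e, the integrand is at least k - e times the bump,
   which is nonnegative of mass pi; off that disc the bump is 0. *)
have lower e : 0 < e -> (k - e) * pi <= pi / 2 * k + (2 * pi)^-1 * D.
  move=> e0.
  have /continuous_atP/(_ e e0)[d' d'0 Hd'] := holomorphic_continuous w Omegaw.
  pose e1 := Num.min d' d; have e10 : 0 < e1 by rewrite lt_min d'0.
  have e1d : e1 <= d by rewrite ge_min lexx orbT.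
  apply: le_trans (upper e1 e10 e1d).
  have cb : continuous (fun p : R * R => complex.Re (rho e1 (plane p))).
    exact: continuous_Re_plane (crho e1 e10).
  have ib : area.-integrable Q (EFin \o (fun p => complex.Re (rho e1 (plane p)))).
    exact: integrable_square.
  have <- : \int[area]_(p in Q) complex.Re (rho e1 (plane p)) = pi.
    rewrite -(Rintegral_recip_bump w e1 L e10 (le_trans e1d dL)).
    by apply: eq_Rintegral => p _; rewrite /rho reg_inv_dbar_XsubC.
  rewrite -RintegralZl //; apply: le_Rintegral => //.
  - exact: integrable_square (continuous_scale _ cb).
  - exact: (integrable_square _ _ _ _ (continuous_Re_plane _ (ch2 e1 e10))).
  move=> p _; rewrite /h2 /rho reg_inv_dbar_XsubC.
  have e120 : 0 < e1 ^+ 2 by rewrite exprn_gt0.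
  set z := plane p; have [zw|zw] := ltP (modulus (z - w)) e1; last first.
    have e1z : e1 ^+ 2 <= modulus (z - w) ^+ 2.
      by rewrite ler_pXn2r ?nnegrE ?modulus_ge0 // ltW.
    rewrite (recip_bump_ge _ _ e120 e1z) /= mulr0.
    by case: (f z * _) => a b /=; rewrite !mulr0 subr0.
  have [-> _] := chi1 z (lt_le_trans zw e1d).
  rewrite mulr1 [leRHS](_ : _ = complex.Re (f z) * recip_bump (e1 ^+ 2) (modulus (z - w) ^+ 2)); last first.
    by case: (f z) => a b /=; rewrite mulr0 subr0.
  apply: ler_wpM2r; first by apply: recip_bump_ge0 => //; exact: sqr_ge0.
  have /Hd' : modulus (z - w) < d' by apply: (lt_le_trans zw); rewrite ge_min lexx.
  rewrite fk => /ltW /(le_trans (Re_le_modulus _)).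
  by case: (f z) => a b; rewrite /= ler_norml; lra.
have : k * pi <= pi / 2 * k + (2 * pi)^-1 * D.
  apply/ler_addgt0Pr => e e0.
  have := lower (e / pi) (divr_gt0 e0 pi0); rewrite mulrBl divfK ?gt_eqF //; lra.
move=> H; have {H} : k * pi / 2 <= (2 * pi)^-1 * D by lra.
rewrite -(ler_pM2l (mulr_gt0 (ltr0Sn R 1) pi0)) => H.
have -> : pi ^+ 2 * k = 2%:R * pi * (k * pi / 2).
  by move: (pi : R) => P; field.
by apply: (le_trans H); rewrite mulrA divff ?mul1r // mulf_neq0 ?gt_eqF.
Qed.

End TestFunction.
End CutoffBound.

(** * Leja points and their limit distribution *)

Section Leja.
Context {R : realType}.

Lemma leja_sequence (E : set R[i]) (c : R) : E !=set0 ->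
  (forall s : seq R[i], s != [::] -> (forall x, x \in s -> E x) ->
     exists2 z, E z & c ^+ size s <= \prod_(x <- s) modulus (z - x)) ->
  exists e : nat -> R[i], (forall n, E (e n)) /\
    forall n, c ^+ n <= \prod_(i < n) modulus (e n - e i).
Proof.
move=> [z0 Ez0] H.
(* The hypothesis excludes the empty list; there the product is 1 = c^0 and any point of [E] will
   do. *)
have next (s : seq R[i]) : (forall x, x \in s -> E x) ->
    exists z, E z /\ c ^+ size s <= \prod_(x <- s) modulus (z - x).
  move=> sE; have [->|s0] := eqVneq s [::]; last by have [z ? ?] := H s s0 sE; exists z.
  by exists z0; rewrite big_nil.
pose good s := [set z | E z /\ c ^+ size s <= \prod_(x <- s) modulus (z - x)].
pose L := fix L n : seq R[i] := if n is m.+1 then rcons (L m) (xget z0 (good (L m))) else [::].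
pose e n := xget z0 (good (L n)).
have LS n : L n.+1 = rcons (L n) (e n) by [].
have LE n : (forall x, x \in L n -> E x) /\ good (L n) (e n).
  elim: n => [|n [IH1 IH2]].
    split=> //; rewrite /e; case: xgetP => [z -> //|/(_ z0) []].
    by split; rewrite //= big_nil.
  have h : forall x, x \in L n.+1 -> E x.
    by move=> x; rewrite LS mem_rcons inE => /predU1P[->|/IH1 //]; have [] := IH2.
  split=> //; rewrite /e; case: xgetP => [z -> //|].
  by have [z hz] := next _ h => /(_ z).
have Lmk n : L n = mkseq e n.
  elim: n => // n IH; rewrite LS IH /mkseq -cats1.
  by rewrite -[n.+1]addn1 iotaD map_cat.
exists e; split=> n; have [_ [h1 h2]] := LE n; first exact: h1.
move: h2; rewrite {1 2}Lmk size_mkseq => /le_trans -> //.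
by rewrite /mkseq big_map -[X in iota 0 X]subn0 -/(index_iota 0 n) big_mkord.
Qed.

End Leja.

Section UltraMean.
Context {R : realType}.

(** Compactness of the segment along an ultrafilter. All limiting frequencies exist at once, with no
    diagonal extraction of subsequences. *)
Lemma ultra_limit (U : set_system nat) (x : nat -> R) (a b : R) : UltraFilter U ->
  (forall n, a <= x n <= b) -> cvg (x @ U).
Proof.
move=> UU xab.
have xU : UltraFilter (x @ U).
  split=> [|G GP sG]; first exact: fmap_proper_filter.
  apply/seteqP; split => A GA; last exact: sG.
  have [//|UA] := in_ultra_setVsetC (x @^-1` A) UU.
  have /filter_ex[? []] : G (A `&` ~` A) by apply: filterI => //; exact: sG.
  by [].
have := @segment_compact R a b; rewrite compact_ultra => /(_ _ xU).
move=> [|l [_ xl]]; last by apply/cvg_ex; exists l.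
apply: (@filterS _ U _ setT) => [n _|]; last exact: filterT.
by have := xab n; rewrite /= in_itv.
Qed.

End UltraMean.

(* The first [N] coordinates of [k |-> idx _ k] are packed into the mixed-radix
   number [code N k]. The limiting frequencies of these codes along the
   ultrafilter [U] are realized on [0, 1[ by their quantile functions, which are
   compatible for different [N]. *)
Section Code.
Context {R : realType}.
Variables (U : set_system nat) (K : nat -> nat) (idx : nat -> nat -> nat).
Hypotheses (UU : UltraFilter U) (idxK : forall N k, (idx N k < K N)%N).

Fixpoint code N k := if N is N'.+1 then (code N' k * K N' + idx N' k)%N else 0%N.
Fixpoint ncode N := if N is N'.+1 then (ncode N' * K N')%N else 1%N.

Lemma code_lt N k : (code N k < ncode N)%N.
Proof.
elim: N => //= N IH; apply: (@leq_trans ((code N k).+1 * K N)).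
  by rewrite mulSn [X in (X < _)%N]addnC ltn_add2r.
by rewrite leq_mul2r IH orbT.
Qed.

Let K0 N : (0 < K N)%N. Proof. exact: leq_ltn_trans (idxK N 0). Qed.

Lemma codeS_div N k : (code N.+1 k %/ K N)%N = code N k.
Proof. by rewrite /= divnMDl // divn_small ?addn0. Qed.

Lemma codeS_mod N k : (code N.+1 k %% K N)%N = idx N k.
Proof. by rewrite /= modnMDl modn_small. Qed.

Definition freq n (A : pred nat) : R := (\sum_(k < n.+1) (A k)%:R) / n.+1%:R.

Lemma freq_bounds n A : 0 <= freq n A <= 1.
Proof.
rewrite /freq divr_ge0 ?sumr_ge0 //= ler_pdivrMr ?ltr0n // mul1r.
rewrite -[X in _ <= X]mulr1 mulr_natl -[X in _ <= _ *+ X](card_ord n.+1) -sumr_const.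
by apply: ler_sum => k _; case: (A k).
Qed.

Lemma freq_le n (A B : pred nat) : (forall k, A k -> B k) -> freq n A <= freq n B.
Proof.
move=> AB; rewrite /freq ler_pM2r ?invr_gt0 ?ltr0n //; apply: ler_sum => k _.
by case Ak : (A k) => //; rewrite (AB _ Ak).
Qed.

Lemma cvg_freq A : cvg (freq n A @[n --> U]).
Proof. by apply: (ultra_limit U _ 0 1 UU) => n; exact: freq_bounds. Qed.

Definition limit_freq A : R := lim (freq n A @[n --> U]).

Lemma limit_freq_cvg A : freq n A @[n --> U] --> limit_freq A.
Proof. exact: cvg_freq. Qed.

Lemma limit_freq_le (A B : pred nat) : (forall k, A k -> B k) -> limit_freq A <= limit_freq B.
Proof.
by move=> AB; apply: ler_lim; try exact: cvg_freq; apply: nearW => n; exact: freq_le.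
Qed.

Lemma limit_freq_eq (A B : pred nat) : A =1 B -> limit_freq A = limit_freq B.
Proof.
by move=> AB; apply: le_anti; rewrite !limit_freq_le // => k; rewrite AB.
Qed.

Definition code_cdf N j := limit_freq (fun k => (code N k < j)%N).

Lemma code_cdf0 N : code_cdf N 0 = 0.
Proof.
apply: (@cvg_lim R (@Rhausdorff R) nat U) => //.
have -> : (freq ^~ (fun k => (code N k < 0)%N)) = (fun=> 0).
  by apply/funext => n; rewrite /freq big1 ?mul0r.
exact: cvg_cst.
Qed.

Lemma code_cdf1 N : code_cdf N (ncode N) = 1.
Proof.
apply: (@cvg_lim R (@Rhausdorff R) nat U) => //.
have -> : (freq ^~ (fun k => (code N k < ncode N)%N)) = (fun=> 1).
  apply/funext => n; rewrite /freq (eq_bigr (fun=> 1)) => [|k _]; last by rewrite code_lt.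
  by rewrite sumr_const card_ord divff // pnatr_eq0.
exact: cvg_cst.
Qed.

Lemma code_cdf_le N i j : (i <= j)%N -> code_cdf N i <= code_cdf N j.
Proof. by move=> ij; apply: limit_freq_le => k ki; exact: leq_trans ki ij. Qed.

(** The codes of level N + 1 below j K(N) are exactly those whose prefix is below j. The partitions
    of [0, 1[ at successive levels are thus refinements of each other, and quantiles at different
    levels agree. *)
Lemma code_cdfS N j : code_cdf N.+1 (j * K N) = code_cdf N j.
Proof. by apply: limit_freq_eq => k; rewrite -[code N k]codeS_div ltn_divLR. Qed.

Lemma ncode_gt0 N : (0 < ncode N)%N.
Proof. exact: leq_ltn_trans (code_lt N 0). Qed.

Definition code_quantile N s := find (fun j => s < code_cdf N j.+1) (iota 0 (ncode N)).

Lemma code_quantile_uniq N s i j : code_cdf N i <= s < code_cdf N i.+1 -> code_cdf N j <= s < code_cdf N j.+1 -> i = j.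
Proof.
move=> /andP[i1 i2] /andP[j1 j2]; apply/eqP; rewrite eqn_leq; apply/andP; split.
  rewrite leqNgt; apply/negP => /(code_cdf_le N) h.
  by have := le_lt_trans (le_trans h i1) j2; rewrite ltxx.
rewrite leqNgt; apply/negP => /(code_cdf_le N) h.
by have := le_lt_trans (le_trans h j1) i2; rewrite ltxx.
Qed.

Lemma code_quantileP N s : 0 <= s < 1 -> (code_quantile N s < ncode N)%N /\ code_cdf N (code_quantile N s) <= s < code_cdf N (code_quantile N s).+1.
Proof.
move=> /andP[s0 s1].
have hs : has (fun j => s < code_cdf N j.+1) (iota 0 (ncode N)).
  apply/hasP; exists (ncode N).-1; first by rewrite mem_iota /= add0n ltn_predL ncode_gt0.
  by rewrite prednK ?ncode_gt0 // code_cdf1.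
have JN : (code_quantile N s < ncode N)%N by move: hs; rewrite has_find size_iota.
split=> //; apply/andP; split; last by have := nth_find 0 hs; rewrite nth_iota // add0n.
case E : (code_quantile N s) => [|j]; first by rewrite code_cdf0.
have jJ : (j < code_quantile N s)%N by rewrite E.
have := before_find 0 jJ; rewrite nth_iota; last exact: ltn_trans jJ JN.
by rewrite add0n => /negbT; rewrite -leNgt.
Qed.

Lemma code_quantile_eq N s j : 0 <= s < 1 -> code_cdf N j <= s < code_cdf N j.+1 -> code_quantile N s = j.
Proof. by move=> s01 h; apply: code_quantile_uniq h; have [_] := code_quantileP N s s01. Qed.

Lemma code_quantileS_div N s : 0 <= s < 1 -> (code_quantile N.+1 s %/ K N)%N = code_quantile N s.
Proof.
move=> s01; symmetry; apply: code_quantile_eq => //.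
rewrite -(code_cdfS N (code_quantile N.+1 s %/ K N)) -(code_cdfS N (code_quantile N.+1 s %/ K N).+1).
have [_ /andP[h1 h2]] := code_quantileP N.+1 s s01.
rewrite (le_trans _ h1) ?code_cdf_le ?leq_divM //=.
by apply: (lt_le_trans h2); apply: code_cdf_le; rewrite ltn_ceil.
Qed.

(** A code taken by no index would have a quantile interval of length zero, which contains no s. *)
Lemma code_quantile_code N s : 0 <= s < 1 -> exists k, code N k = code_quantile N s.
Proof.
move=> s01; have [_ /andP[h1 h2]] := code_quantileP N s s01; apply: contrapT => /forallNP no.
have : code_cdf N (code_quantile N s).+1 <= code_cdf N (code_quantile N s).
  by apply: limit_freq_le => k; rewrite ltnS leq_eqVlt => /predU1P[/no|].
by rewrite leNgt (le_lt_trans h1 h2).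
Qed.

Lemma code_quantile_le N M s k : 0 <= s < 1 -> (N <= M)%N -> code M k = code_quantile M s -> code N k = code_quantile N s.
Proof.
move=> s01 /subnK <-; elim: (M - N)%N => // d IH; rewrite addSn => h.
by apply: IH; rewrite -codeS_div h code_quantileS_div.
Qed.

End Code.

(** * The limit of the Leja points as a random variable on the unit interval *)

Section LimitVariable.
Context {R : realType}.
Variables (E : set R[i]^o) (B : R) (e : nat -> R[i]).
Hypotheses (clE : closed E) (EB : forall z, E z -> modulus z <= B) (eE : forall n, E (e n)).
Variable U : set_system nat.
Hypothesis UU : UltraFilter U.

Let B0 : 0 <= B. Proof. exact: le_trans (modulus_ge0 _) (EB _ (eE 0)). Qed.

(** Mesh 2^-(N+1): two points of one cell then differ by at most 2^-N, the sum of the gaps of their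
    coordinates. *)
Definition grid (N : nat) (x : R) : nat := Num.truncn ((x + B) * 2 ^+ N.+1).
Definition grid_size (N : nat) : nat := (grid N B).+1.
Definition cell (N k : nat) : nat :=
  (grid N (complex.Re (e k)) * grid_size N + grid N (complex.Im (e k)))%N.

Lemma grid_lt N x : `|x| <= B -> (grid N x < grid_size N)%N.
Proof.
move=> /ler_normlP[_ xB]; rewrite ltnS; apply: le_truncn.
by rewrite ler_wpM2r ?exprn_ge0 // lerD2r.
Qed.

Lemma grid_eq N x y : `|x| <= B -> `|y| <= B -> grid N x = grid N y ->
  `|x - y| <= (2 ^+ N.+1)^-1.
Proof.
move=> /ler_normlP[x1 x2] /ler_normlP[y1 y2] xy.
have p0 : 0 < 2 ^+ N.+1 :> R by rewrite exprn_gt0.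
have h1 : 0 <= (x + B) * 2 ^+ N.+1 by apply: mulr_ge0; [lra|exact: ltW].
have h2 : 0 <= (y + B) * 2 ^+ N.+1 by apply: mulr_ge0; [lra|exact: ltW].
have := truncn_itv h1; have := truncn_itv h2; rewrite -/(grid N x) -/(grid N y) xy.
move=> /andP[a1 a2] /andP[b1 b2]; rewrite -natr1 in a2 b2.
rewrite -[_^-1]mul1r ler_pdivlMr // -[X in _ * X]gtr0_norm // -normrM ler_norml; lra.
Qed.

Lemma cell_lt N k : (cell N k < grid_size N * grid_size N)%N.
Proof.
have h1 := grid_lt N _ (le_trans (Re_le_modulus _) (EB _ (eE k))).
have h2 := grid_lt N _ (le_trans (Im_le_modulus _) (EB _ (eE k))).
apply: (@leq_trans ((grid N (complex.Re (e k))).+1 * grid_size N)).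
  by rewrite mulSn [X in (_ <= X)%N]addnC ltn_add2l.
by rewrite leq_mul2r h1 orbT.
Qed.

Lemma cell_eq N k l : cell N k = cell N l -> modulus (e k - e l) <= (2 ^+ N)^-1.
Proof.
have R1 := le_trans (Re_le_modulus _) (EB _ (eE k)).
have R2 := le_trans (Re_le_modulus _) (EB _ (eE l)).
have I1 := le_trans (Im_le_modulus _) (EB _ (eE k)).
have I2 := le_trans (Im_le_modulus _) (EB _ (eE l)).
move=> h; have hI : grid N (complex.Im (e k)) = grid N (complex.Im (e l)).
  by have := congr1 (modn^~ (grid_size N)) h; rewrite /cell !modnMDl !modn_small ?grid_lt.
have hR : grid N (complex.Re (e k)) = grid N (complex.Re (e l)).
  by have := congr1 (divn^~ (grid_size N)) h; rewrite /cell !divnMDl // !divn_small ?grid_lt // !addn0.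
have := grid_eq N _ _ R1 R2 hR; have := grid_eq N _ _ I1 I2 hI.
have -> : (2 ^+ N)^-1 = (2 ^+ N.+1)^-1 + (2 ^+ N.+1)^-1 :> R.
  by rewrite exprS; field; rewrite expf_neq0.
have := modulus_le_ReIm (e k - e l).
by case: (e k) (e l) => [a b] [a' b'] /=; lra.
Qed.

Local Notation cd := (code (fun N => grid_size N * grid_size N)%N cell).
Local Notation nc := (ncode (fun N => grid_size N * grid_size N)%N).
Local Notation cdf := (@code_cdf R U (fun N => grid_size N * grid_size N)%N cell).
Local Notation quantile := (@code_quantile R U (fun N => grid_size N * grid_size N)%N cell).

(** Quantiles make sense on [0, 1[ only; every other s is sent to 0. In [0, 1] this affects just the
    null set {1}. *)
Definition clip01 (s : R) : R := if 0 <= s < 1 then s else 0.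

Lemma clip01_bounds s : 0 <= clip01 s < 1.
Proof. by rewrite /clip01; case: ifP => // _; rewrite lexx ltr01. Qed.

Definition cell_index N s : nat := quantile N (clip01 s).

Definition cell_rep N j : nat := xget 0%N [set k | cd N k = j].

Definition leja_approx N s : R[i] := e (cell_rep N (cell_index N s)).

Lemma cell_rep_code N s : cd N (cell_rep N (cell_index N s)) = cell_index N s.
Proof.
rewrite /cell_rep; case: xgetP => [k _ //|].
have [k hk] := code_quantile_code U _ _ UU cell_lt N (clip01 s) (clip01_bounds s).
by move=> /(_ k).
Qed.

Lemma cell_rep_dist N k : modulus (e (cell_rep N.+1 (cd N.+1 k)) - e k) <= (2 ^+ N)^-1.
Proof.
apply: cell_eq; rewrite /cell_rep; case: xgetP => [l _ /= hl|/(_ k) []//].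
by rewrite -(codeS_mod _ _ cell_lt N l) -(codeS_mod _ _ cell_lt N k) /= hl.
Qed.

(** Representatives at levels beyond N have the same code of length N + 1, whose last digit is the
    cell of level N; hence the strict inequalities. *)
Lemma leja_approx_dist N M M' s : (N < M)%N -> (N < M')%N -> modulus (leja_approx M s - leja_approx M' s) <= (2 ^+ N)^-1.
Proof.
move=> NM NM'; apply: cell_eq.
have h1 := code_quantile_le U _ _ UU cell_lt N.+1 M (clip01 s) _ (clip01_bounds s) NM (cell_rep_code M s).
have h2 := code_quantile_le U _ _ UU cell_lt N.+1 M' (clip01 s) _ (clip01_bounds s) NM' (cell_rep_code M' s).
by rewrite -(codeS_mod _ _ cell_lt N (cell_rep M _)) -(codeS_mod _ _ cell_lt N (cell_rep M' _)) h1 h2.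
Qed.

Lemma pow2_small (d : R) : 0 < d -> exists N, (2 ^+ N)^-1 < d.
Proof.
move=> d0; have di : 0 <= d^-1 by rewrite invr_ge0 ltW.
have /archi_boundP := di; set n := Num.bound _ => nb; exists n.
rewrite invf_plt ?posrE ?exprn_gt0 //; apply: (lt_trans nb).
by rewrite -natrX ltr_nat ltn_expl.
Qed.

Lemma dyadic_cauchy (x : nat -> R) :
  (forall N M M', (N < M)%N -> (N < M')%N -> `|x M - x M'| <= (2 ^+ N)^-1) ->
  cvgn x /\ forall N M, (N < M)%N -> `|x M - limn x| <= (2 ^+ N)^-1.
Proof.
move=> H.
have cx : cvgn x.
  apply/cauchy_cvgP/cauchy_ballP => d d0; have [N Nd] := pow2_small d d0.
  rewrite near_map2; exists ([set k | (N < k)%N], [set k | (N < k)%N]).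
    by split; exact: nbhs_infty_gt.
  by move=> [M M'] [/= NM NM']; apply: (le_lt_trans _ Nd); exact: H.
split=> // N M NM.
have : (fun k => `|x M - x k|) @ \oo --> `|x M - limn x|.
  by apply: cvg_norm; apply: cvgB => //; exact: cvg_cst.
move=> /cvgr_to_le; apply.
by near=> k; apply: H => //; near: k; exact: nbhs_infty_gt.
Unshelve. all: by end_near. Qed.

Definition leja_limit_Re s : R := limn (fun N => complex.Re (leja_approx N s)).
Definition leja_limit_Im s : R := limn (fun N => complex.Im (leja_approx N s)).

Let ReX s : forall N M M', (N < M)%N -> (N < M')%N ->
  `|complex.Re (leja_approx M s) - complex.Re (leja_approx M' s)| <= (2 ^+ N)^-1.
Proof.
move=> N M M' NM NM'; apply: le_trans (leja_approx_dist N M M' s NM NM').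
by apply: le_trans (Re_le_modulus _); case: (leja_approx M s) (leja_approx M' s) => [? ?] [? ?].
Qed.

Let ImX s : forall N M M', (N < M)%N -> (N < M')%N ->
  `|complex.Im (leja_approx M s) - complex.Im (leja_approx M' s)| <= (2 ^+ N)^-1.
Proof.
move=> N M M' NM NM'; apply: le_trans (leja_approx_dist N M M' s NM NM').
by apply: le_trans (Im_le_modulus _); case: (leja_approx M s) (leja_approx M' s) => [? ?] [? ?].
Qed.

(** For s uniform on [0, 1], its law is the limit distribution of the Leja points. It is built as a
    pointwise limit of points of [E], so that no weak convergence of measures is needed. *)
Definition leja_limit s : R[i] := leja_limit_Re s +i* leja_limit_Im s.

Lemma leja_approx_near N s : modulus (leja_approx N.+1 s - leja_limit s) <= 2 * (2 ^+ N)^-1.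
Proof.
have [_ h1] := dyadic_cauchy _ (ReX s); have [_ h2] := dyadic_cauchy _ (ImX s).
have := h1 N N.+1 (ltnSn N); have := h2 N N.+1 (ltnSn N); rewrite -/(leja_limit_Re s) -/(leja_limit_Im s) /leja_limit.
move: (modulus_le_ReIm (leja_approx N.+1 s - (leja_limit_Re s +i* leja_limit_Im s))).
by case: (leja_approx N.+1 s) => a b /=; lra.
Qed.

Lemma leja_limit_in s : E (leja_limit s).
Proof.
apply: clE => V /nbhs_ballP[d0 /= d00 Hd].
have dE := gt0_complexE d00.
have d1 : 0 < complex.Re d0 by rewrite -ltcR -dE.
have [N Nd] := pow2_small (complex.Re d0 / 2) (divr_gt0 d1 (ltr0Sn R 1)).
exists (leja_approx N.+1 s); split; first exact: eE.
apply: Hd; rewrite /ball /= modulus_normE dE ltcR modulusBC.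
by apply: (le_lt_trans (leja_approx_near N s)); lra.
Qed.

Local Notation T := (measurableTypeR R).

Lemma measurable_cell_index N : measurable_fun setT (cell_index N : T -> nat).
Proof.
move=> _ Y _; rewrite setTI.
have fib j : measurable [set s : T | cell_index N s = j].
  (* The 2 is an arbitrary point outside [0, 1[: all of them are clipped to 0 and share one cell. *)
  have -> : [set s : T | cell_index N s = j] =
     (`[0, 1[ `&` `[cdf N j, cdf N j.+1[) `|` (if cell_index N 2 == j then ~` `[0, 1[ else set0).
    have clip2 : cell_index N 2 = quantile N 0 by rewrite /cell_index /clip01 ifF //; apply/negP; lra.
    apply/seteqP; split => [s /= sj|s /=].
      have [s01|s01] := boolP (0 <= s < 1).
        left; rewrite !in_itv /=; split=> //; rewrite -sj.
        have [_ ] := code_quantileP U _ _ UU cell_lt N (clip01 s) (clip01_bounds s).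
        by rewrite -/(cell_index N s) /clip01 s01.
      right; have -> : cell_index N 2 == j.
        by rewrite clip2 -sj /cell_index /clip01 (negbTE s01).
      by rewrite /= in_itv /=; apply/negP.
    move=> [[]|]; first rewrite !in_itv /= => s01 sF.
      by rewrite /cell_index /clip01 s01; apply: (code_quantile_eq U _ _ UU cell_lt).
    case: eqP => // <- /=; rewrite in_itv /= => /negP s01.
    by rewrite clip2 /cell_index /clip01 (negbTE s01).
  by apply: measurableU; [exact: measurableI|case: ifP => // _; exact: measurableC].
rewrite (_ : (cell_index N : T -> nat) @^-1` Y = \bigcup_(j in Y) [set s : T | cell_index N s = j]).
  by apply: bigcup_measurable => j _; exact: fib.
by apply/seteqP; split => [s /= ?|s [j Yj /= ->]] //; exists (cell_index N s).
Qed.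

Lemma measurable_fun_cell_index N (phi : nat -> R) :
  measurable_fun setT (fun s : T => phi (cell_index N s) : T).
Proof. by apply: (measurableT_comp (f := phi)) => //; exact: measurable_cell_index. Qed.

Lemma measurable_leja_limit_Re : measurable_fun setT (leja_limit_Re : T -> T).
Proof.
apply: (@measurable_fun_cvg _ T R setT (fun N (s : T) => complex.Re (leja_approx N s)) leja_limit_Re) => [N|s _].
  exact: (measurable_fun_cell_index N (fun j => complex.Re (e (cell_rep N j)))).
by have [] := dyadic_cauchy _ (ReX s).
Qed.

Lemma measurable_leja_limit_Im : measurable_fun setT (leja_limit_Im : T -> T).
Proof.
apply: (@measurable_fun_cvg _ T R setT (fun N (s : T) => complex.Im (leja_approx N s)) leja_limit_Im) => [N|s _].
  exact: (measurable_fun_cell_index N (fun j => complex.Im (e (cell_rep N j)))).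
by have [] := dyadic_cauchy _ (ImX s).
Qed.

Definition unit_uniform : probability T R := uniform_prob (@ltr01 R).

Definition weight N j : R := cdf N j.+1 - cdf N j.

Lemma weight_ge0 N j : 0 <= weight N j.
Proof. by rewrite subr_ge0; apply: code_cdf_le. Qed.

Lemma weight_sum N : \sum_(j < nc N) weight N j = 1.
Proof.
by rewrite -(big_mkord xpredT (weight N)) /weight telescope_sumr // code_cdf1 // ?code_cdf0 ?subr0 //; exact: cell_lt.
Qed.

(** An upper bound is enough, as only nonnegative functions will be integrated. The point 1,
    displaced by [clip01], is added to the quantile interval at no cost. *)
Lemma unit_uniform_fiber N j : (unit_uniform [set s | cell_index N s = j] <= (weight N j)%:E)%E.
Proof.
rewrite /unit_uniform /= /uniform_prob integral_uniform_pdf.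
set A := [set s | _]; have mA : measurable A.
  by have := measurable_cell_index N measurableT [set j] I; rewrite setTI.
rewrite (eq_integral (fun=> 1%E)); last first.
  move=> s; rewrite inE /= => -[_]; rewrite in_itv /= => s01.
  by rewrite /uniform_pdf s01 subr0 invr1.
rewrite integral_cst ?mul1e; last exact: measurableI.
have AF : A `&` `[0, 1] `<=` `[cdf N j, cdf N j.+1[ `|` [set 1].
  move=> s [/= sj]; rewrite in_itv /= => /andP[s0].
  rewrite le_eqVlt => /predU1P[->|s1]; first by right.
  left; rewrite in_itv /= -sj.
  have [_ ] := code_quantileP U _ _ UU cell_lt N (clip01 s) (clip01_bounds s).
  by rewrite -/(cell_index N s) /clip01 s0 s1.
have mA1 : measurable (A `&` `[0, 1]) by exact: measurableI.
have mF1 : measurable (`[cdf N j, cdf N j.+1[ `|` [set (1 : R)] : set T) by exact: measurableU.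
apply: (le_trans (@le_measure _ _ _ (@lebesgue_measure R) _ _ (mem_set mA1) (mem_set mF1) AF)).
apply: (le_trans (measureU2 _ _ _)) => //.
rewrite [X in (_ + X)%E](_ : _ = 0%E); last exact: lebesgue_measure_set1.
rewrite adde0 [leLHS]lebesgue_measure_itv /= lte_fin.
by case: ifP => // _; rewrite ?lee_fin ?weight_ge0.
Qed.

Lemma integral_cell_index N (phi : nat -> R) : (forall j, 0 <= phi j) ->
  (\int[unit_uniform]_s (phi (cell_index N s))%:E <= (\sum_(j < nc N) weight N j * phi j)%:E)%E.
Proof.
move=> phi0.
have mA (j : nat) : measurable ([set s | cell_index N s = j] : set T).
  by have := measurable_cell_index N measurableT [set j] I; rewrite setTI.
pose A (j : nat) : set T := [set s | cell_index N s = j].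
rewrite (_ : (fun s => (phi (cell_index N s))%:E) =
    (fun s : T => \sum_(j < nc N) ((phi j)%:E * (\1_(A j) s)%:E))%E); last first.
  apply/funext => s; have [jn _] := code_quantileP U _ _ UU cell_lt N (clip01 s) (clip01_bounds s).
  rewrite (bigD1 (Ordinal jn)) //= indicE mem_set // mule1 big1 ?adde0 // => i ij.
  by rewrite indicE memNset ?mule0 //= => h; move: ij; rewrite -val_eqE /= -h eqxx.
rewrite ge0_integral_sum //=; last first.
- by move=> j s _; rewrite mule_ge0 // lee_fin.
- move=> j; apply/measurable_EFinP; apply: measurable_funM => //; exact: (measurable_indic (mA j)).
rewrite -sumEFin; apply: lee_sum => j _.
rewrite ge0_integralZl_EFin //; last by apply/measurable_EFinP; exact: (measurable_indic (mA j)).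
rewrite integral_indic; [|exact: measurableT|exact: mA].
rewrite setIT [leRHS]EFinM [leRHS]muleC.
by apply: lee_wpmul2l; [rewrite lee_fin|exact: unit_uniform_fiber].
Qed.

End LimitVariable.

(** * Truncated logarithmic energy of the Leja points *)

Section LogKernel.
Context {R : realType}.

(** Truncation at [eta] makes the kernel finite on the diagonal and Lipschitz with constant 1 / eta
    in the distance, while staying above log |z - w|. *)
Definition log_kernel (eta : R) (z w : R[i]) : R := ln (Num.max (modulus (z - w)) eta).

Lemma log_kernelC eta z w : log_kernel eta z w = log_kernel eta w z.
Proof. by rewrite /log_kernel modulusBC. Qed.

Lemma ln_max_lip (eta x y : R) : 0 < eta ->
  ln (Num.max x eta) - ln (Num.max y eta) <= `|x - y| / eta.
Proof.
move=> eta0; set a := Num.max x eta; set b := Num.max y eta.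
have a0 : 0 < a by rewrite lt_max eta0 orbT.
have b0 : 0 < b by rewrite lt_max eta0 orbT.
have be : eta <= b by rewrite le_max lexx orbT.
have ab : a - b <= `|x - y|.
  have : a <= b + `|x - y|.
    rewrite ge_max; apply/andP; split.
      have : y <= b by rewrite le_max lexx.
      by have := ler_norm (x - y); lra.
    by have := normr_ge0 (x - y); lra.
  by lra.
rewrite -ln_div ?posrE //.
have -> : a / b = 1 + (a - b) / b by field; rewrite gt_eqF.
have h : -1 < (a - b) / b by rewrite ltr_pdivlMr //; lra.
apply: (le_trans (le_ln1Dx h)).
apply: (@le_trans _ _ (`|x - y| / b)); first by rewrite ler_pM2r ?invr_gt0.
by apply: ler_wpM2l => //; rewrite lef_pV2 ?posrE.
Qed.

Lemma log_kernel_lip eta (z w z' w' : R[i]) : 0 < eta ->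
  log_kernel eta z w <= log_kernel eta z' w' + (modulus (z - z') + modulus (w - w')) / eta.
Proof.
move=> eta0; rewrite -lerBlDl; apply: (le_trans (ln_max_lip _ _ _ eta0)).
apply: ler_wpM2r; first by rewrite invr_ge0 ltW.
have h1 := modulusD (z - z') (z' - w'); have h2 := modulusD (z' - z) (z - w).
have h3 := modulusD (z - w') (w' - w); have h4 := modulusD (z' - w) (w - w').
have h5 := modulusD (z - z') (z' - w).
have h6 := modulusD (z' - z) (z - w').
rewrite !subrKA in h1 h2 h3 h4 h5 h6.
have s1 := modulusBC z z'; have s2 := modulusBC w w'.
rewrite ler_norml; lra.
Qed.

Lemma ln_prod n (x : 'I_n -> R) : (forall i, 0 < x i) ->
  ln (\prod_(i < n) x i) = \sum_(i < n) ln (x i).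
Proof.
elim: n x => [|n IH] x x0; first by rewrite !big_ord0 ln1.
by rewrite !big_ord_recr lnM ?posrE ?IH //; apply: prodr_gt0.
Qed.

(** The point e_n adds a row and a column, each at least n log c by the choice of e_n, and the
    diagonal term log eta. *)
Lemma sum_log_kernel (e : nat -> R[i]) (c eta : R) (n : nat) : 0 < c -> 0 < eta ->
  (forall n, c ^+ n <= \prod_(i < n) modulus (e n - e i)) ->
  n%:R * (n%:R - 1) * ln c + n%:R * ln eta <=
    \sum_(k < n) \sum_(l < n) log_kernel eta (e k) (e l).
Proof.
move=> c0 eta0 H; elim: n => [|n IH]; first by rewrite big_ord0 !mul0r addr0.
have row : n%:R * ln c <= \sum_(l < n) log_kernel eta (e n) (e l).
  rewrite -ln_prod; last by move=> i; rewrite lt_max eta0 orbT.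
  rewrite mulr_natl -lnXn // ler_ln ?posrE ?exprn_gt0 //.
    apply: (le_trans (H n)); apply: ler_prod => i _.
    by rewrite modulus_ge0 le_max lexx.
  by apply: prodr_gt0 => i _; rewrite lt_max eta0 orbT.
rewrite big_ord_recr /=.
under eq_bigr do rewrite big_ord_recr /=.
rewrite big_split /= big_ord_recr /=.
have -> : \sum_(i < n) log_kernel eta (e i) (e n) = \sum_(l < n) log_kernel eta (e n) (e l).
  by apply: eq_bigr => l _; exact: log_kernelC.
have -> : log_kernel eta (e n) (e n) = ln eta.
  by rewrite /log_kernel subrr modulus0 max_r // ltW.
have -> : n.+1%:R * (n.+1%:R - 1) * ln c + n.+1%:R * ln eta =
  (n%:R * (n%:R - 1) * ln c + n%:R * ln eta) + 2 * (n%:R * ln c) + ln eta :> R.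
  by rewrite -natr1; ring.
lra.
Qed.

End LogKernel.

Lemma cvg_ord_sum {R : realType} {T : Type} (U : set_system T) (UF : ProperFilter U) (m : nat)
    (f : 'I_m -> T -> R) (l : 'I_m -> R) : (forall i, f i x @[x --> U] --> l i) ->
  (\sum_(i < m) f i x) @[x --> U] --> \sum_(i < m) l i.
Proof.
elim: m f l => [|m IH] f l H.
  rewrite big_ord0 (_ : (fun x => _) = fun=> 0); first exact: cvg_cst.
  by apply/funext => x; rewrite big_ord0.
rewrite big_ord_recr (_ : (fun x => _) =
  (fun x => \sum_(i < m) f (widen_ord (leqnSn m) i) x + f ord_max x)); last first.
  by apply/funext => x; rewrite big_ord_recr.
by apply: cvgD; [apply: IH => i; exact: H|exact: H].
Qed.

Section EnergyBound.
Context {R : realType}.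
Variables (E : set R[i]^o) (B : R) (e : nat -> R[i]).
Hypotheses (clE : closed E) (EB : forall z, E z -> modulus z <= B) (eE : forall n, E (e n)).
Variable U : set_system nat.
Hypotheses (UU : UltraFilter U) (Uoo : \oo `<=` U).
Variable c : R.
Hypotheses (c0 : 0 < c) (Hc : forall n, c ^+ n <= \prod_(i < n) modulus (e n - e i)).

Local Notation K := (fun N => grid_size B N * grid_size B N)%N.
Local Notation cd := (code K (cell B e)).
Local Notation nc := (ncode K).
Local Notation w := (weight B e U).
Local Notation rp := (cell_rep B e).

Let fr n N j : R := freq n (fun k => (cd N k < j.+1)%N) - freq n (fun k => (cd N k < j)%N).

Let fr_sum n N (g : nat -> R) :
  \sum_(j < nc N) fr n N j * g j = (\sum_(k < n.+1) g (cd N k)) / n.+1%:R.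
Proof.
have frE j : fr n N j = (\sum_(k < n.+1) (cd N k == j)%:R) / n.+1%:R.
  rewrite /fr /freq -mulrBl -sumrB; congr (_ / _); apply: eq_bigr => k _.
  by rewrite ltnS leq_eqVlt; case: eqP => [->|_]; rewrite ?ltnn ?subr0 //= subrr.
under eq_bigr do rewrite frE mulrAC mulr_suml.
rewrite -mulr_suml exchange_big /=; congr (_ / _); apply: eq_bigr => k _.
have kn := code_lt _ _ (cell_lt E B e EB eE) N k.
rewrite (bigD1 (Ordinal kn)) //= eqxx mul1r big1 ?addr0 // => j jk.
by rewrite (_ : (cd N k == j) = false) ?mul0r //; apply/eqP => h; move: jk; rewrite -val_eqE /= h eqxx.
Qed.

Let fr_cvg N j : fr n N j @[n --> U] --> w N j.
Proof. by apply: cvgB; exact: limit_freq_cvg. Qed.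

(** Replacing both arguments by the representatives of their codes moves each by at most 2^-N, which
    costs 2 2^-N / eta. The averages then depend on the frequencies of finitely many codes, and pass
    to the limit along [U]. *)
Lemma weighted_log_kernel N eta : 0 < eta ->
  ln c - 2 * (2 ^+ N)^-1 / eta <=
  \sum_(i < nc N.+1) w N.+1 i * (\sum_(j < nc N.+1) w N.+1 j *
    log_kernel eta (e (rp N.+1 i)) (e (rp N.+1 j))).
Proof.
move=> eta0; set del := 2 * _ / _.
pose kap i j := log_kernel eta (e (rp N.+1 i)) (e (rp N.+1 j)).
have cv : (\sum_(i < nc N.+1) fr n N.+1 i * (\sum_(j < nc N.+1) fr n N.+1 j * kap i j))
    @[n --> U] --> \sum_(i < nc N.+1) w N.+1 i * (\sum_(j < nc N.+1) w N.+1 j * kap i j).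
  apply: cvg_ord_sum => i; apply: cvgM; first exact: fr_cvg.
  by apply: cvg_ord_sum => j; apply: cvgMr_tmp; exact: fr_cvg.
(* The bound of [sum_log_kernel] for n + 1 points, divided by (n + 1)^2. The diagonal disappears in
   the limit because [U] refines the filter at infinity. *)
have cr : (ln c + n.+1%:R^-1 * (ln eta - ln c) - del) @[n --> U] --> ln c + 0 * (ln eta - ln c) - del.
  apply: cvgB; last exact: cvg_cst.
  apply: cvgD; first exact: cvg_cst.
  apply: cvgMr_tmp => V hV; apply: Uoo; exact: (cvg_harmonic hV).
rewrite mul0r addr0 in cr.
apply: (ler_cvg_to cr cv); apply: nearW => n.
rewrite (fr_sum n N.+1 (fun i => \sum_(j < nc N.+1) fr n N.+1 j * kap i j)).
under eq_bigr do rewrite (fr_sum n N.+1 (kap _)).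
have n0 : 0 < n.+1%:R :> R by rewrite ltr0n.
rewrite -mulr_suml -mulrA -invfM ler_pdivlMr ?mulr_gt0 //.
have := sum_log_kernel e c eta n.+1 c0 eta0 Hc.
have : \sum_(k < n.+1) \sum_(l < n.+1) log_kernel eta (e k) (e l) <=
   \sum_(k < n.+1) \sum_(l < n.+1) (kap (cd N.+1 k) (cd N.+1 l) + del).
  apply: ler_sum => k _; apply: ler_sum => l _.
  apply: (le_trans (log_kernel_lip _ _ _ (e (rp N.+1 (cd N.+1 k))) (e (rp N.+1 (cd N.+1 l))) eta0)).
  rewrite lerD2l /del ler_pM2r ?invr_gt0 //.
  have := cell_rep_dist E B e EB eE N k; have := cell_rep_dist E B e EB eE N l.
  rewrite modulusBC => h1; rewrite modulusBC => h2; lra.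
under [X in _ <= X -> _]eq_bigr do rewrite big_split /= sumr_const card_ord -[del *+ _]mulr_natr.
rewrite big_split /= sumr_const card_ord -[_ *+ n.+1]mulr_natr => h1 h2.
have := le_trans h2 h1.
have -> : (ln c + n.+1%:R^-1 * (ln eta - ln c) - del) * (n.+1%:R * n.+1%:R) =
  n.+1%:R * (n.+1%:R - 1) * ln c + n.+1%:R * ln eta - del * n.+1%:R * n.+1%:R.
  by field; rewrite gt_eqF.
lra.
Qed.

End EnergyBound.

(** * Integrals of functions bounded above, possibly equal to -oo *)

Section BoundedAbove.
Local Open Scope ereal_scope.
Context d (T : measurableType d) (R : realType) (P : probability T R).

Lemma integral_cstT (C : R) : \int[P]_x (cst C%:E) x = C%:E.
Proof.
rewrite integral_cst //; transitivity (C%:E * 1); last exact: mule1.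
by congr (_ * _); exact: probability_setT.
Qed.

Lemma integral_le_cst (h : T -> \bar R) (C : R) : (0 <= C)%R -> measurable_fun setT h ->
  (forall x, h x <= C%:E) -> \int[P]_x h x <= C%:E.
Proof.
move=> C0 mh hC; rewrite integralE.
have h1 : \int[P]_x h^\+ x <= C%:E.
  apply: (@le_trans _ _ (\int[P]_x (cst C%:E) x)).
    apply: ge0_le_integral => //; first exact: measurable_funepos.
    by move=> x _; rewrite funeposE ge_max hC lee_fin.
  by rewrite integral_cstT.
apply: le_trans h1; rewrite -[leRHS]sube0; apply: leeB => //.
by apply: integral_ge0 => x _; exact: funeneg_ge0.
Qed.

Lemma leeB_swap (C : R) (x y : \bar R) : C%:E - x <= y -> C%:E - y <= x.
Proof.
case: x => [x| |]; case: y => [y| |] //=; rewrite ?leey ?leNye //.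
by rewrite -!EFinB !lee_fin; lra.
Qed.

(** Passing to the nonnegative C - h gives access to Fubini-Tonelli and monotone convergence. If C -
    h has infinite integral the left-hand side is -oo; otherwise linearity applies. *)
Lemma le_integral_bounded_above (h : T -> \bar R) (C : R) : measurable_fun setT h ->
  (forall x, h x <= C%:E) -> C%:E - \int[P]_x (C%:E - h x) <= \int[P]_x h x.
Proof.
move=> mh hC.
have mg : measurable_fun setT (fun x => C%:E - h x).
  by apply: emeasurable_funB => //; exact: measurable_cst.
have g0 x : 0 <= C%:E - h x by rewrite subre_ge0.
have [goo|goo] := ltP (\int[P]_x (C%:E - h x)) +oo; last first.
  by move: goo; rewrite leye_eq => /eqP ->; rewrite addeNy leNye.
have ig : P.-integrable setT (fun x => C%:E - h x).
  apply/integrableP; split => //.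
  by under eq_integral do rewrite gee0_abs //.
have hE x : h x = C%:E - (C%:E - h x).
  have := hC x; case: (h x) => [r _| |_] //.
  by rewrite -!EFinB subKr.
rewrite [leRHS](eq_integral (fun x => C%:E - (C%:E - h x))) => [|x _]; last exact: hE.
rewrite integralB //; last exact: finite_measure_integrable_cst.
by rewrite (integral_cstT C).
Qed.

Lemma measurable_inner_integral (h : T * T -> \bar R) : measurable_fun setT h ->
  measurable_fun setT (fun s => \int[P]_t h (s, t)).
Proof.
move=> mh; rewrite (_ : (fun s => _) = (fun s => \int[P]_t h^\+ (s, t) - \int[P]_t h^\- (s, t))).
  have mp : measurable_fun setT h^\+ by exact: measurable_funepos.
  have mn : measurable_fun setT h^\- by exact: measurable_funeneg.
  apply: emeasurable_funB.
    exact: (@measurable_fun_fubini_tonelli_F _ _ T T R P _ mp (fun x => funepos_ge0 h x)).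
  exact: (@measurable_fun_fubini_tonelli_F _ _ T T R P _ mn (fun x => funeneg_ge0 h x)).
by apply/funext => s; rewrite integralE; congr (_ - _); apply: eq_integral => t _;
  rewrite ?funeposE ?funenegE.
Qed.

Lemma le_double_integral (h : T * T -> \bar R) (C a : R) : (0 <= C)%R -> measurable_fun setT h ->
  (forall x, h x <= C%:E) ->
  \int[P]_s \int[P]_t (C%:E - h (s, t)) <= (C - a)%:E ->
  a%:E <= \int[P]_s \int[P]_t h (s, t).
Proof.
move=> C0 mh hC H.
have mhs s : measurable_fun setT (fun t => h (s, t)).
  by apply: measurableT_comp => //; exact: pair1_measurable.
have iC s : \int[P]_t h (s, t) <= C%:E by apply: integral_le_cst.
have mi := measurable_inner_integral h mh.
have mc : measurable_fun setT (fun x : T * T => C%:E - h x).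
  by apply: emeasurable_funB => //; exact: measurable_cst.
apply: le_trans (le_integral_bounded_above _ C mi iC).
have h1 : \int[P]_s (C%:E - \int[P]_t h (s, t)) <= (C - a)%:E.
  apply: le_trans H; apply: ge0_le_integral => //.
  - by move=> s _; rewrite subre_ge0.
  - by apply: emeasurable_funB => //; exact: measurable_cst.
  - exact: (measurable_inner_integral _ mc).
  move=> s _; apply: leeB_swap.
  exact: (le_integral_bounded_above _ C (mhs s) (fun t => hC (s, t))).
apply: (@le_trans _ _ (C%:E - (C - a)%:E)).
  by rewrite -EFinB lee_fin; lra.
exact: leeB.
Qed.

Lemma integral_pushforward_any d' (T' : measurableType d') (phi : {mfun T >-> T'})
    (h : T' -> \bar R) : measurable_fun setT h ->
  \int[distribution P phi]_y h y = \int[P]_x h (phi x).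
Proof.
move=> mh; rewrite integralE [RHS]integralE; congr (_ - _).
- rewrite ge0_integral_distribution; [|exact: measurable_funepos|by move=> x; exact: funepos_ge0].
  by apply: eq_integral => x _; rewrite /= !funeposE.
- rewrite ge0_integral_distribution; [|exact: measurable_funeneg|by move=> x; exact: funeneg_ge0].
  by apply: eq_integral => x _; rewrite /= !funenegE.
Qed.

End BoundedAbove.

(** * The energy of the limit distribution *)

Section LimitEnergy.
Context {R : realType}.
Variables (E : set R[i]^o) (B : R) (e : nat -> R[i]).
Hypotheses (clE : closed E) (EB : forall z, E z -> modulus z <= B) (eE : forall n, E (e n)).
Variable U : set_system nat.
Hypotheses (UU : UltraFilter U) (Uoo : \oo `<=` U).
Variable c : R.
Hypotheses (c0 : 0 < c) (Hc : forall n, c ^+ n <= \prod_(i < n) modulus (e n - e i)).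

Local Notation T := (measurableTypeR R).
Local Notation K := (fun N => grid_size B N * grid_size B N)%N.
Local Notation nc := (ncode K).
Local Notation w := (weight B e U).
Local Notation rp := (cell_rep B e).
Local Notation Y1 := (leja_limit_Re B e U).
Local Notation Y2 := (leja_limit_Im B e U).
Local Notation Y := (leja_limit B e U).
Local Notation ci := (cell_index B e U).

Let B0 : 0 <= B. Proof. exact: le_trans (modulus_ge0 _) (EB _ (eE 0)). Qed.
(** An upper bound for the kernels with eta <= 1, as points of [E] are at most 2B apart. The 1
    covers the truncation and keeps [C] nonnegative. *)
Let C : R := ln (2 * B + 1).
Let C0 : 0 <= C. Proof. by rewrite ln_ge0 //; have := B0; lra. Qed.

Let diam z z' : E z -> E z' -> modulus (z - z') <= 2 * B.
Proof. by move=> /EB h1 /EB h2; have := modulusB z z'; lra. Qed.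

Let kernel_le eta z z' : 0 < eta -> eta <= 1 -> E z -> E z' -> log_kernel eta z z' <= C.
Proof.
move=> eta0 eta1 Ez Ez'; have := diam z z' Ez Ez'; have b0 := B0 => h.
rewrite /log_kernel /C ler_ln ?posrE; [|by rewrite lt_max eta0 orbT|lra].
by rewrite ge_max; apply/andP; split; lra.
Qed.

Let mY1 : measurable_fun setT (Y1 : T -> T).
Proof. exact: (measurable_leja_limit_Re E B e EB eE U UU). Qed.
Let mY2 : measurable_fun setT (Y2 : T -> T).
Proof. exact: (measurable_leja_limit_Im E B e EB eE U UU). Qed.

Lemma measurable_modulus_plane :
  measurable_fun setT (fun p : (T * T) * (T * T) => modulus (plane p.1 - plane p.2) : T).
Proof.
rewrite (_ : (fun p => _) = (fun p : (T * T) * (T * T) =>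
   Num.sqrt ((p.1.1 - p.2.1) ^+ 2 + (p.1.2 - p.2.2) ^+ 2))); last first.
  by apply/funext => -[[a b] [a' b']]; rewrite modulusE.
apply: (measurableT_comp (f := @Num.sqrt R)).
  exact: (continuous_measurable_fun (@sqrt_continuous R)).
apply: measurable_funD; apply: measurable_funX; apply: measurable_funB.
- exact: (measurableT_comp measurable_fst measurable_fst).
- exact: (measurableT_comp measurable_fst measurable_snd).
- exact: (measurableT_comp measurable_snd measurable_fst).
- exact: (measurableT_comp measurable_snd measurable_snd).
Qed.

Lemma measurable_lne_EFin : measurable_fun setT (fun r : T => lne r%:E).
Proof.
rewrite /lne; apply: measurable_fun_ifT => /=.
- by apply: measurable_fun_ler => //; exact: measurable_cst.
- exact: measurable_cst.
- by apply/measurable_EFinP; exact: measurable_ln.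
Qed.

Let YY (s : T) : T * T := (Y1 s, Y2 s).

Let mYY : measurable_fun setT YY.
Proof. exact: measurable_fun_pair. Qed.

Let D (x : T * T) : T := modulus (Y x.1 - Y x.2).

Let mD : measurable_fun setT D.
Proof.
have m2 : measurable_fun setT (fun x : T * T => (YY x.1, YY x.2)).
  apply: measurable_fun_pair.
    exact: (measurableT_comp mYY measurable_fst).
  exact: (measurableT_comp mYY measurable_snd).
exact: (measurableT_comp measurable_modulus_plane m2).
Qed.

Let kern eta (x : T * T) : R := log_kernel eta (Y x.1) (Y x.2).

Let mkern eta : measurable_fun setT (kern eta : T * T -> T).
Proof.
apply: (measurableT_comp (f := @ln R)); first exact: measurable_ln.
by apply: measurable_maxr; [exact: mD|exact: measurable_cst].
Qed.

Let mCkern eta : measurable_fun setT (fun x : T * T => (C - kern eta x)%:E).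
Proof.
by apply/measurable_EFinP; apply: measurable_funB; [exact: measurable_cst|exact: mkern].
Qed.

Let Ckern_ge0 eta x : 0 < eta -> eta <= 1 -> 0 <= C - kern eta x.
Proof.
move=> eta0 eta1; rewrite subr_ge0; apply: kernel_le => //; exact: (leja_limit_in E B e clE EB eE U UU).
Qed.

Let integral_kern_N eta N : 0 < eta -> eta <= 1 ->
  (\int[unit_uniform]_s \int[unit_uniform]_t (C - kern eta (s, t))%:E <= (C - ln c + 6 * (2 ^+ N)^-1 / eta)%:E)%E.
Proof.
move=> eta0 eta1.
(* Each argument is within 2 2^-N of its approximation at level N + 1. Together with the 2 2^-N /
   eta of [weighted_log_kernel] this makes the factor 6. *)
pose del : R := 4 * (2 ^+ N)^-1 / eta.
have del0 : 0 <= del by rewrite /del !mulr_ge0 ?invr_ge0 ?exprn_ge0 // ltW.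
pose kap i j : R := log_kernel eta (e (rp N.+1 i)) (e (rp N.+1 j)).
pose phi i j : R := C - kap i j + del.
have phi0 i j : 0 <= phi i j by rewrite addr_ge0 // subr_ge0; exact: kernel_le.
have le_phi s t : C - kern eta (s, t) <= phi (ci N.+1 s) (ci N.+1 t).
  have h1 := leja_approx_near E B e EB eE U UU N s; have h2 := leja_approx_near E B e EB eE U UU N t.
  have := log_kernel_lip eta (e (rp N.+1 (ci N.+1 s))) (e (rp N.+1 (ci N.+1 t))) (Y s) (Y t) eta0.
  rewrite -/(leja_approx B e U N.+1 s) -/(leja_approx B e U N.+1 t) => h3.
  have h4 : (modulus (leja_approx B e U N.+1 s - Y s) + modulus (leja_approx B e U N.+1 t - Y t)) / eta <= del.
    by rewrite ler_pM2r ?invr_gt0 //; lra.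
  rewrite /phi /kap /kern /=; lra.
have inner s : (\int[unit_uniform]_t (C - kern eta (s, t))%:E <=
    (\sum_(j < nc N.+1) w N.+1 j * phi (ci N.+1 s) j)%:E)%E.
  apply: le_trans (integral_cell_index E B e EB eE U UU N.+1 (phi (ci N.+1 s)) (phi0 _)).
  apply: ge0_le_integral => //.
  - by move=> t _; rewrite lee_fin; exact: Ckern_ge0.
  - by apply: (measurableT_comp (mCkern eta)); exact: pair1_measurable.
  - by apply/measurable_EFinP; exact: (measurable_fun_cell_index E B e EB eE U UU N.+1 (phi (ci N.+1 s))).
  - by move=> t _; rewrite lee_fin.
pose psi i : R := \sum_(j < nc N.+1) w N.+1 j * phi i j.
have psi0 i : 0 <= psi i.
  by apply: sumr_ge0 => j _; rewrite mulr_ge0 // (weight_ge0 B e U UU).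
apply: (@le_trans _ _ (\int[unit_uniform]_s (psi (ci N.+1 s))%:E)%E).
  apply: ge0_le_integral => //.
  - by move=> s _; apply: integral_ge0 => t _; rewrite lee_fin; exact: Ckern_ge0.
  - apply: (@measurable_fun_fubini_tonelli_F _ _ T T R unit_uniform _ (mCkern eta)) => x.
    by rewrite lee_fin; exact: Ckern_ge0.
  - by apply/measurable_EFinP; exact: (measurable_fun_cell_index E B e EB eE U UU N.+1 psi).
apply: (le_trans (integral_cell_index E B e EB eE U UU N.+1 psi psi0)).
rewrite lee_fin.
have ws := weight_sum E B e EB eE U UU N.+1.
have psiE i : psi i = C + del - \sum_(j < nc N.+1) w N.+1 j * kap i j.
  rewrite /psi (eq_bigr (fun j : 'I__ => w N.+1 j * (C + del) - w N.+1 j * kap i j)); last first.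
    by move=> j _; rewrite /phi; ring.
  by rewrite sumrB -mulr_suml ws mul1r.
rewrite (eq_bigr (fun i : 'I__ => w N.+1 i * (C + del) -
    w N.+1 i * \sum_(j < nc N.+1) w N.+1 j * kap i j)); last first.
  by move=> i _; rewrite psiE mulrBr.
rewrite sumrB -mulr_suml ws mul1r.
have := weighted_log_kernel E B e EB eE U UU Uoo c c0 Hc N eta eta0.
rewrite -/(kap _ _) /del => h; lra.
Qed.

Let integral_kern eta : 0 < eta -> eta <= 1 ->
  (\int[unit_uniform]_s \int[unit_uniform]_t (C - kern eta (s, t))%:E <= (C - ln c)%:E)%E.
Proof.
move=> eta0 eta1; apply/lee_addgt0Pr => d d0.
have d6 : 0 < d * eta / 6 by rewrite divr_gt0 // mulr_gt0.
have [N HN] := pow2_small _ d6.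
apply: (le_trans (integral_kern_N eta N eta0 eta1)); rewrite -EFinD lee_fin lerD2l.
rewrite ler_pdivrMr //; lra.
Qed.

Let et (n : nat) : R := n.+1%:R^-1.
Let et0 n : 0 < et n. Proof. by rewrite invr_gt0 ltr0n. Qed.
Let et1 n : et n <= 1. Proof. by rewrite invf_le1 ?ltr0n // ler1n. Qed.

Let kern_nd x : nondecreasing_seq (fun n => (C - kern (et n) x)%:E).
Proof.
move=> m n mn; rewrite lee_fin lerD2l lerN2 ler_ln ?posrE ?lt_max ?et0 ?orbT //.
have : et n <= et m by rewrite lef_pV2 ?posrE ?ltr0n // ler_nat.
by move=> h; rewrite ge_max !le_max lexx /= h orbT.
Qed.

Let kern_lim x : (C - kern (et n) x)%:E @[n --> \oo] --> (C%:E - lne (D x)%:E)%E.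
Proof.
have [Dx|Dx] := ltP 0 (D x).
  rewrite lne_EFin // -EFinB; apply: cvg_near_cst.
  have [N HN] : exists N, et N < D x.
    have [N HN] := pow2_small _ Dx; exists (2 ^ N)%N.
    apply: le_lt_trans HN; rewrite lef_pV2 ?posrE ?exprn_gt0 ?ltr0n //.
    by rewrite -natrX ler_nat.
  exists N => // n /= Nn; congr (C - _)%:E; rewrite /kern /log_kernel -/(D x) max_l //.
  by apply: (le_trans _ (ltW HN)); rewrite lef_pV2 ?posrE ?ltr0n // ler_nat.
have D0 : D x = 0 by apply/le_anti; rewrite Dx modulus_ge0.
rewrite D0 [lne _]le0_lneNy //=.
rewrite (_ : (fun n => _) = (fun n => (C + ln n.+1%:R)%:E)); last first.
  apply/funext => n; congr EFin; rewrite /kern /log_kernel -/(D x) D0 max_r ?(ltW (et0 n)) //.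
  by rewrite lnV ?posrE ?ltr0n // opprK.
rewrite (_ : (C%:E - -oo)%E = +oo%E) //; apply/cvgeryP.
apply/cvgryPge => A.
have [N HN] : exists N : nat, expR (A - C) < N.+1%:R.
  exists (Num.bound (expR (A - C))); apply: (lt_trans (archi_boundP (expR_ge0 _))).
  by rewrite ltr_nat.
exists N => // n /= Nn; rewrite -lerBlDl -[A - C]expRK ler_ln ?posrE ?expR_gt0 ?ltr0n //.
by apply: (le_trans (ltW HN)); rewrite ler_nat.
Qed.

Let mG : measurable_fun setT (fun x : T * T => lne (D x)%:E).
Proof. exact: (measurableT_comp measurable_lne_EFin mD). Qed.

Let lneD_le x : (lne (D x)%:E <= C%:E)%E.
Proof.
have [Dx|Dx] := ltP 0 (D x); last by rewrite le0_lneNy ?leNye // lee_fin.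
rewrite lne_EFin // lee_fin /C ler_ln ?posrE //; last by have := B0; lra.
have XE s : E (Y s) by exact: (leja_limit_in E B e clE EB eE U UU).
have := diam _ _ (XE x.1) (XE x.2); rewrite -/(D x); lra.
Qed.

(** As the truncation 1 / (n + 1) decreases, [C] minus the kernel increases to C - log |Y(s) -
    Y(t)|, so monotone convergence, applied in t and then in s, carries the bound to the limit, even
    where the logarithm is -oo. *)
Let limit_energy : ((ln c)%:E <= \int[unit_uniform]_s \int[unit_uniform]_t lne (D (s, t))%:E)%E.
Proof.
apply: (le_double_integral _ _ _ unit_uniform _ C (ln c) C0 mG lneD_le).
have m1 s n : measurable_fun setT (fun t : T => (C - kern (et n) (s, t))%:E).
  by apply: (measurableT_comp (mCkern (et n))); exact: pair1_measurable.
have E1 s : (\int[unit_uniform]_t (C%:E - lne (D (s, t))%:E) =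
    limn (fun n => \int[unit_uniform]_t (C - kern (et n) (s, t))%:E))%E.
  rewrite -monotone_convergence //.
    by apply: eq_integral => t _; apply/esym/cvg_lim => //; exact: kern_lim.
  by move=> n t _; rewrite lee_fin; exact: Ckern_ge0.
rewrite [leLHS](eq_integral (fun s : T =>
  limn (fun n => (\int[unit_uniform]_t (C - kern (et n) (s, t))%:E)%E))) => [|s _]; last exact: E1.
have nd2 s : nondecreasing_seq (fun n => \int[unit_uniform]_t (C - kern (et n) (s, t))%:E)%E.
  move=> m n mn; apply: ge0_le_integral => //.
  - by move=> t _; rewrite lee_fin; exact: Ckern_ge0.
  - by move=> t _; exact: kern_nd.
rewrite monotone_convergence //; first 1 last.
- move=> n; apply: (@measurable_fun_fubini_tonelli_F _ _ T T R unit_uniform _ (mCkern (et n))) => x.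
  by rewrite lee_fin; exact: Ckern_ge0.
- by move=> n s _; apply: integral_ge0 => t _; rewrite lee_fin; exact: Ckern_ge0.
apply: lime_le; last by apply: nearW => n; exact: integral_kern.
apply: ereal_nondecreasing_is_cvgn => m n mn; apply: ge0_le_integral => //.
- by move=> s _; apply: integral_ge0 => t _; rewrite lee_fin; exact: Ckern_ge0.
- apply: (@measurable_fun_fubini_tonelli_F _ _ T T R unit_uniform _ (mCkern (et m))) => x.
  by rewrite lee_fin; exact: Ckern_ge0.
- apply: (@measurable_fun_fubini_tonelli_F _ _ T T R unit_uniform _ (mCkern (et n))) => x.
  by rewrite lee_fin; exact: Ckern_ge0.
- by move=> s _; exact: nd2.
Qed.

Lemma limit_measure : compact E -> exists mu, compactly_supported_in E mu /\
  ((ln c)%:E <= log_energy mu)%E.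
Proof.
move=> coE.
pose YYm := isMeasurableFun.Build _ _ _ _ YY mYY.
pose YYp : {mfun T >-> (T * T)%type} := HB.pack YY YYm.
exists (distribution unit_uniform YYp); split.
  exists E; split => //.
  rewrite /distribution /= /pushforward (_ : _ @^-1` _ = setT); first exact: probability_setT.
  by apply/seteqP; split => // s _ /=; exact: (leja_limit_in E B e clE EB eE U UU).
apply: (le_trans limit_energy); rewrite /log_energy.
have mk : measurable_fun setT (fun p : (T * T) * (T * T) => lne (modulus (plane p.1 - plane p.2))%:E).
  exact: (measurableT_comp measurable_lne_EFin measurable_modulus_plane).
rewrite integral_pushforward_any; last exact: (measurable_inner_integral _ _ _ _ _ mk).
rewrite le_eqVlt; apply/orP; left; apply/eqP; apply: eq_integral => s _.
rewrite integral_pushforward_any //.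
exact: (measurableT_comp mk (pair1_measurable (YYp s))).
Qed.

End LimitEnergy.

(** * The kernel and polynomials small off the domain *)

Section KernelBound.
Context {R : realType}.
Variables (Omega : set R[i]^o) (f : R[i]^o -> R[i]^o) (w : R[i]^o) (k : R).
Hypotheses (oOmega : open Omega) (Omegaw : Omega w).
Hypothesis holf : holomorphic_on Omega f.
Hypothesis fk : f w = k%:C.
Hypothesis intf :
  (\int[area]_(p in plane @^-1` Omega) (modulus (f (plane p)) ^+ 2)%:E <= k%:E)%E.
Variables (s : seq R[i]) (a b rho0 rho1 t : R).
Hypotheses (a0 : 0 < a) (ab : a < b) (r0 : 0 < rho0) (r01 : rho0 < rho1) (t0 : 0 < t).

Let p := \prod_(c <- s) ('X - c%:P).
Let p1 := \prod_(c <- [:: w : R[i]]) ('X - c%:P).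

Hypothesis small : forall z, modulus (z - w) <= rho1 -> ~ Omega z -> sqmod p z < a.
Hypothesis large : forall z, modulus (z - w) < rho0 -> b <= sqmod p z.
Hypothesis near_s : forall c, c \in s -> modulus (c - w) <= rho1.

Let sqmod_p1 z : sqmod p1 z = modulus (z - w) ^+ 2.
Proof. by rewrite /sqmod modulus_prod big_seq1. Qed.

Let rho1_gt0 : 0 < rho1. Proof. exact: lt_trans r01. Qed.
Let sq0 : 0 < rho0 ^+ 2. Proof. by rewrite exprn_gt0. Qed.
Let sq01 : rho0 ^+ 2 < rho1 ^+ 2.
Proof. by rewrite ltr_pXn2r ?nnegrE ?(ltW r0) ?(ltW rho1_gt0). Qed.

Let chi1 z := ramp a b (sqmod p z).
Let chi2 z := 1 - ramp (rho0 ^+ 2) (rho1 ^+ 2) (sqmod p1 z).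
Let kap1 : R[i]^o -> R[i]^o := ramp_dbar a b p.
Let kap2 : R[i]^o -> R[i]^o := ramp_dbar (rho0 ^+ 2) (rho1 ^+ 2) p1.
Let chi z := chi1 z * chi2 z.
Let kap (z : R[i]^o) : R[i]^o := kap1 z * (chi2 z)%:C - (chi1 z)%:C * kap2 z.

Let dchi2 z : exists l, wirtinger (fun z => (chi2 z)%:C) z l (- kap2 z).
Proof.
have [l wl] := wirtinger_ramp (rho0 ^+ 2) (rho1 ^+ 2) p1 sq0 sq01 z.
eexists; apply: (wirtinger_eq (wirtingerD (wirtinger_cst 1 z) (wirtingerM (wirtinger_cst (-1) z) wl))) => //.
  by move=> y; rewrite mulN1r -real_complexB.
by rewrite mul0r !add0r mulN1r.
Qed.

Let dchi z : exists l, wirtinger (fun z => (chi z)%:C) z l (kap z).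
Proof.
have [l1 w1] := wirtinger_ramp a b p a0 ab z; have [l2 w2] := dchi2 z.
eexists; apply: (wirtinger_eq (wirtingerM w1 w2)) => //.
  by move=> y; rewrite -real_complexM.
by rewrite mulrN.
Qed.

Let ckap : continuous kap.
Proof.
have c1 : continuous (fun z : R[i]^o => (chi1 z)%:C : R[i]^o).
  by move=> z; have [l /wirtinger_continuous] := wirtinger_ramp a b p a0 ab z.
have c2 : continuous (fun z : R[i]^o => (chi2 z)%:C : R[i]^o).
  by move=> z; have [l /wirtinger_continuous] := dchi2 z.
have d1 := continuous_mul _ _ (continuous_ramp_dbar a b p a0 ab) c2.
have d2 := continuous_mul _ _ c1 (continuous_ramp_dbar (rho0 ^+ 2) (rho1 ^+ 2) p1 sq0 sq01).
by move=> z; exact: (cvgB (d1 z) (d2 z)).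
Qed.

Let kap1_out z : sqmod p z <= a \/ b <= sqmod p z -> kap1 z = 0.
Proof. by move=> h; rewrite /kap1 /ramp_dbar ramp'_out // mul0r. Qed.

Let kap2_out z : modulus (z - w) <= rho0 \/ rho1 <= modulus (z - w) -> kap2 z = 0.
Proof.
move=> h; rewrite /kap2 /ramp_dbar ramp'_out ?mul0r // sqmod_p1.
by case: h => h; [left|right]; rewrite ler_pXn2r ?nnegrE ?modulus_ge0 ?(ltW r0) ?(ltW rho1_gt0).
Qed.

Let chi2_far z : rho1 <= modulus (z - w) -> chi2 z = 0.
Proof.
move=> h; rewrite /chi2 ramp_ge ?subrr // sqmod_p1.
by rewrite ler_pXn2r ?nnegrE ?modulus_ge0 ?(ltW rho1_gt0).
Qed.

Let chi_near z : modulus (z - w) < rho0 -> chi z = 1 /\ kap z = 0.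
Proof.
move=> h; have bp := large z h.
have c2 : chi2 z = 1.
  rewrite /chi2 ramp_le ?subr0 // sqmod_p1.
  by rewrite ler_pXn2r ?nnegrE ?modulus_ge0 ?(ltW r0) // ltW.
rewrite /chi /kap c2 /chi1 ramp_ge // mulr1 kap1_out; last by right.
by rewrite kap2_out ?mul0r ?mulr0 ?subrr //; left; exact: ltW.
Qed.

(** Within rho1 of w, |p|^2 < a persists near z and switches off the first factor; the strict
    inequality in [small] serves here. Farther away the second factor is zero. *)
Let chi_off z : ~ Omega z -> exists2 e : R, 0 < e &
  forall y, modulus (y - z) < e -> chi y = 0 /\ kap y = 0.
Proof.
move=> Oz; have [zw|zw] := leP (modulus (z - w)) rho1.
  have pz := small z zw Oz; have d0 : 0 < a - sqmod p z by rewrite subr_gt0.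
  have /cvgrPdist_lt/(_ _ d0)/nbhs_ballP[e0 /= e00 He] := continuous_sqmod p z.
  have eE := gt0_complexE e00.
  exists (complex.Re e0); first by rewrite -ltcR -eE.
  move=> y yz; have /He : ball (z : R[i]^o) e0 y.
    by rewrite /ball /= modulus_normE eE ltcR modulusBC.
  rewrite /= ltr_norml => /andP[h _].
  have ya : sqmod p y <= a by lra.
  rewrite /chi /kap /chi1 ramp_le // kap1_out; last by left.
  by rewrite !mul0r subrr.
exists (modulus (z - w) - rho1); first by rewrite subr_gt0.
move=> y yz; have yw : rho1 <= modulus (y - w).
  have := modulusD (z - y) (y - w); rewrite subrKA (modulusBC z y); lra.
rewrite /chi /kap chi2_far // mulr0 kap2_out; last by right.
by rewrite !mulr0 subrr.
Qed.

(** All roots, including w for the second cutoff, are within rho1 of w, and 25 is the ratio required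
    by [ramp_energy_prod]. *)
Let L := 25 * rho1.

Let chi_box z : L <= `|complex.Re (z - w)| \/ L <= `|complex.Im (z - w)| -> chi z = 0.
Proof.
move=> h; rewrite /chi chi2_far ?mulr0 //.
have r := rho1_gt0; rewrite /L in h.
by case: h => h; [have := Re_le_modulus (z - w)|have := Im_le_modulus (z - w)]; lra.
Qed.

Let Q := centered_square w L.

(** The two energies are shared out by (x + y)^2 <= (1 + t) x^2 + (1 + 1/t) y^2. The free [t]
    balances them: t = 1 in general, a large t when the first one is zero. *)
Let kap_sq z : modulus (kap z) ^+ 2 <=
  (1 + t) * modulus (kap1 z) ^+ 2 + (1 + t^-1) * modulus (kap2 z) ^+ 2.
Proof.
have /andP[h1 h2] := ramp_bounds a b a0 ab (sqmod p z).
have /andP[h3 h4] := ramp_bounds (rho0 ^+ 2) (rho1 ^+ 2) sq0 sq01 (sqmod p1 z).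
have n1 : `|chi1 z| <= 1 by rewrite ler_norml; apply/andP; split=> //; exact: le_trans h1.
have n2 : `|chi2 z| <= 1.
  rewrite /chi2; move: (ramp _ _ (sqmod p1 z)) h3 h4 => u h3 h4; rewrite ler_norml; lra.
have m1 : modulus (kap z) <= modulus (kap1 z) + modulus (kap2 z).
  rewrite /kap; apply: (le_trans (modulusB _ _)).
  rewrite (modulusM (kap1 z)) (modulusM (chi1 z)%:C) !modulus_real.
  by apply: lerD; [rewrite ler_piMr ?modulus_ge0|rewrite ler_piMl ?modulus_ge0].
have := modulus_ge0 (kap1 z); have := modulus_ge0 (kap2 z); have := modulus_ge0 (kap z).
move: m1; set x := modulus (kap1 z); set y := modulus (kap2 z); set u := modulus (kap z).
move=> uxy u0 y0 x0.
apply: (@le_trans _ _ ((x + y) ^+ 2)); first by rewrite ler_pXn2r ?nnegrE ?addr_ge0.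
have : 0 <= (t * x - y) ^+ 2 / t by rewrite divr_ge0 ?sqr_ge0 // ltW.
have -> : (t * x - y) ^+ 2 / t = t * x ^+ 2 - 2 * x * y + t^-1 * y ^+ 2 by field; rewrite gt_eqF.
lra.
Qed.

Let modulus_sq_integrable (g : R[i]^o -> R[i]^o) : continuous g ->
  area.-integrable Q (EFin \o (fun q => modulus (g (plane q)) ^+ 2)).
Proof.
move=> cg; apply: integrable_square.
have cgc : continuous (fun z : R[i]^o => (g z)^* : R[i]^o).
  by move=> z; exact: (cvg_comp _ _ (cg z) (continuous_conj _)).
have -> : (fun q : R * R => modulus (g (plane q)) ^+ 2) =
    (fun q : R * R => complex.Re (g (plane q) * (g (plane q))^*)).
  by apply/funext => q; rewrite mul_conj.
exact: (continuous_Re_plane _ (continuous_mul _ _ cg cgc)).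
Qed.

Lemma kernel_bound : pi ^+ 2 * k <= 5 / rho0 ^+ 2 *
  ((1 + t) * (size s)%:R / ln (b / a) + (1 + t^-1) / ln (rho1 ^+ 2 / rho0 ^+ 2)).
Proof.
have rr := rho1_gt0; have L0 : 0 < L by rewrite /L mulr_gt0.
have dL : rho0 <= L by have h := r01; have h0 := r0; rewrite /L; lra.
have mQ : measurable Q by exact: measurable_square.
have cB := cutoff_bound Omega f w k oOmega Omegaw holf fk intf chi kap rho0 L
  dchi ckap r0 dL chi_near chi_off chi_box.
apply: (le_trans cB).
have c1 : continuous kap1 by exact: continuous_ramp_dbar.
have c2 : continuous kap2 by exact: continuous_ramp_dbar.
have cpsi : continuous (reg_inv (rho0 ^+ 2) ('X - w%:P) : R[i]^o -> R[i]^o).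
  by move=> z; have [l /wirtinger_continuous] := wirtinger_reg_inv _ ('X - w%:P) z sq0.
have i1 := modulus_sq_integrable _ c1; have i2 := modulus_sq_integrable _ c2.
have ik := modulus_sq_integrable _ (continuous_mul _ _ ckap cpsi).
have iZ (l : R) (g : measurableTypeR R * measurableTypeR R -> R) :
    area.-integrable Q (EFin \o g) -> area.-integrable Q (EFin \o (fun q => l * g q)).
  by move=> ig; have := integrableZl mQ l ig; apply: eq_integrable => // q _.
have j1 := iZ (1 + t) _ i1; have j2 := iZ (1 + t^-1) _ i2.
have j12 := integrableD mQ j1 j2.
(* [kap] vanishes on D(w, rho0), so 1 / |z - w|^2 may be replaced by 1 / rho0^2 everywhere. *)
apply: (@le_trans _ _ (\int[area]_(q in Q) ((rho0 ^+ 2)^-1 *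
    ((1 + t) * modulus (kap1 (plane q)) ^+ 2 + (1 + t^-1) * modulus (kap2 (plane q)) ^+ 2)))).
  apply: le_Rintegral => //; first by apply: iZ.
  move=> q _; set z := plane q.
  have [zw|zw] := ltP (modulus (z - w)) rho0.
    have [_ ->] := chi_near z zw; rewrite mul0r modulus0 expr0n /=.
    rewrite mulr_ge0 ?invr_ge0 ?(ltW sq0) // addr_ge0 // mulr_ge0 ?sqr_ge0 //.
      by rewrite addr_ge0 // ltW.
    by rewrite addr_ge0 // invr_ge0 ltW.
  have zsq : rho0 ^+ 2 <= sqmod ('X - w%:P) z.
    by rewrite sqmod_XsubC ler_pXn2r ?nnegrE ?modulus_ge0 ?(ltW r0).
  rewrite (reg_inv_ge _ _ _ sq0 zsq) hornerXsubC (modulusM (kap z)) exprMn mulrC.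
  apply: ler_pM; rewrite ?sqr_ge0 //.
  rewrite [modulus _^-1]Normc.normcV -/(modulus (z - w)) exprVn.
  rewrite lef_pV2 ?posrE //; first by rewrite -sqmod_XsubC.
  by rewrite -sqmod_XsubC; exact: lt_le_trans zsq.
rewrite RintegralZl // RintegralD // !RintegralZl //.
have e1 := ramp_energy_prod s w a b L rho1 a0 ab (ltW rr) L0 (lexx _) near_s.
have near_w c : c \in [:: w : R[i]] -> modulus (c - w) <= rho1.
  by rewrite inE => /eqP ->; rewrite subrr modulus0 ltW.
have e2 := ramp_energy_prod [:: w : R[i]] w (rho0 ^+ 2) (rho1 ^+ 2) L rho1 sq0 sq01 (ltW rr) L0
  (lexx _) near_w.
have t1 : 0 < 1 + t by rewrite addr_gt0.
have t2 : 0 < 1 + t^-1 by rewrite addr_gt0 // invr_gt0.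
rewrite [5 / _]mulrC -[leRHS]mulrA ler_pM2l ?invr_gt0 // mulrDr.
apply: lerD.
  apply: (le_trans (ler_wpM2l (ltW t1) e1)).
  by rewrite le_eqVlt; apply/orP; left; apply/eqP; ring.
apply: (le_trans (ler_wpM2l (ltW t2) e2)).
by rewrite le_eqVlt /=; apply/orP; left; apply/eqP; ring.
Qed.

End KernelBound.

(** * Capacity and polynomials *)

Section Numerics.
Context {R : realType}.

(** atan t >= t - t^3 / 3 on [0, 1], and atan 1 = pi / 4. The value 8/3 is exactly what makes 18 pi
    >= 48. *)
Lemma pi_ge_8_3 : 8 / 3 <= pi :> R.
Proof.
pose F (t : R) : R := atan t - (t - t ^+ 3 / 3).
have dF (t : R) : is_derive t (1 : R) F ((1 + t ^+ 2)^-1 - (1 - t ^+ 2)).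
  have dp : is_derive t (1 : R) (horner ('X - 3^-1%:P * 'X^3)) (1 - t ^+ 2).
    have := is_derive_poly ('X - 3^-1%:P * 'X^3) t.
    by congr is_derive; rewrite !poly.derivE !hornerE /=; field.
  have -> : F = (atan : R -> R) - horner ('X - 3^-1%:P * 'X^3).
    by apply/funext => u; rewrite /F !fctE; congr (_ - _); rewrite !hornerE /=; field.
  exact: is_deriveB.
have F01 : F 0 <= F 1.
  apply: (@ger0_derive1_ndecr R F 0 1) => //.
  - move=> t _; rewrite derive1E; have [_ ->] := dF t.
    have h : 0 < 1 + t ^+ 2 by have := sqr_ge0 t; lra.
    have -> : (1 + t ^+ 2)^-1 - (1 - t ^+ 2) = (t ^+ 2) ^+ 2 / (1 + t ^+ 2).
      by field; rewrite gt_eqF.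
    by rewrite divr_ge0 ?sqr_ge0 // ltW.
  - apply: continuous_subspaceT => t; apply: differentiable_continuous.
    by apply/derivable1_diffP; have [] := dF t.
move: F01; rewrite /F atan0 atan1 expr0n expr1n /=; lra.
Qed.

(** From exp(-1/6) >= 5/6 follows e <= (6/5)^6 < 3. *)
Lemma expR1_le3 : expR 1 <= 3 :> R.
Proof.
have h := @expR_ge1Dx R (- (1 / 6)).
have h1 : 0 < expR (1 / 6) :> R by exact: expR_gt0.
have h2 : expR (1 / 6) <= 6 / 5 :> R.
  move: h; rewrite expRN => h.
  by rewrite -[expR _]invrK -[6 / 5]invrK lef_pV2 ?posrE ?invr_gt0 //; lra.
have -> : (1 : R) = (1 / 6) * 6%:R by field.
rewrite expRM_natr; apply: (@le_trans _ _ ((6 / 5) ^+ 6)).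
  by rewrite ler_pXn2r ?nnegrE ?(ltW h1).
by rewrite !exprS expr0; lra.
Qed.

(** Fourth power of exp(y) >= 1 + y at y = 7x/48, where 1 + y > 1.42 and 1.42^4 > 4. *)
Lemma expR_gt4 (x : R) : 50 / 17 < x -> 4 < expR (7 / 12 * x).
Proof.
move=> hx; have h := @expR_ge1Dx R (7 / 48 * x).
have -> : 7 / 12 * x = 7 / 48 * x * 4%:R by field.
rewrite expRM_natr; have h1 : 142 / 100 < expR (7 / 48 * x) by lra.
apply: (@lt_trans _ _ ((142 / 100) ^+ 4)); first by rewrite !exprS expr0; lra.
by rewrite ltr_pXn2r ?nnegrE ?(ltW (expR_gt0 _)) //; lra.
Qed.

End Numerics.

Section Capacity.
Context {R : realType}.

Lemma closed_bounded_compact (E : set R[i]^o) (B : R) : closed E ->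
  (forall z, E z -> modulus z <= B) -> compact E.
Proof.
move=> clE EB.
have -> : E = plane @` ((`[- B, B] `*` `[- B, B]) `&` plane @^-1` E).
  apply/seteqP; split => [z Ez|_ [p [_ /= Ep] <-] //].
  exists (complex.Re z, complex.Im z); last by case: (z).
  have := EB z Ez => h.
  have := le_trans (Re_le_modulus z) h; have := le_trans (Im_le_modulus z) h.
  rewrite !ler_norml => h1 h2; split; first by split; rewrite /= in_itv.
  by rewrite /preimage /=; case: (z) Ez.
apply: continuous_compact.
  by apply: continuous_subspaceT; exact: continuous_plane.
apply: compact_closedI; first by apply: compact_setX; exact: segment_compact.
by apply: preimage_closed => // p _; exact: continuous_plane.
Qed.

Lemma capacity_polynomial (E : set R[i]^o) (B c : R) : closed E ->
  (forall z, E z -> modulus z <= B) -> E !=set0 -> 0 < c -> (log_capacity E < c%:E)%E ->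
  exists s : seq R[i], [/\ s != [::], forall x, x \in s -> E x &
    forall z, E z -> \prod_(x <- s) modulus (z - x) < c ^+ size s].
Proof.
move=> clE EB E0 c0 capc; apply: contrapT => no.
have [e [eE He]] : exists e : nat -> R[i], (forall n, E (e n)) /\
    forall n, c ^+ n <= \prod_(i < n) modulus (e n - e i).
  apply: leja_sequence => // s s0 sE; apply: contrapT => no'.
  apply: no; exists s; split=> // z Ez; rewrite ltNge; apply/negP => h.
  by apply: no'; exists z.
have [U [UU Uoo]] : exists U : set_system nat, UltraFilter U /\ \oo `<=` U.
  exact: ultraFilterLemma.
have [mu [muE Imu]] := limit_measure E B e clE EB eE U UU Uoo c c0 He
  (closed_bounded_compact E B clE EB).
move: capc; rewrite ltNge => /negP; apply.
rewrite /log_capacity -[c]lnK ?posrE // -[(expR _)%:E]/(expeR (ln c)%:E) lee_expeR.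
by apply: (le_trans Imu); apply: ereal_sup_ubound; exists mu.
Qed.

End Capacity.

(** * Distance to the boundary *)

Section BoundaryDistance.
Context {R : realType}.
Variables (Omega : set R[i]^o) (w : R[i]^o) (delta : R).
Hypotheses (oOmega : open Omega) (Omegaw : Omega w).
Hypothesis deltaE : boundary_dist Omega w = delta%:E.

Lemma boundary_dist_gt0 : 0 < delta.
Proof.
have /nbhs_ballP[e /= e0 He] : nbhs w Omega by exact: open_nbhs_nbhs.
have eE := gt0_complexE e0.
have e1 : 0 < complex.Re e by rewrite -ltcR -eE.
suff : ((complex.Re e)%:E <= boundary_dist Omega w)%E.
  by rewrite deltaE lee_fin; exact: lt_le_trans.
apply/ereal_infP => _ [z [_ nz] <-]; rewrite lee_fin leNgt; apply/negP => zw.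
apply: nz; apply: open_nbhs_nbhs; split => //; apply: He.
by rewrite /ball /= modulus_normE eE ltcR.
Qed.

(** The distance is measured to the boundary, not to the complement. If z were outside, the first
    point of the segment from w to z not in [Omega] would be a boundary point closer to w than
    [delta]. *)
Lemma disc_in_domain z : modulus (z - w) < delta -> Omega z.
Proof.
move=> zd; apply: contrapT => Oz.
pose g (t : R) : R[i]^o := w + t%:C * (z - w).
pose N := [set t : R | 0 <= t <= 1 /\ ~ Omega (g t)].
have N1 : N 1 by split; [rewrite ler01 lexx|rewrite /g mul1r addrC subrK].
have N0 : lbound N 0 by move=> t [/andP[]].
pose t0 := inf N.
have hN : has_inf N by split; [exists 1|exists 0].
have t00 : 0 <= t0 by apply: lb_le_inf => //; exists 1.
have t01 : t0 <= 1 by apply: ge_inf => //; exists 0.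
have gd (s t : R) : modulus (g s - g t) = `|s - t| * modulus (z - w).
  rewrite -modulus_real -modulusM /g real_complexB; congr modulus; ring.
have zw0 : 0 <= modulus (z - w) by exact: modulus_ge0.
have near_g (t : R) (V : set R[i]^o) : nbhs (g t) V ->
    exists2 d : R, 0 < d & forall s, `|s - t| < d -> V (g s).
  move=> /nbhs_ballP[e /= e0 He].
  have eE := gt0_complexE e0.
  have e1 : 0 < complex.Re e by rewrite -ltcR -eE.
  have m0 : 0 < modulus (z - w) + 1 by lra.
  exists (complex.Re e / (modulus (z - w) + 1)); first by rewrite divr_gt0.
  move=> s; rewrite ltr_pdivlMr // => st; apply: He.
  rewrite /ball /= modulus_normE eE ltcR modulusBC gd.
  by apply: le_lt_trans st; rewrite ler_wpM2l //; lra.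
have Ot0 : ~ Omega (g t0).
  move=> Og; have [d d0 Hd] := near_g _ _ (open_nbhs_nbhs (conj oOmega Og)).
  have [t Nt td] := inf_adherent d0 hN.
  have t0t : t0 <= t by apply: ge_inf => //; exists 0.
  by case: Nt => _; apply; apply: Hd; rewrite ltr_norml; lra.
have bd : boundary Omega (g t0).
  split; last by move=> /interior_subset.
  move=> V /near_g[d d0 Hd].
  have t0p : 0 < t0.
    rewrite lt_def t00 andbT; apply/eqP => t0E; apply: Ot0.
    by rewrite t0E /g mul0r addr0.
  pose s := Num.max 0 (t0 - d / 2).
  have s0 : 0 <= s by rewrite le_max lexx.
  have st0 : s < t0 by rewrite gt_max t0p /=; lra.
  have sd : t0 - d / 2 <= s by rewrite le_max lexx orbT.
  exists (g s); split; last by apply: Hd; rewrite ltr_norml; lra.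
  apply: contrapT => Os.
  have : t0 <= s by apply: ge_inf; [exists 0|split=> //; lra].
  lra.
have : (boundary_dist Omega w <= (modulus (w - g t0))%:E)%E.
  by apply: ereal_inf_lbound; exists (g t0).
rewrite deltaE lee_fin.
have -> : w - g t0 = - (t0%:C * (z - w)) by rewrite /g; ring.
rewrite modulusN modulusM modulus_real ger0_norm // => h.
have : t0 * modulus (z - w) <= modulus (z - w) by rewrite ler_piMl.
lra.
Qed.

End BoundaryDistance.

(** * The kernel and capacity *)

Lemma prod_ge {R : realType} {T : eqType} (s : seq T) (d : R) (g : T -> R) : 0 <= d ->
  (forall x, x \in s -> d <= g x) -> d ^+ size s <= \prod_(x <- s) g x.
Proof.
move=> d0; elim: s => [|x s IH] H; first by rewrite big_nil.
rewrite big_cons exprS; apply: ler_pM => //; first exact: exprn_ge0.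
  by apply: H; rewrite mem_head.
by apply: IH => y ys; apply: H; rewrite inE ys orbT.
Qed.

Section DiscComplement.
Context {R : realType}.
Variables (Omega : set R[i]^o) (w : R[i]^o) (r : R).

Lemma disc_complement_closed : open Omega -> closed (disc_complement Omega w r).
Proof.
by move=> oO; rewrite /disc_complement setDE; apply: closedI;
  [exact: closed_closure|exact: open_closedC].
Qed.

Lemma disc_complement_le z : disc_complement Omega w r z -> modulus (z - w) <= r.
Proof.
move=> [clz _]; rewrite leNgt; apply/negP => rz.
have d0 : 0 < modulus (z - w) - r by rewrite subr_gt0.
have d0' : 0 < (modulus (z - w) - r)%:C by rewrite ltcR.
have [y []] := clz _ (nbhsx_ballx z _ d0').
rewrite /ball /= !modulus_normE !ltcR => wy zy.
by have := modulusD (z - y) (y - w); rewrite subrKA (modulusBC y w); lra.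
Qed.

(** A point of the circle is a limit of points moved slightly towards w, which lie in the open
    disc. *)
Lemma disc_complement_in z : 0 < r -> modulus (z - w) <= r -> ~ Omega z ->
  disc_complement Omega w r z.
Proof.
move=> r0 zr Oz; split=> // V /nbhs_ballP[e /= e0 He].
have eE := gt0_complexE e0.
have e1 : 0 < complex.Re e by rewrite -ltcR -eE.
pose eta := Num.min 1 (complex.Re e / (2 * r)).
have eta0 : 0 < eta by rewrite lt_min ltr01 divr_gt0 // mulr_gt0.
have eta1 : eta <= 1 by rewrite ge_min lexx.
have eta2 : eta * (2 * r) <= complex.Re e.
  by rewrite -ler_pdivlMr ?mulr_gt0 // ge_min lexx orbT.
pose y := z - eta%:C * (z - w).
have yz : modulus (z - y) < complex.Re e.
  have -> : z - y = eta%:C * (z - w) by rewrite /y; ring.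
  rewrite modulusM modulus_real gtr0_norm //.
  have : eta * modulus (z - w) <= eta * r by rewrite ler_pM2l.
  have : 0 < eta * r by rewrite mulr_gt0.
  lra.
have wy : modulus (w - y) < r.
  have -> : w - y = - ((1 - eta)%:C * (z - w)) by rewrite /y real_complexB; ring.
  rewrite modulusN modulusM modulus_real ger0_norm ?subr_ge0 //.
  have : (1 - eta) * modulus (z - w) <= (1 - eta) * r by rewrite ler_wpM2l // subr_ge0.
  have : 0 < eta * r by rewrite mulr_gt0.
  lra.
exists y; split; first by rewrite /ball /= modulus_normE ltcR.
by apply: He; rewrite /ball /= modulus_normE eE ltcR.
Qed.

End DiscComplement.

Section MainBounds.
Context {R : realType}.
Variables (Omega : set R[i]^o) (f : R[i]^o -> R[i]^o) (w : R[i]^o) (k r delta : R).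
Hypotheses (oOmega : open Omega) (Omegaw : Omega w).
Hypothesis holf : holomorphic_on Omega f.
Hypothesis fk : f w = k%:C.
Hypothesis intf :
  (\int[area]_(p in plane @^-1` Omega) (modulus (f (plane p)) ^+ 2)%:E <= k%:E)%E.
Hypothesis deltaE : boundary_dist Omega w = delta%:E.
Hypothesis delta_r : delta < r.

Let delta0 : 0 < delta. Proof. exact: boundary_dist_gt0 deltaE. Qed.
Let r0 : 0 < r. Proof. exact: lt_trans delta_r. Qed.

Let far z : ~ Omega z -> delta <= modulus (z - w).
Proof. by move=> Oz; rewrite leNgt; apply/negP => /(disc_in_domain Omega w delta oOmega Omegaw deltaE). Qed.

(* Without roots only the cutoff in |z - w| remains, and [kernel_bound] is used
   with a large [t]. *)
Lemma inscribed_disc_bound : pi ^+ 2 * k <= 407 / 25 / delta ^+ 2.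
Proof.
(* [rho1] < [delta] keeps the closed disc inside [Omega]. The bound is proportional to x / log x
   with x = rho1^2 / rho0^2, minimal at x = e; hence the factor exp(-1/2). *)
pose rho1 := 49 / 50 * delta; pose rho0 := rho1 * expR (- (1 / 2)).
have rho1_gt0 : 0 < rho1 by rewrite /rho1 mulr_gt0.
have rho0_gt0 : 0 < rho0 by rewrite /rho0 mulr_gt0 // expR_gt0.
have rho01 : rho0 < rho1.
  by rewrite /rho0 gtr_pMr // expR_lt1; lra.
(* The empty product is 1, so any thresholds 0 < a < b <= 1 would do: the term with log(b/a) has the
   factor [size s] = 0. *)
have lt_a : (0 : R) < 1 / 4 by lra.
have lt_b : (1 / 4 : R) < 1 / 2 by lra.
have t0 : (0 : R) < 24 by [].
have small z : modulus (z - w) <= rho1 -> ~ Omega z ->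
    sqmod (\prod_(c <- [::]) ('X - c%:P)) z < 1 / 4.
  by move=> h /far; rewrite /rho1 in h; have := delta0; lra.
have large z : modulus (z - w) < rho0 ->
    1 / 2 <= sqmod (\prod_(c <- [::]) ('X - c%:P)) z.
  by move=> _; rewrite /sqmod modulus_prod big_nil expr1n; lra.
have near_s c : c \in [::] -> modulus (c - w) <= rho1 by [].
have := kernel_bound Omega f w k oOmega Omegaw holf fk intf [::] _ _ _ _ _
  lt_a lt_b rho0_gt0 rho01 t0 small large near_s.
have rat : rho1 ^+ 2 / rho0 ^+ 2 = expR 1.
  have e2 : expR (- (1 / 2)) ^+ 2 = (expR 1)^-1 :> R.
    by rewrite -expRM_natr -expRN; congr expR; field.
  have e1 : expR 1 != 0 :> R by rewrite gt_eqF // expR_gt0.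
  rewrite /rho0; move: rho1 rho1_gt0 {rho0 rho0_gt0 rho01 small large near_s} => x x0.
  by rewrite exprMn e2; field; rewrite e1 gt_eqF.
rewrite rat expRK mulr0 mul0r add0r divr1 => /le_trans; apply.
have -> : 5 / rho0 ^+ 2 = 5 * expR 1 / rho1 ^+ 2.
  by rewrite -rat; field; rewrite !gt_eqF.
have d2 : 0 < delta ^+ 2 by rewrite exprn_gt0.
rewrite /rho1 exprMn invfM.
have -> : 5 * expR 1 * (((49 / 50) ^+ 2)^-1 * (delta ^+ 2)^-1) * (1 + 24^-1) =
  (5 * ((49 / 50) ^+ 2)^-1 * (1 + 24^-1) * expR 1) / delta ^+ 2 by ring.
rewrite ler_pM2r ?invr_gt0 //.
have e3 := @expR1_le3 R.
have : 5 * ((49 / 50) ^+ 2)^-1 * (1 + 24^-1) * expR 1 <= 5 * ((49 / 50) ^+ 2)^-1 * (1 + 24^-1) * 3 :> R.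
  by rewrite ler_wpM2l //; lra.
lra.
Qed.

(** [kernel_bound] with t = 1 and rho0 = delta/2, whence 20 = 5 / (1/2)^2. For a polynomial of
    degree m, log(b/a) is 2m log(delta / (2c)), which cancels the m of the energy and the factor 1 +
    t. *)
Lemma capacity_kernel_bound (c : R) : 0 < c -> c < delta / 2 ->
  (log_capacity (disc_complement Omega w r) < c%:E)%E ->
  pi ^+ 2 * k <= 20 / delta ^+ 2 * (1 / ln (delta / 2 / c) + 1 / ln (2 * r / delta)).
Proof.
move=> c0 cd capc; set E := disc_complement Omega w r in capc.
have d20 : 0 < delta / 2 by rewrite divr_gt0.
have EB z : E z -> modulus z <= modulus w + r.
  move=> /disc_complement_le h; have := modulusD (z - w) w; rewrite subrK; lra.
(* As delta < r, some boundary point lies in the disc, and a boundary point of an open set is not in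
   it. *)
have E0 : E !=set0.
  have : (boundary_dist Omega w < r%:E)%E by rewrite deltaE lte_fin.
  move=> /ereal_inf_lt[_ [z [_ bz] <-]]; rewrite lte_fin modulusBC => zr; exists z.
  apply: disc_complement_in => //; first exact: ltW.
  by move=> Oz; apply: bz; exact: open_nbhs_nbhs.
have [s [s0 sE sc]] := capacity_polynomial E _ c (disc_complement_closed Omega w r oOmega) EB E0 c0 capc.
have m0 : (0 < size s)%N by rewrite lt0n size_eq0.
pose m := size s; pose a := (c ^+ m) ^+ 2; pose b := ((delta / 2) ^+ m) ^+ 2.
have a0 : 0 < a by rewrite !exprn_gt0.
have ab : a < b.
  by rewrite ltr_pXn2r ?nnegrE ?exprn_ge0 ?(ltW c0) ?(ltW d20) // ltr_pXn2r ?nnegrE ?(ltW c0) ?(ltW d20).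
have rho01 : delta / 2 < r by have := delta_r; have := delta0; lra.
have small z : modulus (z - w) <= r -> ~ Omega z -> sqmod (\prod_(x <- s) ('X - x%:P)) z < a.
  move=> zr Oz; rewrite /sqmod modulus_prod ltr_pXn2r ?nnegrE ?exprn_ge0 ?(ltW c0) //.
    by apply: sc; exact: disc_complement_in.
  by apply: prodr_ge0 => x _; exact: modulus_ge0.
have large z : modulus (z - w) < delta / 2 -> b <= sqmod (\prod_(x <- s) ('X - x%:P)) z.
  move=> zd; rewrite /sqmod modulus_prod ler_pXn2r ?nnegrE ?exprn_ge0 ?(ltW d20) //; last first.
    by apply: prodr_ge0 => x _; exact: modulus_ge0.
  apply: prod_ge => [|x /sE[_ /far xd]]; first exact: ltW.
  have := modulusD (x - z) (z - w); rewrite subrKA (modulusBC x z); lra.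
have near_s x : x \in s -> modulus (x - w) <= r by move=> /sE/disc_complement_le.
have := kernel_bound Omega f w k oOmega Omegaw holf fk intf s a b (delta / 2) r 1
  a0 ab d20 rho01 ltr01 small large near_s.
have q1 : 1 < delta / 2 / c by rewrite ltr_pdivlMr // mul1r.
have q2 : 1 < 2 * r / delta by rewrite ltr_pdivlMr // mul1r; have := delta_r; have := delta0; lra.
have -> : ln (b / a) = 2 * m%:R * ln (delta / 2 / c).
  rewrite (_ : b / a = (delta / 2 / c) ^+ (m * 2)).
    rewrite lnXn; last exact: lt_trans q1.
    by rewrite -[LHS]mulr_natl natrM [_ * 2]mulrC.
  by rewrite exprM (expr_div_n (delta / 2) c) (expr_div_n ((delta / 2) ^+ m)).
have -> : ln (r ^+ 2 / (delta / 2) ^+ 2) = 2 * ln (2 * r / delta).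
  rewrite (_ : r ^+ 2 / (delta / 2) ^+ 2 = (2 * r / delta) ^+ 2).
    by rewrite lnXn ?(lt_trans ltr01 q2) // -[LHS]mulr_natl.
  by field; rewrite gt_eqF.
have l1 : 0 < ln (delta / 2 / c) by rewrite ln_gt0.
have l2 : 0 < ln (2 * r / delta) by rewrite ln_gt0.
have mp : 0 < m%:R :> R by rewrite ltr0n.
congr (_ <= _).
by move: l1 l2 mp => /gt_eqF l1 /gt_eqF l2 /gt_eqF mp; rewrite -/m; field; rewrite l1 l2 mp gt_eqF.
Qed.

End MainBounds.

(** After multiplication by pi^2 the target constant 18 / pi becomes 18 pi, which is at least 48. *)
Lemma pi_normalize {R : realType} (k N S delta : R) : 0 < delta -> 0 <= S ->
  pi ^+ 2 * k <= N / delta ^+ 2 -> N <= 48 * S -> k <= 18 / pi * (1 / delta ^+ 2) * S.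
Proof.
move=> d0 S0 kN NS; have p83 := @pi_ge_8_3 R; have p0 := pi_gt0 R.
move: (pi : R) p83 p0 kN => P p83 p0 kN.
have d2 : 0 < delta ^+ 2 by rewrite exprn_gt0.
rewrite -(ler_pM2l (exprn_gt0 2 p0)); apply: (le_trans kN).
have -> : P ^+ 2 * (18 / P * (1 / delta ^+ 2) * S) = (18 * P * S) / delta ^+ 2.
  by field; rewrite !gt_eqF.
rewrite ler_pM2r ?invr_gt0 //; apply: (le_trans NS).
by apply: ler_wpM2r => //; lra.
Qed.

Theorem theorem1p6 (R : realType) (Omega : set R[i]^o)
    (K : R[i]^o -> R[i]^o -> R[i]^o) (w : R[i]^o) (r : R)
    (domOmega : domain Omega) (KOmega : is_bergman_kernel Omega K)
    (Omegaw : Omega w) (ltr : (boundary_dist Omega w < r%:E)%E) :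
  let delta : R := fine (boundary_dist Omega w) in
  let cap : \bar R := log_capacity (disc_complement Omega w r) in
  (cap < (2 * delta)%:E)%E ->
  K w w <=
    (18 / pi * (1 / delta ^+ 2) *
      ((if cap == 0%E then 0 else 1 / ln (2 * delta / fine cap)) +
       1 / ln (2 * r / delta)))%:C.
Proof.
move=> delta cap capd.
have [oO _ _] := domOmega.
have bge0 : (0%:E <= boundary_dist Omega w)%E.
  by apply/ereal_infP => _ [z _ <-]; rewrite lee_fin; exact: modulus_ge0.
(* A real [r] above the distance rules out the value +oo, so [fine] returns the true distance. *)
have deltaE : boundary_dist Omega w = delta%:E.
  by rewrite /delta fineK // ge0_fin_numE //; exact: lt_trans ltr (ltry _).
have delta0 : 0 < delta by exact: boundary_dist_gt0 oO Omegaw deltaE.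
have delta_r : delta < r by move: ltr; rewrite deltaE lte_fin.
have [[holf L2] reproduce] := KOmega w Omegaw.
pose f := K ^~ w; pose k := complex.Re (K w w).
have L2E : (\int[area]_(p in plane @^-1` Omega) (modulus (f (plane p)) ^+ 2)%:E)%E =
    (Rintegral area (plane @^-1` Omega) (fun p => modulus (f (plane p)) ^+ 2))%:E.
  rewrite /Rintegral fineK // ge0_fin_numE //.
  by apply: integral_ge0 => p _; rewrite lee_fin sqr_ge0.
have KE : K w w = (Rintegral area (plane @^-1` Omega) (fun p => modulus (f (plane p)) ^+ 2))%:C.
  rewrite (reproduce _ (conj holf L2)) /plane_integral.
  have -> : Rintegral area (plane @^-1` Omega)
      (fun p => complex.Im (K (plane p) w * (K (plane p) w)^*)) = 0.
    rewrite (eq_Rintegral area (g := fun=> 0)); last by move=> p _; rewrite mul_conj.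
    by rewrite /Rintegral integral0.
  congr (_ +i* _); apply: (eq_Rintegral area) => p _.
  by rewrite mul_conj.
have fk : f w = k%:C by rewrite /k /f KE.
have intf : (\int[area]_(p in plane @^-1` Omega) (modulus (f (plane p)) ^+ 2)%:E <= k%:E)%E.
  by rewrite L2E /k KE.
rewrite -[K w w]/(f w) fk lecR.
have q2 : 1 < 2 * r / delta by rewrite ltr_pdivlMr // mul1r; lra.
have l2 : 0 < ln (2 * r / delta) by rewrite ln_gt0.
have cap0 : (0 <= cap)%E by exact: expeR_ge0.
have capfin : cap \is a fin_num by rewrite ge0_fin_numE //; exact: lt_trans capd (ltry _).
have q1 : cap != 0%E -> 0 < fine cap < 2 * delta.
  move=> cap1; rewrite fine_gt0 /=; last by rewrite lt_neqAle eq_sym cap1 cap0 (lt_trans capd) ?ltry.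
  by rewrite -lte_fin fineK.
set T1 := (if _ then _ else _); set T2 := 1 / ln (2 * r / delta).
have T20 : 0 < T2 by rewrite divr_gt0.
have T10 : 0 <= T1.
  rewrite /T1; case: ifPn => // /q1/andP[c0 c1]; apply: divr_ge0 => //.
  by apply: ln_ge0; rewrite ler_pdivlMr // mul1r ltW.
have S0 : 0 <= T1 + T2 by rewrite addr_ge0 // ltW.
(* The inscribed disc suffices when the right-hand side is large; otherwise
   Cap is so small that some c with Cap < c < delta / 2 has log (delta / 2 / c)
   comparable to log (2 delta / Cap). *)
have [Sbig|Ssmall] := leP (17 / 50) (T1 + T2).
  (* The threshold 17/50 fits the disc bound: 48 (17/50) = 16.32 exceeds 407/25 = 16.28. *)
  apply: (pi_normalize _ _ _ _ delta0 S0
    (inscribed_disc_bound Omega f w k delta oO Omegaw holf fk intf deltaE)); lra.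
have bound (L : R) : 0 < L -> (cap < (delta / 2 * expR (- L))%:E)%E ->
    pi ^+ 2 * k <= 20 * (1 / L + T2) / delta ^+ 2.
  move=> L0 capL.
  have c0 : 0 < delta / 2 * expR (- L) by rewrite mulr_gt0 ?divr_gt0 // expR_gt0.
  have cd : delta / 2 * expR (- L) < delta / 2.
    by rewrite gtr_pMr ?divr_gt0 // expR_lt1 oppr_lt0.
  have := capacity_kernel_bound Omega f w k r delta oO Omegaw holf fk intf deltaE delta_r _ c0 cd capL.
  have -> : delta / 2 / (delta / 2 * expR (- L)) = expR L.
    by rewrite expRN invfM invrK mulrA divff ?mul1r // gt_eqF // divr_gt0.
  by rewrite expRK -/T2 [X in _ <= X -> _]mulrAC.
have [capE|capN] := eqVneq cap 0%E.
  have T1E : T1 = 0 by rewrite /T1 capE eqxx.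
  (* With zero capacity any L > 0 is admissible; L = log(2r / delta) makes the two terms equal, and
     40 [T2] <= 48 [T2]. *)
  have := bound _ l2; rewrite capE lte_fin mulr_gt0 ?divr_gt0 ?expR_gt0 // => /(_ isT) h.
  apply: (pi_normalize _ _ _ _ delta0 S0 h); rewrite -/T2 T1E; lra.
have /andP[cp0 cp1] := q1 capN; set cp := fine cap in cp0 cp1.
have T1E : T1 = 1 / ln (2 * delta / cp) by rewrite /T1 (negbTE capN).
pose L1 := ln (2 * delta / cp).
have r1 : 1 < 2 * delta / cp by rewrite ltr_pdivlMr // mul1r.
have L10 : 0 < L1 by rewrite /L1 ln_gt0.
(* [T2] is positive, so [T1] = 1 / [L1] alone is below 17/50. *)
have L1big : 50 / 17 < L1.
  have : T1 < 17 / 50 by lra.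
  rewrite T1E -/L1 ltr_pdivrMr // => h; lra.
have e4 := expR_gt4 L1 L1big.
(* The choice c = (delta/2) exp(-5 [L1] / 12) exceeds Cap = 2 delta exp(-[L1]) exactly when exp(7
   [L1] / 12) > 4, and 5/12 is the smallest fraction allowed by 20 (12/5) = 48. *)
have L0 : 0 < 5 / 12 * L1 by rewrite mulr_gt0.
have cpE : cp = 2 * delta * expR (- L1).
  by rewrite expRN /L1 lnK ?posrE ?(lt_trans _ r1) //; field; rewrite !gt_eqF.
have capL : (cap < (delta / 2 * expR (- (5 / 12 * L1)))%:E)%E.
  rewrite -(fineK capfin) lte_fin -/cp cpE.
  have -> : - (5 / 12 * L1) = 7 / 12 * L1 + - L1 by field.
  rewrite expRD mulrA ltr_pM2r ?expR_gt0 //.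
  have : delta / 2 * 4 < delta / 2 * expR (7 / 12 * L1) by rewrite ltr_pM2l // divr_gt0.
  lra.
apply: (pi_normalize _ _ _ _ delta0 S0 (bound _ L0 capL)).
have -> : 1 / (5 / 12 * L1) = 12 / 5 * T1 by rewrite T1E -/L1; field; rewrite gt_eqF.
lra.
Qed.
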